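(* Let $T>0$ and $h>0$. (i) (Brownian bridge from $0$ to $y\in\mathbb{R}$ of length $T$.) If $|y|\ge h$, then $$\mathbb{E}_{0,T,y}[\mathcal{T}_{(-h,h)}]=\int_0^T\int_{-h}^h\frac{p_{T-t}(z,y)}{p_T(0,y)}\,\Delta(z,h,t)\,dz\,dt,$$ and moreover, for every fixed $y\neq0$, $$\lim_{h\downarrow0}h^{-2}\,\mathbb{E}_{0,T,y}[\mathcal{T}_{(-h,h)}]=1.$$ (ii) (3-dimensional Bessel bridge from $x$ to $y$ of length $T$.) If $x>h$, $y>0$ and $y\notin(x-h,x+h)$, then $$\mathbb{E}^{(3)}_{x,T,y}[\mathcal{T}_{(x-h,x+h)}]=\int_0^T\int_{-h}^h\frac{z+x}{x}\,\Delta(z,h,t)\,\frac{r^{(3)}_{T-t}(z+x,y)}{r^{(3)}_T(x,y)}\,dz\,dt,$$ and moreover, for fixed $x>0$ and $y>0$ with $y\ne x$, $$\lim_{h\downarrow0}h^{-2}\,\mathbb{E}^{(3)}_{x,T,y}[\mathcal{T}_{(x-h,x+h)}]=1.$$ (iii) If $y\in(-h,h)$, then $\mathbb{E}_{0,T,y}[\mathcal{T}_{(-h,h)}]=\infty$; and if $x>h$, $y>0$ and $y\in(x-h,x+h)$, then $\mathbb{E}^{(3)}_{x,T,y}[\mathcal{T}_{(x-h,x+h)}]=\infty$.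
   Context: $p_t(x,y)=\frac{1}{\sqrt{2\pi t}}e^{-(x-y)^2/(2t)}$ is the transition density (with respect to Lebesgue measure) of standard Brownian motion. For $x,y>0$, $$r^{(3)}_t(x,y)=\frac{y}{x}\big(p_t(x,y)-p_t(x,-y)\big)$$ is the transition density (with respect to Lebesgue measure) of the 3-dimensional Bessel process. For $|z|<h$, $t>0$, $$\Delta(z,h,t):=\frac1{\sqrt{2\pi t}}\sum_{m=-\infty}^\infty\Big(e^{-\frac{(z+4mh)^2}{2t}}-e^{-\frac{(z+2h(2m+1))^2}{2t}}\Big).$$ The Brownian bridge from $x$ to $y$ of length $T$ has law $\mathbb{P}_{x,T,y}$ and expectation $\mathbb{E}_{x,T,y}$; the 3-dimensional Bessel bridge from $x>0$ to $y>0$ of length $T$ has expectation $\mathbb{E}^{(3)}_{x,T,y}$. Each is the underlying process (Brownian motion, resp. 3-dimensional Bessel process) started at $x$ and conditioned to be at $y$ at time $T$: with $X$ the underlying process, $\mathbb{E}_x^X$ its expectation from $x$ and $q$ its transition density ($p$, resp. $r^{(3)}$), the bridge law of an event $A_t$ depending on the path up to time $t<T$ is $\mathbb{E}^X_x\big[\frac{q_{T-t}(X_t,y)}{q_T(x,y)};A_t\big]$, and the bridge takes the value $y$ at time $T$. For a continuous process $X$ (for a bridge, on the time interval $[0,T]$), $\mathcal{T}_{(a,b)}:=\inf\{t>0:X_t\notin(a,b)\}$, with $\mathcal{T}_{(a,b)}:=\infty$ if this set is empty. *)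

(* Defs.v *)
From HB Require Import structures.
From mathcomp Require Import all_boot all_order all_algebra.
From mathcomp Require Import all_classical all_reals all_analysis.

Set Implicit Arguments.
Unset Strict Implicit.
Unset Printing Implicit Defensive.
Import Order.TTheory GRing.Theory Num.Theory numFieldNormedType.Exports.
Local Open Scope classical_set_scope.
Local Open Scope ring_scope.

Section Densities.
Context {R : realType}.
Implicit Types (t x y z h : R).

Definition bm_density t x y : R :=
  (Num.sqrt (2 * pi * t))^-1 * expR (- (x - y) ^+ 2 / (2 * t)).

(** Meaningful for [0 < x] and [0 < y] only. *)
Definition bes3_density t x y : R :=
  y / x * (bm_density t x y - bm_density t x (- y)).

(** Sum over all integers, as the sum of the two half-series [m >= 0] and
    [m < 0]; it is the usual bilateral sum when both half-series converge. *)
Definition bilateral_sum (f : int -> R) : R :=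
  limn (series (fun n : nat => f n%:Z)) +
  limn (series (fun n : nat => f (- n.+1%:Z))).

Definition Delta z h t : R :=
  (Num.sqrt (2 * pi * t))^-1 *
  bilateral_sum (fun m : int =>
    expR (- (z + 4 * m%:~R * h) ^+ 2 / (2 * t)) -
    expR (- (z + 2 * h * (2 * m%:~R + 1)) ^+ 2 / (2 * t))).

(** The events on paths [R -> R] that only depend on the times in [[0, t]]. *)
Definition path_events t : set (set (R -> R)) :=
  <<s [set A | exists (s : R) (U : set R), [/\ 0 <= s <= t, measurable U &
                 A = [set w : R -> R | U (w s)]] ] >>.

(** First exit time from [(a, b)] of a path on the time interval [[0, T]];
    the infimum of the empty set is [+oo]. *)
Definition exit_time (T a b : R) (w : R -> R) : \bar R :=
  ereal_inf [set t%:E | t in [set t : R | 0 < t <= T /\ ~ (a < w t < b)]].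

End Densities.

Section Processes.
Context {R : realType}.

(** Time-homogeneous Markov process with continuous paths, started at [x], whose
    transition density [q] lives on the state space [D]: for [s < t],
    P(X_t in U | F_s) = int_(U /\ D) q_(t-s)(X_s, z) dz, where F_s is generated
    by the path up to time [s].  Only the values [X t] with [0 <= t] matter.
    When [q t z] has integral 1 over [D] for every [z] in [D], [X t] lies in [D]
    almost surely, so the values of [q] outside [D] are irrelevant. *)
Record markov_process d (S : measurableType d) (P : probability S R)
    (D : set R) (q : R -> R -> R -> R) (x : R) (X : R -> {RV P >-> R}) : Prop :=
  MarkovProcess {
    markov_continuous : forall w,
      {within `[0, +oo[, continuous (fun t : R => X t w)};
    markov_start : {ae P, forall w, X 0 w = x};
    markov_transition : forall (s t : R) (A : set (R -> R)) (U : set R),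
      0 <= s < t -> path_events s A -> measurable U ->
      P [set w | A (fun u => X u w) /\ U (X t w)] =
      (\int[P]_(w in [set w | A (fun u => X u w)])
         \int[lebesgue_measure]_(z in U `&` D) (q (t - s) (X s w) z)%:E)%E }.

Definition brownian_motion d (S : measurableType d) (P : probability S R)
    (x : R) (X : R -> {RV P >-> R}) : Prop :=
  markov_process setT bm_density x X.

Definition bessel3_process d (S : measurableType d) (P : probability S R)
    (x : R) (X : R -> {RV P >-> R}) : Prop :=
  markov_process [set z | 0 < z] bes3_density x X.

(** [B] is the process [X], with transition density [q] and started at [x],
    conditioned to be at [y] at time [T]; it may live on another probability
    space.  Only the values [B t] with [0 <= t <= T] matter. *)
Record bridge_of d (S : measurableType d) (P : probability S R)
    (X : R -> {RV P >-> R}) (q : R -> R -> R -> R) (T x y : R)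
    d' (S' : measurableType d') (P' : probability S' R)
    (B : R -> {RV P' >-> R}) : Prop :=
  BridgeOf {
    bridge_continuous : forall w,
      {within `[0, T], continuous (fun t : R => B t w)};
    bridge_end : {ae P', forall w, B T w = y};
    bridge_law : forall (t : R) (A : set (R -> R)),
      0 <= t < T -> path_events t A ->
      P' [set w | A (fun u => B u w)] =
      (\int[P]_(w in [set w | A (fun u => X u w)])
         (q (T - t) (X t w) y / q T x y)%:E)%E }.

Definition brownian_bridge (T x y : R)
    d' (S' : measurableType d') (P' : probability S' R)
    (B : R -> {RV P' >-> R}) : Prop :=
  exists (d : measure_display) (S : measurableType d) (P : probability S R)
         (X : R -> {RV P >-> R}),
    brownian_motion x X /\ bridge_of X bm_density T x y B.

Definition bessel3_bridge (T x y : R)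
    d' (S' : measurableType d') (P' : probability S' R)
    (B : R -> {RV P' >-> R}) : Prop :=
  exists (d : measure_display) (S : measurableType d) (P : probability S R)
         (X : R -> {RV P >-> R}),
    bessel3_process x X /\ bridge_of X bes3_density T x y B.

(** Expected exit time from [(a, b)], possibly [+oo]. *)
Definition mean_exit_time d (S : measurableType d) (P : probability S R)
    (B : R -> {RV P >-> R}) (T a b : R) : \bar R :=
  (\int[P]_w exit_time T a b (fun t => B t w))%E.

End Processes.

(* Main.v *)
Require Import Defs.
From HB Require Import structures.
From mathcomp Require Import all_boot all_order all_algebra.
From mathcomp Require Import all_classical all_reals all_analysis measurable_realfun.
From mathcomp Require Import zify ring lra.

(** Both processes are Brownian motion in disguise: inside the interval
    [I = (c - h, c + h)] the transition density is [w z / w a] times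
    [reflected_kernel th], with [w = 1], [th = 0] for Brownian motion and
    [w z = z], [th = 1] for the Bessel process. The proof treats both at once.

    Survival. The weight of the paths that stay in [I] up to time [t] and end at
    [z] is [w z / w c * Delta (z - c) h t] ([survival_formula]). This is the
    method of images, carried out with the Markov property at deterministic
    times only. Observed on a grid of mesh [t / n] and killed outside of a
    slightly smaller interval [J], the process is an iterated killed kernel
    ([markov_killed]). The test function [f] is extended to a function that is
    odd about both end points; its free heat flow vanishes at the end points, so
    killing a path close to them costs little, and long steps have probability
    exponentially small in [n]. Hence the killed chain follows the free flow
    ([killed_iter_images_near]), whose value at [c] is [f] integrated against the
    image series. Then the mesh tends to [0], [J] to [I], and the truncation of
    the series to infinity.

    Formulas. The bridge law multiplies this by the ratio of transition
    densities; the weights [w] cancel ([bridge_survival]). If [y] is outside of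
    [I], the exit time is at most [T] and its mean is the integral over [t] of
    the survival probabilities ([mean_exit_time_layer_cake]).

    Small intervals. Let [S t] be the integral of [Delta z h t] over [(- h, h)],
    and [W t] that of [(h ^+ 2 - z ^+ 2) * Delta z h t]. Since [Delta] solves the heat
    equation, vanishes at the ends and starts as a Dirac mass, the derivative of
    [W] is [- S] ([Delta_parabola_mass_balance]) and [W] starts at [h ^+ 2]; and
    [W <= h ^+ 2 * S] makes [W r] at most [h ^+ 4 / r]. So the integral of [S] over
    [(0, r)] is [h ^+ 2] up to [h ^+ 4 / r] ([Delta_mass_integral]). The ratio of
    transition densities is close to one near the start and bounded later, which
    gives the limit ([scaled_mean_cvg1]).

    Infinite mean. [Delta] is positive, with a bound uniform up to time [T] away
    from the ends ([Delta_lower_bound]): by a finite form of the Jacobi triple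
    product, it is a limit of products of positive factors. If [y] is in [I], the
    density of the bridge concentrates at [y] as [t] tends to [T], so the
    survival probabilities stay bounded below, and with positive probability the
    bridge never leaves [I] ([survival_to_end]). *)

Set Implicit Arguments.
Unset Strict Implicit.
Unset Printing Implicit Defensive.
Import Order.TTheory GRing.Theory Num.Theory numFieldNormedType.Exports.
Local Open Scope classical_set_scope.
Local Open Scope ring_scope.

(** * Reflection and translation of integrals *)

Section Reflection.
Context {R : realType}.
Notation mu := (@lebesgue_measure R).

Let reflection (c : R) : measurableTypeR R -> measurableTypeR R := fun y => c - y.

Let measurable_reflection (c : R) : measurable_fun setT (reflection c).
Proof. by apply: measurable_funB. Qed.

HB.instance Definition _ c := @isMeasurableFun.Build _ _ _ _
  (reflection c) (measurable_reflection c).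

Lemma lebesgue_measure_reflect (c : R) (A : set R) : measurable A ->
  pushforward mu (reflection c) A = mu A.
Proof.
move=> mA; apply/esym.
apply: lebesgue_measure_unique => //= _ [[a b]] _ <-.
rewrite /pushforward.
rewrite (_ : _ @^-1` _ = `[c - b, c - a[%classic); last first.
  by apply/seteqP; split => x /=; rewrite /reflection !in_itv /= => /andP[? ?]; apply/andP; split; lra.
rewrite !lebesgue_measure_itv/= !lte_fin.
rewrite ltrD2l ltrN2; case: ifP => // _.
by rewrite -!EFinD; congr EFin; ring.
Qed.

Lemma ge0_integral_reflect (c : R) (f : R -> \bar R) : measurable_fun setT f ->
  (forall x, 0 <= f x)%E -> (\int[mu]_x f (c - x)%R = \int[mu]_x f x)%E.
Proof.
move=> mf f0.
transitivity (\int[pushforward mu (reflection c)]_x f x)%E.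
  by rewrite ge0_integral_pushforward ?preimage_setT//; exact: measurable_reflection.
by apply: eq_measure_integral => A mA _; exact: lebesgue_measure_reflect.
Qed.

Lemma integral_reflect (c : R) (f : R -> \bar R) : measurable_fun setT f ->
  (\int[mu]_x f (c - x)%R = \int[mu]_x f x)%E.
Proof.
move=> mf; rewrite integralE [RHS]integralE; congr (_ - _)%E.
  rewrite -(ge0_integral_reflect c (measurable_funepos mf)) => [|x]; last exact: funepos_ge0.
  by apply: eq_integral => x _; rewrite !funeposE.
rewrite -(ge0_integral_reflect c (measurable_funeneg mf)) => [|x]; last exact: funeneg_ge0.
by apply: eq_integral => x _; rewrite !funenegE.
Qed.

Lemma integral_shift (c : R) (f : R -> \bar R) : measurable_fun setT f ->
  (\int[mu]_x f (c + x)%R = \int[mu]_x f x)%E.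
Proof.
move=> mf.
have mf' : measurable_fun setT (fun x : R => f (c - x)).
  apply: (measurableT_comp mf); exact: measurable_reflection.
rewrite -(integral_reflect c mf) -(integral_reflect 0 mf').
by apply: eq_integral => x _; congr f; ring.
Qed.

Lemma Rintegral_reflect (c : R) (f : R -> R) : measurable_fun setT f ->
  \int[mu]_x f (c - x) = \int[mu]_x f x.
Proof.
move=> mf; congr fine; apply: (integral_reflect c (f := EFin \o f)).
exact/measurable_EFinP.
Qed.

Lemma Rintegral_shift (c : R) (f : R -> R) : measurable_fun setT f ->
  \int[mu]_x f (c + x) = \int[mu]_x f x.
Proof.
move=> mf; congr fine; apply: (integral_shift c (f := EFin \o f)).
exact/measurable_EFinP.
Qed.

End Reflection.

(** * The Gaussian kernel *)

Section Gaussian.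
Context {R : realType}.
Notation mu := (@lebesgue_measure R).
Notation p := (@bm_density R).
Implicit Types a b c s t x y z C L : R.

Lemma bm_densityE t x : 0 < t -> p t x = normal_pdf x (Num.sqrt t).
Proof.
move=> t0; apply/funext => y.
rewrite normal_pdfE ?gt_eqF ?sqrtr_gt0// /bm_density /normal_peak /normal_fun.
rewrite sqr_sqrtr ?ltW//; congr ((Num.sqrt _)^-1 * expR _).
  by rewrite -mulr_natl; ring.
by rewrite -sqrrN opprB mulr_natl.
Qed.

Lemma bm_density_ge0 t x y : 0 <= p t x y.
Proof. by rewrite mulr_ge0 ?expR_ge0// invr_ge0 sqrtr_ge0. Qed.

Lemma bm_density_gt0 t x y : 0 < t -> 0 < p t x y.
Proof.
by move=> t0; rewrite mulr_gt0 ?expR_gt0// invr_gt0 sqrtr_gt0 !mulr_gt0 ?pi_gt0.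
Qed.

Lemma bm_densityC t x y : p t x y = p t y x.
Proof. by rewrite /bm_density -sqrrN opprB. Qed.

Lemma bm_density_diff t x y x' y' : (x - y) ^+ 2 = (x' - y') ^+ 2 -> p t x y = p t x' y'.
Proof. by rewrite /bm_density => ->. Qed.

Lemma measurable_bm_density t x : measurable_fun setT (p t x).
Proof.
apply: measurable_funM => //; apply: measurableT_comp => //; apply: measurable_funM => //.
apply: measurableT_comp => //; apply: measurable_funX; exact: measurable_funB.
Qed.

Lemma integral_bm_density t x : 0 < t -> (\int[mu]_y (p t x y)%:E = 1)%E.
Proof. by move=> t0; rewrite bm_densityE// integral_normal_pdf. Qed.

Lemma integrable_bm_density t x : 0 < t -> mu.-integrable setT (EFin \o p t x).
Proof. by move=> t0; rewrite bm_densityE//; exact: integrable_normal_pdf. Qed.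

Lemma integrable_bm_densityM t x (C : R) (g : R -> R) : 0 < t ->
  measurable_fun setT g -> (forall y, `|g y| <= C) ->
  mu.-integrable setT (fun y => (p t x y * g y)%:E).
Proof.
move=> t0 mg gC.
apply: (@le_integrable _ _ _ mu setT measurableT _ (fun y => (p t x y * C)%:E)).
- by apply/measurable_EFinP/measurable_funM => //; exact: measurable_bm_density.
- move=> y _; rewrite lee_fin normrM (ger0_norm (bm_density_ge0 _ _ _)).
  rewrite normrM (ger0_norm (bm_density_ge0 _ _ _)) ler_wpM2l ?bm_density_ge0//.
  exact: le_trans (gC y) (ler_norm _).
- under eq_fun do rewrite EFinM.
  by apply: integrableZr => //; exact: integrable_bm_density.
Qed.

Lemma Rintegral_bm_density t x : 0 < t -> \int[mu]_y p t x y = 1.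
Proof. by move=> t0; rewrite /Rintegral integral_bm_density. Qed.

Lemma expRN_le1 (a : R) : 0 <= a -> expR (- a) <= 1.
Proof. by move=> a0; rewrite -expR0 ler_expR oppr_le0. Qed.

(** Half of the exponent provides the decay; the other half stays behind as a
    Gaussian of twice the variance, so that the bound still has finite mass. *)
Lemma bm_density_tail t x y a : 0 < t -> 0 <= a -> a <= `|x - y| ->
  p t x y <= Num.sqrt 2 * expR (- a ^+ 2 / (4 * t)) * p (2 * t) x y.
Proof.
move=> t0 a0 axy; rewrite /bm_density.
have -> : 2 * pi * (2 * t) = 2 * (2 * pi * t) :> R by ring.
have pt0 : 0 < 2 * pi * t :> R by rewrite !mulr_gt0 ?pi_gt0.
have -> : Num.sqrt (2 * (2 * pi * t)) = Num.sqrt 2 * Num.sqrt (2 * pi * t) by rewrite sqrtrM ?ler0n.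
have s2 : Num.sqrt 2 != 0 :> R by rewrite gt_eqF// sqrtr_gt0.
have -> : Num.sqrt 2 * expR (- a ^+ 2 / (4 * t)) *
  ((Num.sqrt 2 * Num.sqrt (2 * pi * t))^-1 * expR (- (x - y) ^+ 2 / (2 * (2 * t)))) =
  (Num.sqrt (2 * pi * t))^-1 * (expR (- a ^+ 2 / (4 * t)) * expR (- (x - y) ^+ 2 / (2 * (2 * t)))).
  by field; rewrite s2 gt_eqF// sqrtr_gt0.
rewrite ler_wpM2l ?invr_ge0 ?sqrtr_ge0// -expRD ler_expR.
have a2 : a ^+ 2 <= (x - y) ^+ 2 by rewrite -(real_normK (num_real (x-y))) lerXn2r ?nnegrE.
have -> : - (x - y) ^+ 2 / (2 * t) =
  - (x - y) ^+ 2 / (4 * t) + - (x - y) ^+ 2 / (2 * (2 * t)) by field; rewrite gt_eqF.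
by rewrite lerD2r ler_wpM2r ?invr_ge0 ?lerN2 ?mulr_ge0// ltW.
Qed.

(** Completing the square, the integrand is [p (s + t) x y] times a Gaussian
    density in [z]. *)
Lemma Chapman_Kolmogorov s t x y : 0 < s -> 0 < t ->
  (\int[mu]_z (p s x z * p t z y)%:E = (p (s + t) x y)%:E)%E.
Proof.
move=> s0 t0.
have st0 : 0 < s + t by apply: addr_gt0.
pose m := (t * x + s * y) / (s + t).
pose v := s * t / (s + t).
have v0 : 0 < v by rewrite divr_gt0// mulr_gt0.
have E z : p s x z * p t z y = p (s + t) x y * p v m z.
  rewrite /bm_density.
  have pi0 := @pi_gt0 R.
  rewrite mulrACA [RHS]mulrACA -!invfM -!sqrtrM; try by rewrite !mulr_ge0 ?pi_ge0// ltW.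
  rewrite -!expRD; congr (_^-1 * expR _).
    by congr Num.sqrt; rewrite /v; field; rewrite gt_eqF.
  by rewrite /v /m; field; rewrite !gt_eqF.
under eq_integral do rewrite E EFinM.
rewrite integralZl//; last exact: integrable_bm_density.
by rewrite integral_bm_density// mule1.
Qed.

End Gaussian.

(** * The heat semigroup *)

Section Heat.
Context {R : realType}.
Notation mu := (@lebesgue_measure R).
Notation p := (@bm_density R).
Implicit Types a b c s t x y z C L : R.
Implicit Types f g : R -> R.

Definition bounded_measurable C g := measurable_fun setT g /\ forall x, `|g x| <= C.

Definition bounded_lipschitz C L g :=
  (forall x, `|g x| <= C) /\ forall x y, `|g x - g y| <= L * `|x - y|.

Lemma lipschitz_continuous L g : (forall x y, `|g x - g y| <= L * `|x - y|) -> continuous g.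
Proof.
move=> gL x; apply/cvgrPdist_lt => e e0.
have L0 : 0 < `|L| + 1 by rewrite ltr_pwDr.
have d0 : 0 < e / (`|L| + 1) by rewrite divr_gt0.
near=> y.
apply: le_lt_trans (gL _ _) _.
have : `|x - y| < e / (`|L| + 1) by near: y; exact: cvgr_dist_lt.
rewrite ltr_pdivlMr// mulrC => h.
apply: le_lt_trans h; rewrite ler_wpM2r//.
by rewrite (le_trans (ler_norm _))// lerDl.
Unshelve. all: by end_near. Qed.

Lemma bounded_lipschitz_measurable C L g : bounded_lipschitz C L g -> bounded_measurable C g.
Proof.
move=> [gC gL]; split => //.
by apply: continuous_measurable_fun; exact: lipschitz_continuous gL.
Qed.

Definition heat s g x := \int[mu]_y (p s x y * g y).

Lemma heat_integrable s g x C : 0 < s -> bounded_measurable C g ->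
  mu.-integrable setT (EFin \o (fun y => p s x y * g y)).
Proof. by move=> s0 [mg gC]; exact: integrable_bm_densityM gC. Qed.

Lemma le_heat s C C' f g x : 0 < s -> bounded_measurable C f -> bounded_measurable C' g ->
  (forall y, f y <= g y) -> heat s f x <= heat s g x.
Proof.
move=> s0 bf bg fg; apply: le_Rintegral => //; first exact: heat_integrable bf.
  exact: heat_integrable bg.
by move=> y _; rewrite ler_wpM2l ?bm_density_ge0.
Qed.

Lemma heatD s C C' f g x : 0 < s -> bounded_measurable C f -> bounded_measurable C' g ->
  heat s (f \+ g) x = heat s f x + heat s g x.
Proof.
move=> s0 bf bg; rewrite /heat -RintegralD//; last 2 first.
- exact: heat_integrable bf.
- exact: heat_integrable bg.
by apply: eq_Rintegral => y _; rewrite /= mulrDr.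
Qed.

Lemma heatB s C C' f g x : 0 < s -> bounded_measurable C f -> bounded_measurable C' g ->
  heat s (f \- g) x = heat s f x - heat s g x.
Proof.
move=> s0 bf bg; rewrite /heat -RintegralB//; last 2 first.
- exact: heat_integrable bf.
- exact: heat_integrable bg.
by apply: eq_Rintegral => y _; rewrite /= mulrBr.
Qed.

Lemma heat_cst s c x : 0 < s -> heat s (cst c) x = c.
Proof.
move=> s0; rewrite /heat RintegralZr//; last exact: integrable_bm_density.
by rewrite Rintegral_bm_density// mul1r.
Qed.

Lemma bounded_measurable_cst c : bounded_measurable `|c| (cst c).
Proof. by split. Qed.

Lemma heatN s C g x : 0 < s -> bounded_measurable C g ->
  heat s (fun y => - g y) x = - heat s g x.
Proof.
move=> s0 bg; rewrite -[RHS]add0r -[in RHS](heat_cst 0 x s0) -(heatB x s0 (bounded_measurable_cst 0) bg).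
by apply: eq_Rintegral => y _ /=; rewrite sub0r.
Qed.

Lemma heat_bounded s C g x : 0 < s -> bounded_measurable C g -> `|heat s g x| <= C.
Proof.
move=> s0 bg; rewrite ler_norml; have [mg gC] := bg.
rewrite -{1}(heat_cst (- C) x s0) -{2}(heat_cst C x s0).
have := gC; move=> /(_ _)/ler_normlP gC'.
apply/andP; split; apply: le_heat => //; try exact: bounded_measurable_cst; try exact: bg.
  by move=> y; rewrite lerNl; have [] := gC' y.
by move=> y; have [] := gC' y.
Qed.

Lemma bm_density_shift t x y : p t x (x + y) = p t 0 y.
Proof. by apply: bm_density_diff; ring. Qed.

Lemma heat_shift s g x : measurable_fun setT g ->
  heat s g x = heat s (fun y => g (x + y)) 0.
Proof.
move=> mg; rewrite /heat -(Rintegral_shift x); last first.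
  by apply: measurable_funM => //; exact: measurable_bm_density.
by apply: eq_Rintegral => y _; rewrite bm_density_shift.
Qed.

Lemma heat_reflect s g c x : measurable_fun setT g ->
  heat s (fun y => g (c - y)) x = heat s g (c - x).
Proof.
move=> mg; rewrite /heat -(Rintegral_reflect c (f := fun y => p s (c - x) y * g y)); last first.
  by apply: measurable_funM => //; exact: measurable_bm_density.
by apply: eq_Rintegral => y _; congr (_ * _); apply: bm_density_diff; ring.
Qed.

Lemma bounded_measurable_shift C g x : bounded_measurable C g -> bounded_measurable C (fun y => g (x + y)).
Proof.
move=> [mg gC]; split => //; apply: (measurableT_comp mg).
exact: measurable_funD.
Qed.

Lemma heat_bounded_lipschitz s C L g : 0 < s -> bounded_lipschitz C L g ->
  bounded_lipschitz C L (heat s g).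
Proof.
move=> s0 gCL; have bg := bounded_lipschitz_measurable gCL.
have [gC gL] := gCL.
split=> [x|x y]; first exact: heat_bounded.
rewrite !(heat_shift s _ (proj1 bg)) -(heatB _ s0 (bounded_measurable_shift _ bg) (bounded_measurable_shift _ bg)).
apply: heat_bounded => //; split.
  by apply: measurable_funB; apply: (bounded_measurable_shift _ bg).1.
move=> z /=; apply: le_trans (gL _ _) _.
by rewrite opprD addrACA subrr addr0.
Qed.

(** The mass of the wider Gaussian of [bm_density_tail] is one. *)
Lemma heat_far s C g x a : 0 < s -> 0 <= a -> bounded_measurable C g ->
  (forall y, `|x - y| < a -> g y = 0) ->
  `|heat s g x| <= C * Num.sqrt 2 * expR (- a ^+ 2 / (4 * s)).
Proof.
move=> s0 a0 bg gx0; have [mg gC] := bg.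
have C0 : 0 <= C by apply: le_trans (gC 0).
pose K := Num.sqrt 2 * expR (- a ^+ 2 / (4 * s)).
have K0 : 0 <= K by rewrite mulr_ge0 ?sqrtr_ge0 ?expR_ge0.
have s20 : 0 < 2 * s by rewrite mulr_gt0.
apply: le_trans (le_normr_Rintegral _ _) _ => //; first exact: heat_integrable bg.
have -> : C * Num.sqrt 2 * expR (- a ^+ 2 / (4 * s)) = \int[mu]_y (p (2 * s) x y * (C * K)).
  rewrite RintegralZr//; last exact: integrable_bm_density.
  by rewrite Rintegral_bm_density// mul1r mulrA.
apply: le_Rintegral => //.
- apply: (@eq_integrable _ _ _ mu setT measurableT (EFin \o (fun y => p s x y * `|g y|))).
    by move=> y _ /=; rewrite normrM (ger0_norm (bm_density_ge0 _ _ _)).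
  apply: (@heat_integrable s _ x C) => //; split => [|y]; last by rewrite normr_id.
  exact: measurableT_comp.
- exact: (heat_integrable x s20 (bounded_measurable_cst _)).
- move=> y _; rewrite normrM (ger0_norm (bm_density_ge0 _ _ _)).
  have [xy|xy] := ltP `|x - y| a.
    by rewrite gx0// normr0 mulr0 !mulr_ge0 ?bm_density_ge0.
  apply: (@le_trans _ _ (p s x y * C)); first by rewrite ler_wpM2l ?bm_density_ge0.
  rewrite mulrA (mulrC (_ * C)) mulrA; rewrite [leRHS](_ : _ = K * p (2 * s) x y * C); last by ring.
  by rewrite ler_wpM2r//; exact: bm_density_tail.
Qed.

End Heat.

Section Joint.
Context {R : realType}.
Notation mu := (@lebesgue_measure R).
Notation p := (@bm_density R).
Implicit Types a b c s t x y z C L : R.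
Implicit Types f g : R -> R.

(** Inversion is not continuous at [0], but it is the pointwise limit of the
    continuous maps [h n]. *)
Lemma measurable_inv : measurable_fun setT (@GRing.inv R).
Proof.
pose h (n : nat) x : R := x / (x ^+ 2 + n.+1%:R^-1).
have hp n x : 0 < x ^+ 2 + n.+1%:R^-1 by rewrite ltr_wpDl// sqr_ge0.
apply: (@measurable_fun_cvg _ _ _ _ h) => [n|x _].
  apply: continuous_measurable_fun => x; apply: cvgM; first exact: cvg_id.
  apply: cvgV; first by rewrite gt_eqF.
  by apply: cvgD; [exact: sqr_continuous|exact: cvg_cst].
have [->|x0] := eqVneq x 0.
  rewrite invr0 (_ : (fun n => h n 0) = cst 0); first exact: cvg_cst.
  by apply/funext => n; rewrite /h mul0r.
rewrite (_ : x^-1 = x / (x ^+ 2 + 0)); last by rewrite addr0; field.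
apply: cvgM; first exact: cvg_cst.
apply: cvgV; first by rewrite addr0 expf_neq0.
by apply: cvgD; [exact: cvg_cst|exact: cvg_harmonic].
Qed.

Lemma measurable_sqrt : measurable_fun setT (@Num.sqrt R).
Proof. by apply: continuous_measurable_fun; exact: sqrt_continuous. Qed.

Lemma measurable_bm_density_joint d (T : measurableType d) (tau f1 f2 : T -> R) (D : set T) :
  measurable_fun D tau -> measurable_fun D f1 -> measurable_fun D f2 ->
  measurable_fun D (fun w => p (tau w) (f1 w) (f2 w)).
Proof.
move=> mt m1 m2; apply: measurable_funM.
  apply: (measurableT_comp measurable_inv); apply: (measurableT_comp measurable_sqrt).
  exact: measurable_funM.
apply: measurableT_comp => //; apply: measurable_funM.
  apply: measurableT_comp => //; apply: measurable_funX.
  exact: measurable_funB.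
apply: (measurableT_comp measurable_inv).
exact: measurable_funM.
Qed.

(** Chapman-Kolmogorov and Fubini; the absolute double integral is bounded by
    that of the constant [C]. *)
Lemma heat_heat s t g x C : 0 < s -> 0 < t -> bounded_measurable C g ->
  heat s (heat t g) x = heat (s + t) g x.
Proof.
move=> s0 t0 bg; have [mg gC] := bg.
pose F (zy : measurableTypeR R * measurableTypeR R) := (p s x zy.1 * (p t zy.1 zy.2 * g zy.2))%:E.
have mF : measurable_fun setT F.
  apply/measurable_EFinP; apply: measurable_funM.
    exact: measurable_bm_density_joint.
  apply: measurable_funM; first exact: measurable_bm_density_joint.
  exact: measurableT_comp.
have inner z : (\int[mu]_y F (z, y) = (p s x z * heat t g z)%:E)%E.
  rewrite /F /= /heat EFinM fineK; last exact/integrable_fin_num/heat_integrable.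
  rewrite -integralZl//; exact: heat_integrable bg.
have iF : (mu \x mu)%E.-integrable setT F.
  apply/integrable12ltyP => //.
  apply: (@le_lt_trans _ _ (\int[mu]_z \int[mu]_y (C%:E * (p s x z * p t z y)%:E)))%E.
    have mG : measurable_fun setT (fun zy : measurableTypeR R * measurableTypeR R =>
        (C%:E * (p s x zy.1 * p t zy.1 zy.2)%:E)%E).
      rewrite (_ : (fun _ => _) = EFin \o (fun zy => C * (p s x zy.1 * p t zy.1 zy.2))); last first.
        by apply/funext => zy.
      apply/measurable_EFinP; apply: measurable_funM => //.
      by apply: measurable_funM; exact: measurable_bm_density_joint.
    have C0 : 0 <= C by apply: le_trans (gC 0).
    have G0 zy : (0 <= C%:E * (p s x zy.1 * p t zy.1 zy.2)%:E)%E.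
      by rewrite -EFinM lee_fin !mulr_ge0 ?bm_density_ge0.
    apply: ge0_le_integral => //.
    - by move=> z _; exact: integral_ge0.
    - have mF' : measurable_fun setT (abse \o F) by exact: measurableT_comp.
      exact: (measurable_fun_fubini_tonelli_F (m2 := mu) _ mF' (fun=> abse_ge0 _)).
    - exact: (measurable_fun_fubini_tonelli_F (m2 := mu) _ mG G0).
    - move=> z _; apply: ge0_le_integral => //.
      + apply/measurable_EFinP => //; apply: measurableT_comp => //.
        rewrite /=; apply: measurable_funM => //.
        by apply: measurable_funM => //; exact: measurable_bm_density.

      + rewrite /=; apply/measurable_EFinP => //; apply: measurable_funM => //.
        by apply: measurable_funM => //; exact: measurable_bm_density.
      + move=> y _; rewrite /F /= -EFinM lee_fin mulrA normrM ger0_norm ?mulr_ge0 ?bm_density_ge0//.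
        by rewrite [leRHS]mulrC ler_wpM2l ?mulr_ge0 ?bm_density_ge0.
  have -> : (\int[mu]_z \int[mu]_y (C%:E * (p s x z * p t z y)%:E) = \int[mu]_z (p s x z * C)%:E)%E.
    apply: eq_integral => z _.
    transitivity (\int[mu]_y ((p s x z * C)%:E * (p t z y)%:E))%E.
      by apply: eq_integral => y _; rewrite -!EFinM mulrCA mulrA.
    rewrite integralZl//; last exact: integrable_bm_density.
    by rewrite integral_bm_density// mule1.
  have : mu.-integrable setT (fun z => (p s x z * C)%:E).
    exact: (heat_integrable x s0 (bounded_measurable_cst C)).
  by move=> /integrable_fin_num; rewrite ltey_eq => ->.
have FI : (\int[mu]_z (p s x z * heat t g z)%:E = \int[mu]_y \int[mu]_z F (z, y))%E.
  by rewrite -(Fubini iF); apply: eq_integral => z _; rewrite inner.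
rewrite [LHS]/heat /Rintegral FI; congr fine.
apply: eq_integral => y _.
under eq_integral => z _ do rewrite /F /= mulrA EFinM.
rewrite integralZr//; last first.
  apply/integrableP; split.
    apply/measurable_EFinP; apply: measurable_funM; exact: measurable_bm_density_joint.
  under eq_integral => z _ do rewrite /= ger0_norm ?mulr_ge0 ?bm_density_ge0//.
  by rewrite /= Chapman_Kolmogorov ?ltry.
by rewrite Chapman_Kolmogorov// -EFinM.
Qed.

Lemma iter_heat s C L g k : 0 < s -> bounded_lipschitz C L g ->
  iter k.+1 (heat s) g = heat (k.+1%:R * s) g.
Proof.
move=> s0 gCL; have bg := bounded_lipschitz_measurable gCL.
elim: k => [|k IH]; first by rewrite mul1r.
have sk0 : 0 < k.+1%:R * s by rewrite mulr_gt0.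
have -> : k.+2%:R * s = s + k.+1%:R * s by rewrite -[k.+2%:R]natr1 mulrDl mul1r addrC.
rewrite iterS IH; apply/funext => x; exact: (heat_heat x s0 sk0 bg).
Qed.

End Joint.

(** * Chains killed outside of a set *)

Section Killed.
Context {R : realType}.
Notation mu := (@lebesgue_measure R).
Notation p := (@bm_density R).
Implicit Types a b c d e s t x y z C L K : R.
Implicit Types f g u F : R -> R.

Variables (J : set R) (kap : R -> R -> R).

Definition killed_kernel x z := \1_J x * \1_J z * kap x z.

Definition killed F x := \int[mu]_z (killed_kernel x z * F z).

Variables (d : R) (d_gt0 : 0 < d).
Hypothesis mJ : measurable J.
Hypothesis mkap : measurable_fun setT (fun xz : R * R => kap xz.1 xz.2).
Hypothesis kap_ge0 : forall x z, J x -> J z -> 0 <= kap x z.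
Hypothesis kap_le : forall x z, J x -> J z -> kap x z <= p d x z.

Lemma killed_kernel_ge0 x z : 0 <= killed_kernel x z.
Proof.
rewrite /killed_kernel !indicE; case: (boolP (x \in J)) => [/set_mem Jx|]; last by rewrite !mul0r.
case: (boolP (z \in J)) => [/set_mem Jz|]; last by rewrite mulr0 !mul0r.
by rewrite !mul1r kap_ge0.
Qed.

Lemma killed_kernel_le x z : killed_kernel x z <= p d x z.
Proof.
rewrite /killed_kernel !indicE; case: (boolP (x \in J)) => [/set_mem Jx|]; last by rewrite !mul0r bm_density_ge0.
case: (boolP (z \in J)) => [/set_mem Jz|]; last by rewrite mulr0 !mul0r bm_density_ge0.
by rewrite !mul1r kap_le.
Qed.

Lemma measurable_killed_kernel2 :
  measurable_fun setT (fun xz : R * R => killed_kernel xz.1 xz.2).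
Proof.
apply: measurable_funM => //; apply: measurable_funM.
  have m1 : measurable_fun setT (\1_J : R -> R) by exact: measurable_indic.
  exact: (measurableT_comp m1 measurable_fst).
have m1 : measurable_fun setT (\1_J : R -> R) by exact: measurable_indic.
exact: (measurableT_comp m1 measurable_snd).
Qed.

Lemma measurable_killed_kernel x : measurable_fun setT (killed_kernel x).
Proof.
apply: measurable_funM; last exact: (measurableT_comp mkap (pair1_measurable x)).
by apply: measurable_funM => //; exact: measurable_indic.
Qed.

Lemma killed_integrable C F x : bounded_measurable C F ->
  mu.-integrable setT (EFin \o (fun z => killed_kernel x z * F z)).
Proof.
move=> bF; have [mF FC] := bF.
apply: (le_integrable _ _ _ (heat_integrable x d_gt0 bF)) => //.
  by apply/measurable_EFinP/measurable_funM => //; exact: measurable_killed_kernel.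
move=> z _; rewrite /= lee_fin (normrM (killed_kernel _ _)) (normrM (p _ _ _)) ler_wpM2r//.
by rewrite !ger0_norm ?killed_kernel_ge0 ?bm_density_ge0// killed_kernel_le.
Qed.

Lemma killed_ge0 F x : (forall z, 0 <= F z) -> 0 <= killed F x.
Proof. by move=> F0; apply: Rintegral_ge0 => z _; rewrite mulr_ge0 ?killed_kernel_ge0. Qed.

Lemma killed_bounded C F : (forall z, 0 <= F z) -> bounded_measurable C F ->
  bounded_measurable C (killed F).
Proof.
move=> F0 bF; have [mF FC] := bF; split.
  have mk : measurable_fun setT
      (fun xz : measurableTypeR R * measurableTypeR R => (killed_kernel xz.1 xz.2 * F xz.2)%:E).
    apply/measurable_EFinP; apply: measurable_funM; first exact: measurable_killed_kernel2.
    exact: measurableT_comp.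
  have k0 xz : (0 <= (killed_kernel xz.1 xz.2 * F xz.2)%:E)%E.
    by rewrite lee_fin mulr_ge0 ?killed_kernel_ge0.
  have := measurable_fun_fubini_tonelli_F (m2 := mu) _ mk k0.
  move=> H; apply: measurableT_comp => //; exact: H.
move=> x; rewrite ger0_norm ?killed_ge0//.
rewrite -(heat_cst C x d_gt0); apply: le_Rintegral => //.
- exact: killed_integrable bF.
- exact: (heat_integrable x d_gt0 (bounded_measurable_cst C)).
- move=> z _; rewrite ler_pM ?killed_kernel_ge0 ?killed_kernel_le//=.
  exact: le_trans (ler_norm _) (FC z).
Qed.

(* [eta] bounds the flow within [e] of the set [J], and [K] is the relative
   cost of a step that jumps further than [e] or uses the reflected part of the
   kernel; for steps of length [d] it will be exponentially small in [1 / d]. *)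
Variables (K e eta : R).
Hypothesis eta_ge0 : 0 <= eta.
Hypothesis K_ge0 : 0 <= K.
Hypothesis kap_far : forall x z, J x -> J z -> p d x z - kap x z <= K * p (2 * d) x (- z).
Hypothesis far : forall x z, e <= `|x - z| -> p d x z <= K * p (2 * d) x z.

(** From a point of [J], the error already made inside [J] is averaged with
    total weight at most one, while outside of [J] the flow [u] is small unless
    the step is long. *)
Lemma killed_heat_step C C' F u E x : eta <= E ->
  bounded_measurable C' F -> bounded_measurable C u ->
  (forall z, J z -> `|F z - u z| <= E) ->
  (forall x z, J x -> ~ J z -> `|x - z| < e -> `|u z| <= eta) ->
  J x -> `|killed F x - heat d u x| <= E + 2 * C * K.
Proof.
move=> etaE bF bu FuE uE Jx; have [mu_ uC] := bu.
have C0 : 0 <= C by apply: le_trans (uC 0).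
have E0 : 0 <= E by apply: le_trans etaE.
have d20 : 0 < 2 * d by rewrite mulr_gt0.
rewrite /killed /heat -RintegralB//; last 2 first.
- exact: killed_integrable bF.
- exact: heat_integrable bu.
pose G z := p d x z * E + (C * K) * (p (2 * d) x z + p (2 * d) (- x) z).
have i1 y : mu.-integrable setT (EFin \o p (2 * d) y) by exact: integrable_bm_density.
have iE : mu.-integrable setT (EFin \o (fun z => p d x z * E)).
  exact: (heat_integrable x d_gt0 (bounded_measurable_cst E)).
have i2 : mu.-integrable setT (EFin \o (fun z => p (2 * d) x z + p (2 * d) (- x) z)).
  by apply: (integrableD measurableT (i1 x) (i1 (- x))).
have i3 : mu.-integrable setT (EFin \o (fun z => (C * K) * (p (2 * d) x z + p (2 * d) (- x) z))).
  by apply: (integrableZl measurableT (C * K) i2).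
have iG : mu.-integrable setT (EFin \o G) by apply: (integrableD measurableT iE i3).
have -> : E + 2 * C * K = \int[mu]_z G z.
  rewrite RintegralD// RintegralZr//; last exact: integrable_bm_density.
  rewrite RintegralZl// RintegralD// !Rintegral_bm_density//; ring.
have iB : mu.-integrable setT (EFin \o (fun z => killed_kernel x z * F z - p d x z * u z)).
  by apply: (integrableB measurableT (killed_integrable x bF) (heat_integrable x d_gt0 bu)).
apply: le_trans (le_normr_Rintegral _ _) _ => //.
apply: le_Rintegral => //.
  by apply: integrable_norm.
move=> z _; rewrite /G.
have p0 s y : 0 <= p s y z by exact: bm_density_ge0.
have CK0 : 0 <= C * K by rewrite mulr_ge0.
have -> : p (2 * d) (- x) z = p (2 * d) x (- z) by apply: bm_density_diff; ring.
have p2 : 0 <= p (2 * d) x (- z) by exact: bm_density_ge0.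
have [Jz|nJz] := pselect (J z).
  rewrite /killed_kernel !indicE !mem_set// !mul1r.
  have -> : kap x z * F z - p d x z * u z = kap x z * (F z - u z) - (p d x z - kap x z) * u z by ring.
  apply: le_trans (ler_normB _ _) _; apply: lerD.
    rewrite normrM (ger0_norm (kap_ge0 Jx Jz)).
    by apply: ler_pM; rewrite ?kap_ge0 ?kap_le ?FuE.
  rewrite normrM ger0_norm ?subr_ge0 ?kap_le//.
  apply: (@le_trans _ _ (K * p (2 * d) x (- z) * C)).
    by apply: ler_pM; rewrite ?subr_ge0 ?kap_le ?kap_far.
  by rewrite mulrDr [leLHS]mulrC mulrA lerDr mulr_ge0.
rewrite /killed_kernel !indicE (memNset nJz) mulr0 !mul0r sub0r normrN normrM ger0_norm//.
have [xz|xz] := ltP `|x - z| e.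
  apply: (@le_trans _ _ (p d x z * E)).
    by rewrite ler_wpM2l// (le_trans (uE _ _ Jx nJz xz)).
  by rewrite lerDl mulr_ge0// addr_ge0.
apply: (@le_trans _ _ (K * p (2 * d) x z * C)).
  by apply: ler_pM => //; exact: far.
have -> : K * p (2 * d) x z * C = C * K * p (2 * d) x z by ring.
by rewrite mulrDr addrA addrAC lerDr addr_ge0// mulr_ge0.
Qed.

(** The errors of the steps add up, but [eta] is not multiplied by their number:
    it bounds the flow itself at each time, not an increment. *)
Lemma killed_heat_iter C C' L f g n : bounded_measurable C' f -> (forall z, 0 <= f z) ->
  bounded_lipschitz C L g -> (forall z, J z -> f z = g z) ->
  (forall k, (k < n)%N -> forall x z, J x -> ~ J z -> `|x - z| < e ->
     `|iter k (heat d) g z| <= eta) ->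
  forall x, J x -> `|iter n killed f x - iter n (heat d) g x| <= eta + n%:R * (2 * C * K).
Proof.
move=> bf f0 bg fg near.
have C0 : 0 <= C by apply: le_trans (bg.1 0).
have bfk k : bounded_measurable C' (iter k killed f) /\ forall z, 0 <= iter k killed f z.
  elim: k => [|k [IH1 IH2]]; first by split.
  by rewrite iterS; split; [exact: killed_bounded|move=> z; exact: killed_ge0].
have bgk k : bounded_lipschitz C L (iter k (heat d) g).
  by elim: k => [//|k IH]; rewrite iterS; exact: heat_bounded_lipschitz.
elim: n near => [|n IH] near x Jx.
  by rewrite /= fg// subrr normr0 mul0r addr0.
rewrite !iterS -[n.+1%:R]natr1 mulrDl mul1r addrA.
have CK : 0 <= n%:R * (2 * C * K) by rewrite !mulr_ge0.
apply: (killed_heat_step (C' := C')) => //.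
- by rewrite lerDl.
- by case: (bfk n).
- exact: (bounded_lipschitz_measurable (bgk n)).
- by move=> z Jz; apply: IH => // k kn; apply: near; rewrite ltnW.
- by apply: near.
Qed.

End Killed.

(** * The method of images *)

Section Images.
Context {R : realType}.
Notation mu := (@lebesgue_measure R).
Notation p := (@bm_density R).
Implicit Types a b d e s t x y z C L K : R.
Implicit Types f g u F : R -> R.

Lemma eq_lexx x y : x = y -> x <= y.
Proof. by move=> ->. Qed.

(** The sum over [- N <= m < N]: for this range a shift of the index changes
    the sum by two terms only. *)
Definition bilateral_partial (N : nat) (phi : int -> R) :=
  \sum_(n < N) (phi n%:Z + phi (- n.+1%:Z)).

Lemma bilateral_partial_shift N (phi : int -> R) :
  bilateral_partial N (fun m => phi (m + 1)) =
  bilateral_partial N phi + phi N%:Z - phi (- N%:Z).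
Proof.
rewrite /bilateral_partial; elim: N => [|N IH].
  by rewrite !big_ord0 oppr0 add0r subrr.
rewrite !big_ord_recr /= IH.
have -> : (- N.+1%:Z + 1 = - N%:Z)%R by rewrite -addn1 PoszD opprD addrNK.
have -> : (N%:Z + 1 = N.+1%:Z)%R by rewrite -addn1 PoszD.
ring.
Qed.

Lemma bilateral_partialB N (phi psi : int -> R) :
  bilateral_partial N (fun m => phi m - psi m) =
  bilateral_partial N phi - bilateral_partial N psi.
Proof.
by rewrite /bilateral_partial -sumrB; apply: eq_bigr => i _; ring.
Qed.

Lemma eq_bilateral_partial N (phi psi : int -> R) : phi =1 psi ->
  bilateral_partial N phi = bilateral_partial N psi.
Proof. by move=> e; apply: eq_bigr => i _; rewrite !e. Qed.

Lemma bilateral_partial_norm N (phi : int -> R) C : (forall m, `|phi m| <= C) ->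
  `|bilateral_partial N phi| <= (N%:R * 2) * C.
Proof.
move=> h; rewrite /bilateral_partial; apply: le_trans (ler_norm_sum _ _ _) _.
apply: le_trans (ler_sum _ (fun i _ => ler_normD _ _)) _.
apply: (@le_trans _ _ (\sum_(i < N) (C + C))).
  by apply: ler_sum => i _; apply: lerD.
by rewrite sumr_const card_ord -mulr_natl; apply: eq_lexx; ring.
Qed.

Variables (c h : R) (h_gt0 : 0 < h).

(** A translate of [f] by a multiple of [4 * h], minus a mirror image of [f]: the
    full sum over [m] is odd about both end points [c - h] and [c + h]. *)
Definition image_term f (m : int) z :=
  f (z - 4 * m%:~R * h) - f (2 * c - z - 2 * h * (2 * m%:~R + 1)).

Definition images f N z := bilateral_partial N (fun m => image_term f m z).

Section Props.
Variables (f : R -> R) (C0 L0 : R).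
Hypothesis fCL : bounded_lipschitz C0 L0 f.
Hypothesis f0 : forall z, h <= `|z - c| -> f z = 0.

Let C0_ge0 : 0 <= C0. Proof. exact: le_trans (fCL.1 0). Qed.

Lemma images_bounded_lipschitz N :
  bounded_lipschitz (N%:R * 2 * (2 * C0)) (N%:R * 2 * (2 * L0)) (images f N).
Proof.
have [fC fL] := fCL; split=> [z|y z].
  apply: bilateral_partial_norm => m; apply: le_trans (ler_normB _ _) _.
  by rewrite (_ : 2 * C0 = C0 + C0) ?lerD//; ring.
rewrite /images -bilateral_partialB -mulrA; apply: bilateral_partial_norm => m.
rewrite /image_term.
set A := f _; set B := f _; set A' := f _; set B' := f _.
have -> : A - B - (A' - B') = (A - A') - (B - B') by ring.
apply: le_trans (ler_normB _ _) _.
rewrite (_ : 2 * L0 * `|y - z| = L0 * `|y - z| + L0 * `|y - z|); last by ring.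
apply: lerD; (apply: le_trans (fL _ _) _).
  by apply: eq_lexx; congr (_ * `| _ |); ring.
by rewrite distrC; apply: eq_lexx; congr (_ * `| _ |); ring.
Qed.

Lemma intr_ge1 (m : int) : m != 0 -> 1 <= `|m%:~R| :> R.
Proof. by move=> m0; rewrite -intr_norm -[1]/(1%:~R) ler_int; case: m m0 => [[|n]|n]. Qed.

Lemma images_inside N z : (0 < N)%N -> `|z - c| <= h -> images f N z = f z.
Proof.
case: N => // N _ zc; rewrite /images /bilateral_partial.
have i0 (m : int) : m != 0 -> f (z - 4 * m%:~R * h) = 0.
  move=> m0; apply: f0; have := intr_ge1 m0.
  rewrite -[_ - c](addrNK (z - c)) => m1.
  have -> : z - 4 * m%:~R * h - c - (z - c) + (z - c) = (z - c) - m%:~R * (4 * h) by ring.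
  rewrite distrC; apply: le_trans (lerB_dist _ _).
  have h4 : 0 < 4 * h by rewrite mulr_gt0.
  rewrite normrM (gtr0_norm h4); nra.
have i1 (m : int) : f (2 * c - z - 2 * h * (2 * m%:~R + 1)) = 0.
  apply: f0.
  have : 1 <= `|(2 * m + 1)%:~R| :> R by apply: intr_ge1; case: m => [[|n]|[|n]].
  rewrite intrD intrM /= => m1.
  have -> : 2 * c - z - 2 * h * (2 * m%:~R + 1) - c = - ((2 * m%:~R + 1) * (2 * h) - (c - z)) by ring.
  rewrite normrN; apply: le_trans (lerB_dist _ _).
  have h2 : 0 < 2 * h by rewrite mulr_gt0.
  rewrite normrM (gtr0_norm h2) (distrC c); nra.
rewrite big_ord_recl big1 => [|i _].
  by rewrite /image_term !i1 (i0 (- _)) ?oppr_eq0// mulr0 mul0r !subr0 !addr0.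
by rewrite /image_term !i1 !i0 ?oppr_eq0// !subr0 addr0.
Qed.

(** About [c - h] the truncated sum is odd, term by term. *)
Lemma images_reflect_low N z : images f N (2 * (c - h) - z) = - images f N z.
Proof.
rewrite /images /bilateral_partial -sumrN; apply: eq_bigr => i _.
have E m : image_term f m (2 * (c - h) - z) = - image_term f m z.
  by rewrite /image_term [RHS]opprB; congr (_ - _); congr f; ring.
by rewrite !E -opprD.
Qed.

Definition image_defect N z := images f N (2 * (c + h) - z) + images f N z.

(** Reflecting at [c + h] exchanges translates and mirror images with a shift of
    the index, so that the truncation leaves four far copies of [f]. *)
Lemma image_defectE N z : image_defect N z =
  f (2 * c - z + 2 * h * (2 * N%:R + 1)) - f (2 * c - z - 2 * h * (2 * N%:R - 1))
  + f (z + 4 * N%:R * h) - f (z - 4 * N%:R * h).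
Proof.
pose A (m : int) := f (z - 4 * m%:~R * h).
pose B (m : int) := f (2 * c - z - 2 * h * (2 * m%:~R + 1)).
pose B' (m : int) := B (m - 1).
rewrite /image_defect /images.
rewrite (_ : bilateral_partial N (fun m => image_term f m z) = bilateral_partial N A - bilateral_partial N B); last first.
  exact: bilateral_partialB.
rewrite (_ : bilateral_partial N _ = bilateral_partial N B' - bilateral_partial N (fun m => A (m + 1))); last first.
  rewrite -bilateral_partialB; apply: eq_bilateral_partial => m.
  by rewrite /image_term /B' /B /A !intrD; congr (_ - _); congr f; rewrite ?intrN; ring.
rewrite (bilateral_partial_shift N A).
have : bilateral_partial N B = bilateral_partial N B' + B' N%:Z - B' (- N%:Z).
  by rewrite -bilateral_partial_shift; apply: eq_bilateral_partial => m; rewrite /B' addrK.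
move=> ->.
have -> : f (2 * c - z + 2 * h * (2 * N%:R + 1)) = B' (- N%:Z).
  by rewrite /B' /B; congr f; rewrite intrD !intrN; ring.
have -> : f (2 * c - z - 2 * h * (2 * N%:R - 1)) = B' N%:Z.
  by rewrite /B' /B; congr f; rewrite intrD intrN; ring.
have -> : f (z + 4 * N%:R * h) = A (- N%:Z).
  by rewrite /A; congr f; rewrite intrN; ring.
by rewrite /A; ring.
Qed.

Lemma image_defect_bounded N : bounded_measurable (4 * C0) (image_defect N).
Proof.
have bi := bounded_lipschitz_measurable (images_bounded_lipschitz N).
split.
  apply: measurable_funD; last exact: bi.1.
  apply: (measurableT_comp bi.1); exact: measurable_funB.
move=> z; rewrite image_defectE; have fC := fCL.1.
have -> : 4 * C0 = C0 + C0 + C0 + C0 by ring.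
apply: le_trans (ler_normB _ _) _; apply: lerD => //.
apply: le_trans (ler_normD _ _) _; apply: lerD => //.
by apply: le_trans (ler_normB _ _) _; apply: lerD.
Qed.

Lemma image_defect_far N z : (0 < N)%N -> `|c + h - z| < 4 * (N%:R - 1) * h -> image_defect N z = 0.
Proof.
move=> N0; have : 1 <= N%:R :> R by rewrite ler1n.
rewrite ltr_norml image_defectE; move: N%:R => M N1.
rewrite (_ : 4 * (M - 1) * h = 4 * (M * h) - 4 * h); last by ring.
rewrite (_ : 2 * h * (2 * M + 1) = 4 * (M * h) + 2 * h); last by ring.
rewrite (_ : 2 * h * (2 * M - 1) = 4 * (M * h) - 2 * h); last by ring.
rewrite (_ : 4 * M * h = 4 * (M * h)); last by ring.
have Nh : h <= M * h by rewrite ler_peMl// ltW.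
move: (M * h) Nh => Mh Nh /andP[z1 z2].
have hh := h_gt0.
rewrite !f0 ?subrr ?addr0 ?subrr//.
- by rewrite -normrN ler_normr; apply/orP; left; lra.
- by rewrite ler_normr; apply/orP; left; lra.
- by rewrite -normrN ler_normr; apply/orP; left; lra.
- by rewrite ler_normr; apply/orP; left; lra.
Qed.

(** The heat flow of an odd function stays odd, hence vanishes at the centre. *)
Lemma heat_images_low s N : 0 < s -> heat s (images f N) (c - h) = 0.
Proof.
move=> s0; have bi := bounded_lipschitz_measurable (images_bounded_lipschitz N).
have := heat_reflect s (2 * (c - h)) (c - h) bi.1.
rewrite (_ : (fun _ => _) = (fun y => - images f N y)); last first.
  by apply/funext => y; rewrite images_reflect_low.
rewrite (heatN _ s0 bi) (_ : 2 * (c - h) - (c - h) = c - h); last by ring.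
lra.
Qed.

(** Oddness about [c + h] fails only by the heat flow of the far defect. *)
Lemma heat_images_high s t N : 0 < s -> s <= t -> (0 < N)%N ->
  `|heat s (images f N) (c + h)| <=
  2 * C0 * Num.sqrt 2 * expR (- (4 * (N%:R - 1) * h) ^+ 2 / (4 * t)).
Proof.
move=> s0 st N0; have bi := bounded_lipschitz_measurable (images_bounded_lipschitz N).
have N1 : 0 <= 4 * (N%:R - 1) * h by apply: mulr_ge0; [apply: mulr_ge0 => //; rewrite subr_ge0 ler1n|exact: ltW].
have := heat_far s0 N1 (image_defect_bounded N) (fun y => image_defect_far N0).
rewrite (_ : image_defect N = (fun y => images f N (2 * (c + h) - y)) \+ images f N)//.
have bi' : bounded_measurable (N%:R * 2 * (2 * C0)) (fun y => images f N (2 * (c + h) - y)).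
  split; first by apply: (measurableT_comp bi.1); exact: measurable_funB.
  by move=> y; exact: (bi.2 _).
rewrite (heatD _ s0 bi' bi).
rewrite (heat_reflect _ _ _ bi.1) (_ : 2 * (c + h) - (c + h) = c + h); last by ring.
have -> : forall u : R, u + u = 2 * u by move=> u; ring.
rewrite normrM ger0_norm// => H.
have E : expR (- (4 * (N%:R - 1) * h) ^+ 2 / (4 * s)) <= expR (- (4 * (N%:R - 1) * h) ^+ 2 / (4 * t)).
  rewrite ler_expR !mulNr lerN2 ler_wpM2l ?sqr_ge0// lef_pV2 ?posrE ?mulr_gt0//; last exact: lt_le_trans st.
  by rewrite ler_wpM2l.
have s2 : 0 <= Num.sqrt 2 :> R by rewrite sqrtr_ge0.
have : 4 * C0 * Num.sqrt 2 * expR (- (4 * (N%:R - 1) * h) ^+ 2 / (4 * s)) <=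
  4 * C0 * Num.sqrt 2 * expR (- (4 * (N%:R - 1) * h) ^+ 2 / (4 * t)).
  by rewrite ler_wpM2l// !mulr_ge0.
move=> /(le_trans H); set Y := expR _ => H''.
rewrite -(ler_pM2l (ltr0Sn R 1)); apply: le_trans H'' _.
by apply: eq_lexx; ring.
Qed.

End Props.

End Images.

(** * Killed chains and the heat flow of images *)

Section KilledImages.
Context {R : realType}.
Notation mu := (@lebesgue_measure R).
Notation p := (@bm_density R).
Implicit Types a b d e s t x y z C L K : R.
Implicit Types f g u F : R -> R.

Lemma nat_expRN_cvg0 a : 0 < a -> (fun n => n.+1%:R * expR (- (a * n.+1%:R))) @ \oo --> (0 : R).
Proof.
move=> a0.
have a20 : 0 < (a / 2) ^+ 2 by rewrite exprn_gt0// divr_gt0.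
have E n : n.+1%:R * expR (- (a * n.+1%:R)) <= ((a / 2) ^+ 2)^-1 * n.+1%:R^-1.
  rewrite expRN ler_pdivrMr ?expR_gt0//.
  have n0 : 0 < n.+1%:R :> R by [].
  rewrite -mulrA ler_pdivlMl// ler_pdivlMl//.
  apply: (@le_trans _ _ ((1 + a / 2 * n.+1%:R) ^+ 2)).
    have : 0 < a * n.+1%:R by rewrite mulr_gt0.
    by move: n.+1%:R n0 => M M0 aM; nra.
  rewrite (_ : a * n.+1%:R = a / 2 * n.+1%:R + a / 2 * n.+1%:R); last by field.
  rewrite expRD -expr2 lerXn2r ?nnegrE ?expR_ge0 ?expR_ge1Dx//.
  by rewrite addr_ge0// !mulr_ge0// ltW.
apply: (@squeeze_cvgr _ _ _ _ (fun=> 0) (fun n => ((a / 2) ^+ 2)^-1 * n.+1%:R^-1)).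
- by near=> n; rewrite E andbT mulr_ge0// expR_ge0.
- exact: cvg_cst.
- rewrite -[X in _ --> X](mulr0 (((a / 2) ^+ 2)^-1)); apply: cvgM; first exact: cvg_cst.
  exact: cvg_harmonic.
Unshelve. all: by end_near. Qed.

(** The transition density of Brownian motion for [th = 0], and of Brownian motion
    killed at [0] for [th = 1]; the Bessel density is [z / x] times the latter. *)
Definition reflected_kernel th d x z := p d x z - th * p d x (- z).

Variables (c h r th : R).
Hypothesis h_gt0 : 0 < h.
Hypothesis r_gt0 : 0 < r.
Hypothesis rh : r < h.
Hypothesis thP : th = 0 \/ th = 1 /\ 0 < c - h.

Let J : set R := `[c - h + r, c + h - r].

Lemma J_in x : J x -> `|x - c| <= h - r.
Proof.
rewrite /J /= in_itv /= => /andP[x1 x2].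
by rewrite ler_norml; apply/andP; split; lra.
Qed.

(** A step shorter than [e] that leaves [J] ends close to an end point of the
    large interval. *)
Lemma J_out x z e : J x -> ~ J z -> `|x - z| < e -> `|z - (c - h)| <= r + e \/ `|z - (c + h)| <= r + e.
Proof.
have := r_gt0; have := rh => rh' r0'.
rewrite /J /= in_itv /= => /andP[x1 x2] /negP; rewrite in_itv /= negb_and -!ltNge.
rewrite ltr_norml => zJ /andP[z1 z2]; case/orP: zJ => zJ; [left|right];
  by rewrite ler_norml; apply/andP; split; lra.
Qed.

Lemma th_ge0 : 0 <= th.
Proof. by case: thP => [->|[->]]. Qed.

Lemma reflected_kernel_ge0 d x z : 0 < d -> J x -> J z -> 0 <= reflected_kernel th d x z.
Proof.
have := r_gt0; move=> r0' d0.
rewrite /J /= !in_itv /= => /andP[x1 x2] /andP[z1 z2].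
rewrite /reflected_kernel; case: thP => [->|[-> ch]]; first by rewrite mul0r subr0 bm_density_ge0.
rewrite mul1r subr_ge0 ler_wpM2l ?invr_ge0 ?sqrtr_ge0// ler_expR.
have d20 : 0 <= (2 * d)^-1 by rewrite invr_ge0 mulr_ge0// ltW.
rewrite ler_wpM2r// lerN2.
have x0 : 0 < x by lra.
have z0 : 0 < z by lra.
have xz : 0 < x * z by rewrite mulr_gt0.
nra.
Qed.

Lemma reflected_kernel_le d x z : reflected_kernel th d x z <= p d x z.
Proof. by rewrite gerBl mulr_ge0 ?bm_density_ge0 ?th_ge0. Qed.

Lemma measurable_reflected_kernel d :
  measurable_fun setT (fun xz : R * R => reflected_kernel th d xz.1 xz.2).
Proof.
apply: measurable_funB; first exact: measurable_bm_density_joint.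
apply: measurable_funM => //; apply: measurable_bm_density_joint => //.
exact: measurableT_comp.
Qed.

Variables (f : R -> R) (C0 L0 : R).
Hypothesis fCL : bounded_lipschitz C0 L0 f.
Hypothesis f_ge0 : forall z, 0 <= f z.
Hypothesis f0 : forall z, h <= `|z - c| -> f z = 0.

Definition image_tail t N := 2 * C0 * Num.sqrt 2 * expR (- (4 * (N%:R - 1) * h) ^+ 2 / (4 * t)).

Let C0_ge0 : 0 <= C0. Proof. exact: le_trans (fCL.1 0). Qed.

Lemma image_tail_ge0 t N : 0 <= image_tail t N.
Proof. by rewrite !mulr_ge0 ?expR_ge0 ?sqrtr_ge0. Qed.

(** Outside of [J] but within [e] of it, the flow of the images is within
    [L * (r + e)] of its value at an end point, where it vanishes up to
    [image_tail]. When [th = 1], the mirror image [- z] of a point of [J] is at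
    distance at least [2 * (c - h)] from [J], so that the reflected part of the
    kernel counts as a long step. *)
Lemma killed_iter_images t N n e : 0 < t -> (0 < N)%N -> 0 < e ->
  (th = 0 \/ e <= 2 * (c - h)) ->
  `|iter n.+1 (killed J (reflected_kernel th (t / n.+1%:R))) f c - heat t (images c h f N) c| <=
  (N%:R * 2 * (2 * L0) * (r + e) + image_tail t N) +
  n.+1%:R * (2 * (N%:R * 2 * (2 * C0)) * (Num.sqrt 2 * expR (- e ^+ 2 / (4 * (t / n.+1%:R))))).
Proof.
have := r_gt0; have := rh; have := h_gt0; move=> h0' rh' r0' t0 N0 e0 eth.
have n0 : 0 < n.+1%:R :> R by [].
have d0 : 0 < t / n.+1%:R by rewrite divr_gt0.
have bim := images_bounded_lipschitz c h fCL N.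
have L_ge0 : 0 <= N%:R * 2 * (2 * L0).
  have := bim.2 0 1; rewrite sub0r normrN1 mulr1; exact: le_trans.
have <- : iter n.+1 (heat (t / n.+1%:R)) (images c h f N) = heat t (images c h f N).
  rewrite (iter_heat n d0 bim); congr heat; rewrite mulrC divfK// gt_eqF//.
have Jc : J c by rewrite /J /= in_itv /=; apply/andP; split; lra.
apply: (@killed_heat_iter _ J (reflected_kernel th (t / n.+1%:R)) _ d0 _ (measurable_reflected_kernel _)
  (fun x z => @reflected_kernel_ge0 _ x z d0)
  (fun x z _ _ => reflected_kernel_le _ x z) _ e _ _ _ _ _ _ C0) => //.
- exact: measurable_itv.
- by rewrite addr_ge0 ?image_tail_ge0// mulr_ge0// addr_ge0// ltW.
- move=> x z Jx Jz; rewrite /reflected_kernel opprB addrC subrK.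
  case: thP eth => [->|[-> ch]] eth.
    by rewrite mul0r !mulr_ge0 ?expR_ge0 ?sqrtr_ge0 ?bm_density_ge0.
  case: eth => [/eqP|eth]; first by rewrite oner_eq0.
  rewrite mul1r; apply: bm_density_tail => //; first exact: ltW.
  move: Jx Jz; rewrite /J /= !in_itv /= => /andP[x1 x2] /andP[z1 z2].
  by rewrite ler_normr; apply/orP; left; lra.
- by move=> x z xz; apply: bm_density_tail => //; exact: ltW.
- exact: bounded_lipschitz_measurable fCL.
- exact: bim.
- move=> z Jz; rewrite images_inside//.
  by apply: le_trans (J_in Jz) _; rewrite gerBl ltW.
- move=> k kn x z Jx nJz xz.
  suff H b : (b = c - h \/ b = c + h) -> `|iter k (heat (t / n.+1%:R)) (images c h f N) b| <= image_tail t N.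
    have bk : bounded_lipschitz (N%:R * 2 * (2 * C0)) (N%:R * 2 * (2 * L0)) (iter k (heat (t / n.+1%:R)) (images c h f N)).
      elim: (k) => [//|j IH]; rewrite iterS; exact: heat_bounded_lipschitz.
    have K b : (b = c - h \/ b = c + h) -> `|z - b| <= r + e ->
        `|iter k (heat (t / n.+1%:R)) (images c h f N) z| <= N%:R * 2 * (2 * L0) * (r + e) + image_tail t N.
      move=> /H Hb zb; rewrite -[X in `|X|](subrK (iter k (heat (t / n.+1%:R)) (images c h f N) b)).
      apply: le_trans (ler_normD _ _) _; apply: lerD => //.
      by apply: le_trans (bk.2 _ _) _; rewrite ler_wpM2l.
    by case: (J_out Jx nJz xz); apply: K; [left|right].
  case: k kn => [|k] kn.
    have z0 b' : (b' = c - h \/ b' = c + h) -> images c h f N b' = 0.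
      move=> bb; have bc : `|b' - c| = h.
        by case: bb => ->; rewrite addrAC subrr add0r ?normrN gtr0_norm.
      by rewrite images_inside ?f0// bc.
    by move=> /z0 /= ->; rewrite normr0 image_tail_ge0.
  rewrite (iter_heat k d0 bim).
  have k0 : 0 < k.+1%:R * (t / n.+1%:R) by rewrite mulr_gt0.
  have kt : k.+1%:R * (t / n.+1%:R) <= t.
    by rewrite mulrA ler_pdivrMr// mulrC ler_pM2l// ler_nat ltnW.
  case=> ->; first by rewrite (heat_images_low c h fCL) ?normr0 ?image_tail_ge0.
  exact: (heat_images_high h_gt0 fCL f0 k0 kt N0).
Qed.

(** With [n] steps of length [t / n], the cost [exp (- e^2 n / (4 t))] of a long
    step outweighs their number. *)
Lemma killed_iter_images_near t N (eps : R) : 0 < t -> (0 < N)%N -> 0 < eps ->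
  \forall n \near \oo,
  `|iter n.+1 (killed J (reflected_kernel th (t / n.+1%:R))) f c - heat t (images c h f N) c| <=
  N%:R * 2 * (2 * L0) * r + image_tail t N + eps.
Proof.
move=> t0 N0 eps0.
have L_ge0 : 0 <= N%:R * 2 * (2 * L0).
  have := (images_bounded_lipschitz c h fCL N).2 0 1; rewrite sub0r normrN1 mulr1; exact: le_trans.
set LN := N%:R * 2 * (2 * L0) in L_ge0 *.
have [e [e0 eLN eth]] : exists e, [/\ 0 < e, LN * e <= eps / 2 & th = 0 \/ e <= 2 * (c - h)].
  have e1 : 0 < eps / 2 / (LN + 1) by rewrite !divr_gt0// ltr_pwDr.
  have LNe e : 0 <= e -> e <= eps / 2 / (LN + 1) -> LN * e <= eps / 2.
    move=> e0; rewrite ler_pdivlMr ?ltr_pwDr// mulrC; apply: le_trans.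
    by rewrite ler_wpM2r// lerDl.
  case: thP => [th0|[_ ch]].
    by exists (eps / 2 / (LN + 1)); split; [|apply: LNe => //; exact: ltW|left].
  exists (Num.min (eps / 2 / (LN + 1)) (2 * (c - h))); split.
  - by rewrite lt_min e1 mulr_gt0.
  - by apply: LNe; rewrite ?ge_min ?lexx// le_min (ltW e1) mulr_ge0// ltW.
  - by right; rewrite ge_min lexx orbT.
pose D := 2 * (N%:R * 2 * (2 * C0)) * Num.sqrt 2.
have e24 : 0 < e ^+ 2 / (4 * t) by rewrite divr_gt0 ?exprn_gt0 ?mulr_gt0.
have cv : (fun n => D * (n.+1%:R * expR (- (e ^+ 2 / (4 * t) * n.+1%:R)))) @ \oo --> (0 : R).
  rewrite -[X in _ --> X](mulr0 D); apply: cvgM; first exact: cvg_cst.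
  exact: nat_expRN_cvg0.
have eps2 : 0 < eps / 2 by rewrite divr_gt0.
move/cvgrPdist_lt: cv => /(_ _ eps2) cv.
near=> n.
have : `|0 - D * (n.+1%:R * expR (- (e ^+ 2 / (4 * t) * n.+1%:R)))| < eps / 2.
  by near: n.
rewrite sub0r normrN => /(le_lt_trans (ler_norm _)) H.
apply: le_trans (killed_iter_images n t0 N0 e0 eth) _.
rewrite -/LN.
have -> : - e ^+ 2 / (4 * (t / n.+1%:R)) = - (e ^+ 2 / (4 * t) * n.+1%:R).
  by field; rewrite !gt_eqF//= ?ltr0n.
rewrite /D in H; move: (expR _) H => X H.
have HH : n.+1%:R * (2 * (N%:R * 2 * (2 * C0)) * (Num.sqrt 2 * X)) < eps / 2.
  by apply: le_lt_trans H; apply: eq_lexx; ring.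
rewrite mulrDr; lra.
Unshelve. all: by end_near. Qed.

End KilledImages.

(** * Integrals of functions of a random variable *)

Section SameImage.
Context {R : realType}.
Import HBNNSimple.

(** Approximating [phi] by simple functions expresses the integral through its
    values at indicators. *)
Lemma integral_comp_approx d (T : measurableType d) (m : {measure set T -> \bar R})
    (H : T -> R) (pi_ : T -> R) (phi : R -> R)
    (mphi : measurable_fun setT (EFin \o phi)) :
  measurable_fun setT H -> (forall w, 0 <= H w) ->
  measurable_fun setT pi_ -> (forall z, 0 <= phi z) ->
  (\int[m]_w (H w * phi (pi_ w))%:E =
  limn (fun n => \sum_(r \in range (nnsfun_approx measurableT mphi n))
     r%:E * \int[m]_w (H w * \1_(nnsfun_approx measurableT mphi n @^-1` [set r]) (pi_ w))%:E))%E.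
Proof.
move=> mH H0 mpi phi0.
pose f_ := nnsfun_approx measurableT mphi.
have phi0' z : setT z -> (0 <= (EFin \o phi) z)%E by move=> _; rewrite lee_fin.
transitivity (limn (fun n => \int[m]_w (H w * f_ n (pi_ w))%:E))%E.
  rewrite -monotone_convergence//.
  - apply: eq_integral => w _; apply/esym/cvg_lim => //.
    under eq_fun do rewrite EFinM; rewrite EFinM.
    by apply: cvgeZl => //; exact: (cvg_nnsfun_approx measurableT mphi phi0' (x := pi_ w) I).
  - move=> n; apply/measurable_EFinP; apply: measurable_funM => //.
    exact: measurableT_comp.
  - by move=> n w _; rewrite lee_fin mulr_ge0.
  - move=> w _ a b ab; rewrite lee_fin ler_wpM2l//.
    by have /lefP := nd_nnsfun_approx measurableT mphi ab; exact.
congr (limn _); apply/funext => n.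
have E w : (H w * f_ n (pi_ w))%:E =
   (\sum_(r \in range (f_ n)) (r * (H w * \1_(f_ n @^-1` [set r]) (pi_ w)))%:E)%E.
  rewrite (fimfunE (f_ n) (pi_ w)) EFinM -fsumEFin//.
  rewrite ge0_mule_fsumr//; last by move=> r; rewrite EFinM nnfun_muleindic_ge0.
  by apply: eq_fsbigr => r _; rewrite -EFinM mulrCA.
under eq_integral do rewrite E.
have mI r : measurable_fun setT (fun w => H w * \1_(f_ n @^-1` [set r]) (pi_ w)).
  apply: measurable_funM => //.
  have m1 : measurable_fun setT (\1_(f_ n @^-1` [set r]) : R -> R) by exact: measurable_indic.
  exact: (measurableT_comp m1 mpi).
have mI0 r w : (0 <= r * (H w * \1_(f_ n @^-1` [set r]) (pi_ w))).
  rewrite mulrCA mulr_ge0//. have := nnfun_muleindic_ge0 (f_ n) r (pi_ w). by rewrite -EFinM lee_fin.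
rewrite ge0_integral_fsum//; last 2 first.
- by move=> r; apply/measurable_EFinP; apply: measurable_funM.
- by move=> r w _; rewrite lee_fin.
apply: eq_fsbigr => r; rewrite inE => -[z _ zr].
rewrite -ge0_integralZl//.
- by apply/measurable_EFinP.
- by move=> w _; rewrite lee_fin mulr_ge0// indicE.
- by rewrite lee_fin -zr.
Qed.

(** The Markov property speaks of probabilities of events; this extends it from
    indicators to nonnegative functions of the position. *)
Lemma eq_integral_comp d1 (T1 : measurableType d1) (m1 : {measure set T1 -> \bar R})
    d2 (T2 : measurableType d2) (m2 : {measure set T2 -> \bar R})
    (H1 pi1 : T1 -> R) (H2 pi2 : T2 -> R) (phi : R -> R) :
  measurable_fun setT H1 -> (forall w, 0 <= H1 w) -> measurable_fun setT pi1 ->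
  measurable_fun setT H2 -> (forall w, 0 <= H2 w) -> measurable_fun setT pi2 ->
  (forall U, measurable U -> \int[m1]_w (H1 w * \1_U (pi1 w))%:E = \int[m2]_w (H2 w * \1_U (pi2 w))%:E)%E ->
  measurable_fun setT phi -> (forall z, 0 <= phi z) ->
  (\int[m1]_w (H1 w * phi (pi1 w))%:E = \int[m2]_w (H2 w * phi (pi2 w))%:E)%E.
Proof.
move=> mH1 H10 mp1 mH2 H20 mp2 HU mphi phi0.
have mphi' : measurable_fun setT (EFin \o phi) by apply/measurable_EFinP.
rewrite (integral_comp_approx m1 mphi')// (integral_comp_approx m2 mphi')//.
congr (limn _); apply/funext => n; apply: eq_fsbigr => r _; congr (_ * _)%E.
exact: HU.
Qed.

End SameImage.

(** * Path events and the Markov property *)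

Section PathEvents.
Context {R : realType}.
Implicit Types (s t : R) (U J : set R).

Definition path_generator t : set (set (R -> R)) :=
  [set A | exists (s : R) (U : set R), [/\ 0 <= s <= t, measurable U &
                 A = [set w : R -> R | U (w s)]] ].

Lemma path_events_measurable t A :
  path_events t A <-> measurable (A : set (g_sigma_algebraType (path_generator t))).
Proof. by []. Qed.

Lemma path_events_at t s U : 0 <= s <= t -> measurable U -> path_events t [set w | U (w s)].
Proof. by move=> st mU; apply: sub_sigma_algebra; exists s, U. Qed.

Lemma path_events_bigcap t (F : nat -> set (R -> R)) :
  (forall n, path_events t (F n)) -> path_events t (\bigcap_n F n).
Proof. by move=> h; apply/path_events_measurable; apply: bigcapT_measurable. Qed.

Lemma path_events_bigcup t (F : nat -> set (R -> R)) :
  (forall n, path_events t (F n)) -> path_events t (\bigcup_n F n).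
Proof. by move=> h; apply/path_events_measurable; apply: bigcupT_measurable. Qed.

Lemma path_events_setT t : path_events t setT.
Proof. exact/path_events_measurable. Qed.

Definition grid_event (d : R) (k : nat) J : set (R -> R) :=
  [set w | forall j, (j <= k)%N -> J (w (j%:R * d))].

Lemma grid_event_path_events d k J t : 0 <= d -> k%:R * d <= t -> measurable J ->
  path_events t (grid_event d k J).
Proof.
move=> d0 kd mJ.
rewrite (_ : grid_event d k J = \bigcap_j [set w | (j <= k)%N -> J (w (j%:R * d))]); last first.
  by apply/seteqP; split => w /= h j; [move=> _; exact: h|exact: (h j I)].
apply: path_events_bigcap => j.
case: (leqP j k) => jk; last first.
  rewrite (_ : [set _ | _] = setT); first exact: path_events_setT.
  by apply/seteqP; split.
rewrite (_ : [set _ | _] = [set w | J (w (j%:R * d))]); last first.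
  by apply/seteqP; split => w /=; [exact|].
apply: path_events_at => //; rewrite mulr_ge0//=; apply: le_trans kd.
by rewrite ler_wpM2r// ler_nat.
Qed.

End PathEvents.

Section MarkovKilled.
Context {R : realType}.
Notation mu := (@lebesgue_measure R).
Implicit Types (f F : R -> R).
Context d (S : measurableType d) (P : probability S R).
Variables (D : set R) (q : R -> R -> R -> R) (x : R) (X : R -> {RV P >-> R}).
Hypothesis HM : markov_process D q x X.

Variables (J : set R) (kap : R -> R -> R) (w : R -> R) (dt : R).
Hypothesis dt_gt0 : 0 < dt.
Hypothesis mJ : measurable J.
Hypothesis JD : J `<=` D.
Hypothesis mkap : measurable_fun setT (fun xz : R * R => kap xz.1 xz.2).
Hypothesis kap_ge0 : forall a z, J a -> J z -> 0 <= kap a z.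
Hypothesis kap_le : forall a z, J a -> J z -> kap a z <= bm_density dt a z.
Hypothesis mw : measurable_fun setT w.
Hypothesis w_gt0 : forall z, J z -> 0 < w z.
Hypothesis qE : forall a z, J a -> J z -> q dt a z = w z / w a * kap a z.
Hypothesis Jx : J x.

Definition path_set (A : set (R -> R)) : set S := [set o | A (fun u => X u o)].

Lemma measurable_at t U : measurable U -> measurable [set o | U (X t o)].
Proof. by move=> mU; rewrite -[X in measurable X]setTI; exact: (measurable_funPT (X t)). Qed.

Lemma measurable_path_set t A : path_events t A -> measurable (path_set A).
Proof.
pose G := [set A | measurable (path_set A)].
have sG : sigma_algebra setT G.
  split.
  - by rewrite /G /= (_ : path_set set0 = set0)//; apply/seteqP; split.
  - move=> A'; rewrite /G /= => mA.
    rewrite (_ : path_set _ = ~` path_set A'); first exact: measurableC.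
    by apply/seteqP; split => o /=; [case|].
  - move=> F mF; rewrite /G /=.
    rewrite (_ : path_set _ = \bigcup_n path_set (F n)); first by apply: bigcupT_measurable => n; exact: mF.
    by apply/seteqP; split => o [n _ h]; exists n.
have sub : path_generator t `<=` G.
  by move=> A' [s [U [_ mU ->]]]; exact: measurable_at.
exact: (smallest_sub sG sub).
Qed.

Let E k := path_set (grid_event dt k J).

Let grid_path k : path_events (k%:R * dt) (grid_event dt k J).
Proof. by apply: grid_event_path_events => //; exact: ltW. Qed.

Let mE k : measurable (E k).
Proof. exact: (measurable_path_set (@grid_path k)). Qed.

Let EJ k o : E k o -> J (X (k%:R * dt) o).
Proof. by move=> h; exact: (h k (leqnn k)). Qed.

Definition weighted F z := \1_J z * (F z / w z).

Let mX t : measurable_fun setT (X t). Proof. exact: measurable_funPT. Qed.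

Let m1J : measurable_fun setT (\1_J : R -> R).
Proof. exact: measurable_indic. Qed.

Let m1E k : measurable_fun setT (\1_(E k) : S -> R).
Proof. exact: measurable_indic. Qed.

Lemma measurable_weighted F : measurable_fun setT F -> measurable_fun setT (weighted F).
Proof.
move=> mF; apply: measurable_funM => //; apply: measurable_funM => //.
exact: (measurableT_comp measurable_inv mw).
Qed.

Lemma weighted_ge0 F z : (forall z, 0 <= F z) -> 0 <= weighted F z.
Proof.
move=> F0; rewrite /weighted indicE; case: (boolP (z \in J)) => [/set_mem Jz|]; last by rewrite mul0r.
by rewrite mul1r divr_ge0// ltW// w_gt0.
Qed.

Let trans a z := killed_kernel J kap a z * (w z / w a).

Let trans_ge0 a z : 0 <= trans a z.
Proof.
rewrite /trans /killed_kernel !indicE.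
case: (boolP (a \in J)) => [/set_mem Ja|]; last by rewrite !mul0r.
case: (boolP (z \in J)) => [/set_mem Jz|]; last by rewrite mulr0 !mul0r.
by rewrite !mul1r mulr_ge0 ?kap_ge0// divr_ge0// ltW// w_gt0.
Qed.

Let transE a z : J a -> J z -> trans a z = q dt a z.
Proof. by move=> Ja Jz; rewrite /trans /killed_kernel !indicE !mem_set// !mul1r mulrC qE. Qed.

Let measurable_trans k :
  measurable_fun setT (fun oz : S * R => trans (X (k%:R * dt) oz.1) oz.2).
Proof.
have mX1 : measurable_fun setT (fun oz : S * R => X (k%:R * dt) oz.1) by exact: measurableT_comp.
have m2 : measurable_fun setT (fun oz : S * R => (X (k%:R * dt) oz.1, oz.2)).
  exact: measurable_fun_pair.
apply: measurable_funM.
  exact: (measurableT_comp (measurable_killed_kernel2 mJ mkap) m2).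
apply: measurable_funM.
  exact: (measurableT_comp mw measurable_snd).
apply: (measurableT_comp measurable_inv); exact: (measurableT_comp mw mX1).
Qed.

(** The Markov property at time [k * dt], on the event that the first [k] grid
    values lie in [J]. The factor [w z / w a] of the transition density turns
    [F / w] into [killed J kap F / w]. *)
Lemma markov_killed_step k F : (forall z, 0 <= F z) -> measurable_fun setT F ->
  (forall a, mu.-integrable setT (EFin \o (fun z => killed_kernel J kap a z * F z))) ->
  (\int[P]_o (\1_(E k.+1) o * weighted F (X (k.+1%:R * dt) o))%:E =
   \int[P]_o (\1_(E k) o * weighted (killed J kap F) (X (k%:R * dt) o))%:E)%E.
Proof.
move=> F0 mF iF.
have kk1 : k.+1%:R * dt = k%:R * dt + dt by rewrite -natr1 mulrDl mul1r.
pose H1 o : R := \1_(E k) o * \1_J (X (k.+1%:R * dt) o).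
pose H2 (oz : S * R) : R := \1_(E k) oz.1 * trans (X (k%:R * dt) oz.1) oz.2.
have mH1 : measurable_fun setT H1.
  by apply: measurable_funM => //; exact: (measurableT_comp m1J (mX _)).
have mH2 : measurable_fun setT H2.
  by apply: measurable_funM => //; exact: (measurableT_comp (m1E k) measurable_fst).
have H10 o : 0 <= H1 o by rewrite mulr_ge0// indicE.
have H20 oz : 0 <= H2 oz by rewrite mulr_ge0// indicE.
have mwF : measurable_fun setT (weighted F) by exact: measurable_weighted.
transitivity (\int[P]_o (H1 o * weighted F (X (k.+1%:R * dt) o))%:E)%E.
  apply: eq_integral => o _; congr EFin.
  rewrite /H1 /weighted; set Y := X _ _.
  have [JY|nJY] := pselect (J Y); last by rewrite !indicE (memNset nJY) !(mulr0, mul0r).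
  rewrite [\1_J Y]indicE mem_set// mulr1; congr (_ * _).
  rewrite !indicE; congr (_%:R); congr nat_of_bool; apply/idP/idP => /set_mem h; apply/mem_set.
    by move=> j jk; apply: h; exact: leqW.
  by move=> j; rewrite leq_eqVlt => /predU1P[->//|]; exact: h.
transitivity (\int[(P \x mu)%E]_oz (H2 oz * weighted F oz.2)%:E)%E.
  apply: eq_integral_comp => //; last by move=> z; exact: weighted_ge0.
  move=> U mU.
  have mUJ : measurable (U `&` J) by exact: measurableI.
  have := markov_transition HM (s := k%:R * dt) (t := k.+1%:R * dt) (A := grid_event dt k J) (U := U `&` J).
  have hst : 0 <= k%:R * dt < k.+1%:R * dt by rewrite kk1 ltrDl dt_gt0 andbT mulr_ge0// ltW.
  move=> /(_ hst (@grid_path k) mUJ).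
  have -> : k.+1%:R * dt - k%:R * dt = dt by rewrite kk1; ring.
  move=> MT.
  transitivity (P [set o | grid_event dt k J (X^~ o) /\ (U `&` J) (X (k.+1%:R * dt) o)]).
    rewrite -[LHS]/(\int[P]_o (H1 o * \1_U (X (k.+1%:R * dt) o))%:E)%E.
    have mEU : measurable (E k `&` [set o | (U `&` J) (X (k.+1%:R * dt) o)]).
      by apply: measurableI => //; exact: measurable_at.
    rewrite -[P _]/(P (E k `&` [set o | (U `&` J) (X (k.+1%:R * dt) o)])).
    rewrite -[in RHS](setIT (E k `&` _)) -integral_indic//.
    apply: eq_integral => o _; congr EFin.
    rewrite /H1 indicI -mulrA; congr (_ * _).
    by rewrite mulrC !indicE -natrM mulnb !in_setI.
  rewrite MT.
  pose K (oz : S * R) := (H2 oz * \1_U oz.2)%:E.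
  have mK : measurable_fun setT K.
    apply/measurable_EFinP; apply: measurable_funM => //.
    have m1U : measurable_fun setT (\1_U : R -> R) by exact: measurable_indic.
    exact: (measurableT_comp m1U measurable_snd).
  have K0 oz : (0 <= K oz)%E by rewrite lee_fin mulr_ge0// indicE.
  transitivity (\int[P]_o fubini_F mu K o)%E; last exact: (esym (fubini_tonelli1 (m1 := P) (m2 := mu) _ mK K0)).
  rewrite integral_mkcond; apply: eq_integral => o _; rewrite patchE /fubini_F /K /H2 /=.
  case: ifPn => [/set_mem Eo|nEo].
    have -> : \1_(E k) o = 1 :> R by rewrite indicE mem_set.
    under [RHS]eq_integral do rewrite mul1r.
    rewrite [LHS]integral_mkcond; apply: eq_integral => z _; rewrite patchE.
    have -> : U `&` J `&` D = U `&` J by apply/setIidPl => y [_ /JD].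
    have JX := EJ Eo.
    case: ifPn => [/set_mem [Uz Jz]|nUJ].
      by rewrite transE// indicE (mem_set Uz) mulr1.
    rewrite /trans /killed_kernel !indicE; move: nUJ; rewrite in_setI negb_and => /orP[] /negbTE ->.
      by rewrite mulr0.
    by rewrite mulr0 !mul0r.
  have -> : \1_(E k) o = 0 :> R by rewrite indicE (negbTE nEo).
  by under [RHS]eq_integral do rewrite !mul0r; rewrite integral0.
pose K (oz : S * R) := (H2 oz * weighted F oz.2)%:E.
have mK : measurable_fun setT K.
  apply/measurable_EFinP; apply: measurable_funM => //.
  exact: (measurableT_comp mwF measurable_snd).
have K0 oz : (0 <= K oz)%E by rewrite lee_fin mulr_ge0// weighted_ge0.
transitivity (\int[P]_o fubini_F mu K o)%E; first exact: (fubini_tonelli1 (m1 := P) (m2 := mu) _ mK K0).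
apply: eq_integral => o _; rewrite /fubini_F /K /H2 /=.
have [Eo|nEo] := pselect (E k o); last first.
  have -> : \1_(E k) o = 0 :> R by rewrite indicE memNset.
  by rewrite mul0r; under eq_integral do rewrite !mul0r; rewrite integral0.
have -> : \1_(E k) o = 1 :> R by rewrite indicE mem_set.
set a := X _ _.
have Ja : J a := EJ Eo.
have -> : weighted (killed J kap F) a = killed J kap F a / w a.
  by rewrite /weighted indicE mem_set// mul1r.
rewrite mul1r.
transitivity (\int[mu]_z ((w a)^-1%:E * (killed_kernel J kap a z * F z)%:E))%E.
  apply: eq_integral => z _; rewrite -EFinM mul1r; congr EFin.
  rewrite /trans /weighted /killed_kernel !indicE (mem_set Ja).
  have [Jz|nJz] := pselect (J z); last by rewrite (memNset nJz) !(mulr0, mul0r).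
  rewrite (mem_set Jz) !mul1r; field.
  by rewrite !gt_eqF// w_gt0.
rewrite integralZl//; last exact: iF.
by rewrite /killed /Rintegral mulrC EFinM fineK//; exact/integrable_fin_num/iF.
Qed.

Lemma markov_killed C k F : (forall z, 0 <= F z) -> bounded_measurable C F ->
  (\int[P]_o (\1_(E k) o * weighted F (X (k%:R * dt) o))%:E =
   (iter k (killed J kap) F x / w x)%:E)%E.
Proof.
elim: k F => [|k IH] F F0 bF.
  transitivity (\int[P]_o (cst (weighted F x)%:E o))%E; last first.
    by rewrite integral_cst//= probability_setT mule1 /weighted indicE mem_set ?mul1r.
  apply: ae_eq_integral => //.
  - apply/measurable_EFinP; apply: measurable_funM => //.
    exact: (measurableT_comp (measurable_weighted bF.1) (mX _)).
  - apply: filterS (markov_start HM) => o X0 _ /=.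
    rewrite mul0r X0 indicE mem_set ?mul1r//.
    by move=> j; rewrite leqn0 => /eqP ->; rewrite mul0r X0.
rewrite markov_killed_step//; last 2 first.
- exact: bF.1.
- move=> a; exact: (killed_integrable dt_gt0 mJ mkap kap_ge0 kap_le a bF).
rewrite IH ?iterSr//.
  by move=> z; apply: killed_ge0.
exact: (killed_bounded dt_gt0).
Qed.

End MarkovKilled.

(** * Continuous paths that stay in an interval *)

Section Paths.
Context {R : realType}.
Implicit Types (g : R -> R) (a b e s t lo hi c h : R).

Lemma open_path_stable a b g (U : set R) s : {within `[a, b], continuous g} ->
  a <= s <= b -> open U -> U (g s) ->
  exists2 e : R, 0 < e & forall u, a <= u <= b -> `|s - u| < e -> U (g u).
Proof.
move=> /subspace_continuousP cg sab oU Ugs.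
have As : `[a, b]%classic s by rewrite /= in_itv.
have /(_ s As) := cg.
move=> /(_ U); rewrite /nbhs /=. 
move=> H.
have nU : nbhs (g s) U by apply: open_nbhs_nbhs.
have /nbhs_ballP[e e0 eU] := H nU.
by exists e => // u uab su; apply: eU.
Qed.

(** A continuous path that leaves a closed interval is outside of it during some
    time interval, which every fine grid meets. *)
Lemma grid_event_near g t lo hi s : 0 < t -> {within `[0, t], continuous g} ->
  0 <= s <= t -> ~ (lo <= g s <= hi) ->
  \forall n \near \oo, ~ grid_event (t / n.+1%:R) n.+1 `[lo, hi] g.
Proof.
move=> t0 cg st gs.
have [e e0 He] : exists2 e : R, 0 < e & forall u, 0 <= u <= t -> `|s - u| < e -> ~ (lo <= g u <= hi).
  have oU : open (~` `[lo, hi]%classic) by apply: closed_openC; exact: itv_closed.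
  have [|e e0 He] := open_path_stable cg st oU.
    by rewrite /= in_itv.
  by exists e => // u ut su; have := He u ut su; rewrite /= in_itv.
have : (fun n => t * n.+1%:R^-1) @ \oo --> (0 : R).
  by rewrite -[X in _ --> X](mulr0 t); apply: cvgM; [exact: cvg_cst|exact: cvg_harmonic].
move=> /cvgrPdist_lt /(_ _ e0) H.
near=> n.
have : `|0 - t * n.+1%:R^-1| < e by near: n.
rewrite sub0r normrN => /(le_lt_trans (ler_norm _)) tn G.
set d := t / n.+1%:R in tn G.
have d0 : 0 < d by rewrite divr_gt0.
have /andP[s0 s1] := st.
have sd0 : 0 <= s / d by rewrite divr_ge0// ltW.
have := truncn_itv sd0; set j := Num.truncn _ => /andP[j1 j2].
have j1' : j%:R * d <= s by rewrite -ler_pdivlMr.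
have j2' : s < j.+1%:R * d by rewrite -ltr_pdivrMr.
have jn : (j <= n.+1)%N.
  rewrite -(ler_nat R); apply: le_trans j1 _.
  by rewrite ler_pdivrMr// /d mulrCA divff ?mulr1.
have := G j jn; rewrite /= in_itv /=; apply: He.
  by apply/andP; split; [rewrite mulr_ge0// ltW|exact: le_trans s1].
rewrite ger0_norm ?subr_ge0//; move: j2'; rewrite -natr1 mulrDl mul1r; lra.
Unshelve. all: by end_near. Qed.

(** Countably many times, so that it is a path event; see [closed_stayP]. *)
Definition closed_stay t lo hi : set (R -> R) :=
  \bigcap_n grid_event (t / n.+1%:R) n.+1 `[lo, hi].

Lemma closed_stayP g t lo hi : 0 < t -> {within `[0, t], continuous g} ->
  closed_stay t lo hi g <-> forall s, 0 <= s <= t -> lo <= g s <= hi.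
Proof.
move=> t0 cg; split=> [G s st|G n _ j jn]; last first.
  rewrite /= in_itv /=; apply: G; apply/andP; split; first by rewrite mulr_ge0// divr_ge0// ltW.
  by rewrite mulrCA ler_piMr ?(ltW t0)// ler_pdivrMr// mul1r ler_nat.
apply: contrapT => gs.
have [N _ HN] := grid_event_near t0 cg st gs.
by apply: (HN N (leqnn N)); exact: G.
Qed.

Definition margin h (m : nat) := h / m.+2%:R.

Lemma margin_gt0 h m : 0 < h -> 0 < margin h m.
Proof. by move=> h0; rewrite divr_gt0. Qed.

Lemma margin_lt h m : 0 < h -> margin h m < h.
Proof. by move=> h0; rewrite ltr_pdivrMr// ltr_pMr// ltr1n. Qed.

Lemma margin_le h m n : 0 < h -> (m <= n)%N -> margin h n <= margin h m.
Proof. by move=> h0 mn; rewrite ler_pM2l// lef_pV2 ?posrE// ler_nat. Qed.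

Lemma margin_cvg h : margin h @ \oo --> (0 : R).
Proof.
have : (fun n => h * n.+1%:R^-1) @ \oo --> (0 : R).
  by rewrite -[X in _ --> X](mulr0 h); apply: cvgM; [exact: cvg_cst|exact: cvg_harmonic].
by rewrite -(cvg_shiftS (fun n => h * n.+1%:R^-1)).
Qed.

(** On a compact time interval a continuous path stays in the open interval iff it
    stays in one of these closed ones. *)
Definition open_stay t c h : set (R -> R) :=
  \bigcup_m closed_stay t (c - h + margin h m) (c + h - margin h m).

Lemma open_stay_near g t c h : 0 < t -> 0 < h -> {within `[0, t], continuous g} ->
  (forall s, 0 <= s <= t -> c - h < g s < c + h) ->
  \forall m \near \oo, closed_stay t (c - h + margin h m) (c + h - margin h m) g.
Proof.
move=> t0 h0 cg G.
have [u uI umax] := EVT_max (ltW t0) cg.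
have [v vI vmin] := EVT_min (ltW t0) cg.
move: uI vI; rewrite !in_itv /= => /G /andP[_ u2] /G /andP[v1 _].
pose e := Num.min (c + h - g u) (g v - (c - h)).
have e0 : 0 < e by rewrite lt_min; apply/andP; split; lra.
have := margin_cvg h; move=> /cvgrPdist_lt /(_ _ e0) H.
near=> m.
have : `|0 - margin h m| < e by near: m.
rewrite sub0r normrN => /(le_lt_trans (ler_norm _)); rewrite lt_min => /andP[m1 m2].
apply/closed_stayP => // s st.
have /umax gu : s \in `[0, t] by rewrite in_itv.
have /vmin gv : s \in `[0, t] by rewrite in_itv.
by apply/andP; split; lra.
Unshelve. all: by end_near. Qed.

Lemma open_stayP g t c h : 0 < t -> 0 < h -> {within `[0, t], continuous g} ->
  open_stay t c h g <-> forall s, 0 <= s <= t -> c - h < g s < c + h.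
Proof.
move=> t0 h0 cg; split=> [[m _ /closed_stayP H] s st|G].
  have /andP[H1 H2] := H t0 cg s st; have := margin_gt0 m h0.
  by move=> r0; apply/andP; split; lra.
have [N _ HN] := open_stay_near t0 h0 cg G.
by exists N => //; exact: HN (leqnn N).
Qed.

Lemma closed_stay_path_events t lo hi : 0 < t -> path_events t (closed_stay t lo hi).
Proof.
move=> t0; apply: path_events_bigcap => n; apply: grid_event_path_events => //.
  by rewrite divr_ge0// ltW.
by rewrite mulrCA divff ?mulr1.
Qed.

Lemma open_stay_path_events t c h : 0 < t -> path_events t (open_stay t c h).
Proof. by move=> t0; apply: path_events_bigcup => n; exact: closed_stay_path_events. Qed.

End Paths.

(** * Bounded convergence *)

Section BoundedConvergence.
Context {R : realType} d (S : measurableType d) (m : {measure set S -> \bar R}).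

Lemma integrable_bounded_on (D : set S) (f : S -> R) (C : R) : measurable D -> (m D < +oo)%E ->
  measurable_fun D f -> (forall o, D o -> `|f o| <= C) -> m.-integrable D (EFin \o f).
Proof.
move=> mD fD mf fC; apply: (@le_integrable _ _ _ m D mD _ (EFin \o cst C)).
- exact/measurable_EFinP.
- by move=> o Do /=; rewrite lee_fin (le_trans (fC o Do))// ler_norm.
- apply/integrableP; split; first exact/measurable_EFinP.
  by rewrite /= integral_cst// lte_mul_pinfty.
Qed.

Lemma Rintegral_bounded_cvg (D : set S) (F : nat -> S -> R) (G : S -> R) (C : R) :
  measurable D -> (m D < +oo)%E ->
  (forall n, measurable_fun D (F n)) -> (forall n o, D o -> `|F n o| <= C) ->
  (forall o, D o -> (fun n => F n o) @ \oo --> G o) ->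
  (fun n => \int[m]_(o in D) F n o) @ \oo --> \int[m]_(o in D) G o.
Proof.
move=> mD fD mF FC FG.
have mG : measurable_fun D G by apply: (measurable_fun_cvg mF).
have h1 : {ae m, forall o, D o -> (F n o)%:E @[n --> \oo] --> (G o)%:E}.
  by apply: aeW => o Do; apply: cvg_EFin; [exact: nearW|exact: FG].
have h2 : {ae m, forall o n, D o -> (`|(F n o)%:E| <= (EFin \o cst C) o)%E}.
  by apply: aeW => o n Do; rewrite /= lee_fin; exact: FC.
have iC : m.-integrable D (EFin \o cst C).
  by apply: (@integrable_bounded_on D (cst C) `|C|).
have [iG _ H] := dominated_convergence mD
  (fun n => (measurable_EFinP _ _).2 (mF n)) ((measurable_EFinP _ _).2 mG) h1 iC h2.
by apply: fine_cvg; rewrite fineK; [exact: H|exact: integrable_fin_num].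
Qed.

End BoundedConvergence.

Section IndicatorCvg.
Context {R : realType} d (S : measurableType d) (P : probability S R).

Lemma integrable_bounded (phi : S -> R) (C : R) : measurable_fun setT phi ->
  (forall o, `|phi o| <= C) -> P.-integrable setT (EFin \o phi).
Proof.
move=> mphi bphi; apply: (@integrable_bounded_on _ _ _ _ _ _ C) => //.
by rewrite (le_lt_trans (probability_le1 P measurableT))// ltry.
Qed.

Lemma Rintegral_indic_cvg (F : nat -> set S) (G : set S) (phi : S -> R) (C : R) :
  (forall n, measurable (F n)) -> measurable_fun setT phi -> (forall o, `|phi o| <= C) ->
  (forall o, \forall n \near \oo, F n o <-> G o) ->
  (fun n => \int[P]_o (\1_(F n) o * phi o)) @ \oo --> \int[P]_o (\1_G o * phi o).
Proof.
move=> mF mphi bphi FG; apply: (Rintegral_bounded_cvg (C := C)) => //.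
- by rewrite (le_lt_trans (probability_le1 P measurableT))// ltry.
- by move=> n; apply: measurable_funM => //; exact: measurable_indic.
- move=> n o _; rewrite normrM indicE; apply: le_trans (bphi o); rewrite ler_piMl//.
  by rewrite ger0_norm// lern1 leq_b1.
- move=> o _; apply: cvg_near_cst; near=> n; have FGn : F n o <-> G o by near: n; exact: FG.
  by rewrite !indicE; congr (_%:R * _); congr nat_of_bool; apply/idP/idP => /set_mem /FGn /mem_set.
Unshelve. all: by end_near. Qed.

End IndicatorCvg.

(** * From grids to continuous time *)

Lemma weighted_bounded {R : realType} (I : set R) (w f : R -> R) (w0 C z : R) : 0 < w0 ->
  (forall z, I z -> w0 <= w z) -> (forall z, `|f z| <= C) -> `|weighted I w f z| <= C / w0.
Proof.
move=> w00 w_ge fC; have C0 : 0 <= C by apply: le_trans (fC 0).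
rewrite /weighted indicE; case: (boolP (_ \in _)) => [/set_mem Iz|_]; last first.
  by rewrite mul0r normr0 divr_ge0// ltW.
have wz := lt_le_trans w00 (w_ge z Iz).
rewrite mul1r normrM; apply: ler_pM => //.
by rewrite gtr0_norm ?invr_gt0// lef_pV2 ?posrE// w_ge.
Qed.

Section Survive.
Context {R : realType}.
Notation mu := (@lebesgue_measure R).
Implicit Types (a z e r t : R).
Context d (S : measurableType d) (P : probability S R).
Variables (D : set R) (q : R -> R -> R -> R) (c : R) (X : R -> {RV P >-> R}).
Hypothesis HM : markov_process D q c X.
Variables (h th w0 : R) (w : R -> R).
Hypothesis h_gt0 : 0 < h.
Hypothesis thP : th = 0 \/ th = 1 /\ 0 < c - h.
Hypothesis mw : measurable_fun setT w.
Hypothesis w0_gt0 : 0 < w0.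
Hypothesis w_ge : forall z, c - h < z < c + h -> w0 <= w z.
Hypothesis ID : forall z, c - h < z < c + h -> D z.
Hypothesis qE : forall dt a z : R, 0 < dt -> c - h < a < c + h -> c - h < z < c + h ->
  q dt a z = w z / w a * reflected_kernel th dt a z.

Variables (f : R -> R) (C0 L0 t : R).
Hypothesis fCL : bounded_lipschitz C0 L0 f.
Hypothesis f_ge0 : forall z, 0 <= f z.
Hypothesis f0 : forall z, h <= `|z - c| -> f z = 0.
Hypothesis t_gt0 : 0 < t.

Let I : set R := `]c - h, c + h[.
Let J r : set R := `[c - h + r, c + h - r].

Let cI : c - h < c < c + h.
Proof. by rewrite gtrBl ltrDl h_gt0. Qed.

Let JI r z : 0 < r -> J r z -> c - h < z < c + h.
Proof. by move=> r0; rewrite /J /= in_itv /= => /andP[? ?]; apply/andP; split; lra. Qed.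

Let wgt0 z : c - h < z < c + h -> 0 < w z.
Proof. by move=> /w_ge; exact: lt_le_trans. Qed.

Let C0_ge0 : 0 <= C0. Proof. exact: le_trans (fCL.1 0). Qed.

Let phi o := weighted I w f (X t o).

Let mphi : measurable_fun setT phi.
Proof.
apply: (measurableT_comp (f := weighted I w f)); last exact: measurable_funPT.
apply: measurable_weighted => //; first exact: measurable_itv.
exact: (bounded_lipschitz_measurable fCL).1.
Qed.

Let phi_bounded o : `|phi o| <= C0 / w0.
Proof.
by apply: (weighted_bounded _ w0_gt0 _ fCL.1) => z; rewrite /I /= in_itv; exact: w_ge.
Qed.

Let killed_n r n := iter n.+1 (killed (J r) (reflected_kernel th (t / n.+1%:R))) f c.

Let grid r n := path_set X (grid_event (t / n.+1%:R) n.+1 (J r)).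

Let dt_gt0 n : 0 < t / n.+1%:R. Proof. by rewrite divr_gt0. Qed.

Let tn n : n.+1%:R * (t / n.+1%:R) = t. Proof. by rewrite mulrCA divff ?mulr1. Qed.

Let mgrid r n : measurable (grid r n).
Proof.
apply: (@measurable_path_set _ _ _ _ _ t); apply: grid_event_path_events.
- exact: ltW.
- by rewrite tn.
- exact: measurable_itv.
Qed.

(** The probabilistic meaning of the killed chain; on the grid event the final
    position is in [J], where both indicators are one. *)
Lemma survive_grid r n : 0 < r -> r < h ->
  \int[P]_o (\1_(grid r n) o * phi o) = killed_n r n / w c.
Proof.
move=> r0 rh.
have Jc : J r c by rewrite /J /= in_itv /=; apply/andP; split; lra.
have HK := @markov_killed R d S P D q c X HM (J r) (reflected_kernel th (t / n.+1%:R)) w (t / n.+1%:R)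
  (dt_gt0 n) (measurable_itv _) (fun z Jz => ID (JI r0 Jz)) (measurable_reflected_kernel _ _)
  (fun a z => @reflected_kernel_ge0 _ c h r th r0 thP _ a z (dt_gt0 n))
  (fun a z _ _ => @reflected_kernel_le _ c h th thP _ a z) mw
  (fun z Jz => wgt0 (JI r0 Jz))
  (fun a z Ja Jz => qE (dt_gt0 n) (JI r0 Ja) (JI r0 Jz)) Jc C0 n.+1 f f_ge0 (bounded_lipschitz_measurable fCL).
rewrite /Rintegral -[killed_n r n / w c]/(fine (killed_n r n / w c)%:E); congr fine.
rewrite /killed_n -HK; apply: eq_integral => o _; congr EFin.
rewrite tn /phi /weighted !indicE.
have [Eo|nEo] := pselect (grid r n o); last by rewrite (memNset nEo) !mul0r.
have JX : J r (X t o) by rewrite -(tn n); exact: (Eo n.+1 (leqnn _)).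
have IX : I (X t o) by rewrite /I /= in_itv /=; exact: JI JX.
by rewrite (mem_set JX) (mem_set IX).
Qed.

Let closed r := path_set X (closed_stay t (c - h + r) (c + h - r)).

Let mclosed r : measurable (closed r).
Proof. apply: (@measurable_path_set _ _ _ _ X t); exact: closed_stay_path_events. Qed.

Let pathc o : {within `[0, t], continuous (fun s : R => X s o)}.
Proof.
have sub : `[0, t]%classic `<=` (`[0, +oo[%classic : set R).
  by move=> s /=; rewrite !in_itv /= => /andP[->].
by apply: continuous_subspaceW sub _; exact: (markov_continuous HM).
Qed.

(** Refining the grid, which decreases to the event [closed_stay]; on the analytic
    side this is [killed_iter_images_near]. *)
Lemma survive_closed r N : 0 < r -> r < h -> (0 < N)%N ->
  `|w c * \int[P]_o (\1_(closed r) o * phi o) - heat t (images c h f N) c| <=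
  N%:R * 2 * (2 * L0) * r + image_tail h C0 t N.
Proof.
move=> r0 rh N0.
have cv : (fun n => \int[P]_o (\1_(grid r n) o * phi o)) @ \oo --> \int[P]_o (\1_(closed r) o * phi o).
  apply: (@Rintegral_indic_cvg _ _ _ _ _ _ phi (C0 / w0)) => // o.
  have [Co|nCo] := pselect (closed r o).
    by near=> n; split => // _; exact: Co.
  have [s [st ns]] : exists s : R, 0 <= s <= t /\ ~ (c - h + r <= X s o <= c + h - r).
    apply: contrapT => ne; apply: nCo; apply/(closed_stayP _ _ t_gt0 (@pathc o)) => s st.
    by apply: contrapT => ns; apply: ne; exists s.
  have H := grid_event_near t_gt0 (@pathc o) st ns.
  near=> n; split => // Go; exfalso.
  have : ~ grid_event (t / n.+1%:R) n.+1 `[c - h + r, c + h - r] (fun s => X s o) by near: n.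
  exact.
apply/ler_addgt0Pr => e e0.
have e2 : 0 < e / 2 by rewrite divr_gt0.
have wc : 0 < w c by exact: wgt0.
have H1 := killed_iter_images_near h_gt0 r0 rh thP fCL f_ge0 f0 t_gt0 N0 e2.
have e3 : 0 < e / 2 / w c by rewrite divr_gt0.
move/cvgrPdist_lt: cv => /(_ _ e3) H2.
have [n [Hn1 Hn2]] : exists n,
    `|killed_n r n - heat t (images c h f N) c| <= N%:R * 2 * (2 * L0) * r + image_tail h C0 t N + e / 2 /\
    `|\int[P]_o (\1_(closed r) o * phi o) - \int[P]_o (\1_(grid r n) o * phi o)| < e / 2 / w c.
  have [n _ Hn] := filterI H1 H2.
  by exists n; exact: (Hn n (leqnn n)).
rewrite (survive_grid n r0 rh) in Hn2.
move: Hn1 Hn2; set K := killed_n r n; set A := \int[P]_o _; set U := heat t _ c => Hn1 Hn2.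
have -> : w c * A - U = w c * (A - K / w c) + (K - U) by field; rewrite gt_eqF.
apply: le_trans (ler_normD _ _) _; rewrite normrM (gtr0_norm wc).
move: Hn2; rewrite ltr_pdivlMr// mulrC => Hn2.
move: (`|A - _|) Hn1 Hn2 => B Hn1 Hn2; lra.
Unshelve. all: by end_near. Qed.

Definition survival_integral :=
  \int[P]_o (\1_(path_set X (open_stay t c h)) o * weighted I w f (X t o)).

(** As the margin tends to [0], the Lipschitz error disappears. *)
Lemma survive_open N : (0 < N)%N ->
  `|w c * survival_integral - heat t (images c h f N) c| <= image_tail h C0 t N.
Proof.
move=> N0.
have cv : (fun m => \int[P]_o (\1_(closed (margin h m)) o * phi o)) @ \oo --> survival_integral.
  apply: (@Rintegral_indic_cvg _ _ _ _ _ _ phi (C0 / w0)) => // o.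
  have [Co|nCo] := pselect (path_set X (open_stay t c h) o).
    have := open_stay_near t_gt0 h_gt0 (@pathc o) ((open_stayP _ t_gt0 h_gt0 (@pathc o)).1 Co).
    by move=> H; near=> m; split => // _; near: m.
  by near=> m; split => // Cm; exfalso; apply: nCo; exists m.
apply/ler_addgt0Pr => e e0.
have e2 : 0 < e / 2 by rewrite divr_gt0.
have wc : 0 < w c by exact: wgt0.
have L_ge0 : 0 <= N%:R * 2 * (2 * L0).
  have := (images_bounded_lipschitz c h fCL N).2 0 1; rewrite sub0r normrN1 mulr1; exact: le_trans.
set LN := N%:R * 2 * (2 * L0) in L_ge0.
have e3 : 0 < e / 2 / w c by rewrite divr_gt0.
have e4 : 0 < e / 2 / (LN + 1) by rewrite divr_gt0// ltr_pwDr.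
move/cvgrPdist_lt: cv => /(_ _ e3) H2.
have := margin_cvg h; move/cvgrPdist_lt => /(_ _ e4) H1.
have [m _ Hm] := filterI H1 H2.
have [] := Hm m (leqnn m).
rewrite sub0r normrN => /(le_lt_trans (ler_norm _)) Hm1 Hm2.
have := survive_closed (margin_gt0 m h_gt0) (margin_lt m h_gt0) N0.
move: Hm1 Hm2; rewrite -/LN; set r := margin h m; set A := \int[P]_o _; set U := heat t _ c => Hm1 Hm2.
move: survival_integral Hm2 => B Hm2 HA.
have -> : w c * B - U = w c * (B - A) + (w c * A - U) by ring.
apply: le_trans (ler_normD _ _) _; rewrite normrM (gtr0_norm wc).
move: Hm2; rewrite ltr_pdivlMr// mulrC => Hm2.
move: Hm1; rewrite ltr_pdivlMr ?ltr_pwDr// => Hm1.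
have r0 : 0 < r by exact: margin_gt0.
have : LN * r < e / 2 by apply: le_lt_trans Hm1; rewrite mulrC ler_wpM2l ?lerDl// ltW.
move: (`|B - A|) (`|_ - U|) (image_tail _ _ _ _) HA Hm2 => Y Z T HA Hm2 Hr; lra.
Unshelve. all: by end_near. Qed.

Lemma image_tail_cvg0 : image_tail h C0 t @ \oo --> (0 : R).
Proof.
pose a := 4 * h ^+ 2 / t.
have a0 : 0 < a by rewrite divr_gt0 ?mulr_gt0 ?exprn_gt0.
pose K := 2 * C0 * Num.sqrt 2.
have K0 : 0 <= K by rewrite !mulr_ge0 ?sqrtr_ge0.
rewrite -(cvg_shiftn 2).
apply: (@squeeze_cvgr _ _ _ _ (fun=> 0) (fun n => K * (n.+1%:R * expR (- (a * n.+1%:R))))).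
- near=> n; rewrite (image_tail_ge0 h fCL)//= /image_tail -/K ler_wpM2l//.
  have -> : (n + 2)%:R - 1 = n.+1%:R :> R by rewrite natrD -natr1; ring.
  have n1 : 1 <= n.+1%:R :> R by rewrite ler1n.
  apply: (@le_trans _ _ (expR (- (a * n.+1%:R)))); last by rewrite ler_peMl ?expR_ge0.
  rewrite ler_expR mulNr lerN2.
  have -> : (4 * n.+1%:R * h) ^+ 2 / (4 * t) = a * n.+1%:R * n.+1%:R by rewrite /a; field; rewrite gt_eqF.
  by rewrite ler_peMr// mulr_ge0// ltW.
- exact: cvg_cst.
- rewrite -[X in _ --> X](mulr0 K); apply: cvgM; first exact: cvg_cst.
  exact: nat_expRN_cvg0.
Unshelve. all: by end_near. Qed.

Lemma survive_cvg : (fun N => heat t (images c h f N) c) @ \oo --> w c * survival_integral.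
Proof.
apply/cvgrPdist_lt => e e0.
move/cvgrPdist_lt: image_tail_cvg0 => /(_ _ e0) H.
near=> N.
apply: le_lt_trans (survive_open _) _; first by near: N; exact: nbhs_infty_gt.
have : `|0 - image_tail h C0 t N| < e by near: N.
by rewrite sub0r normrN; apply: le_lt_trans; exact: ler_norm.
Unshelve. all: by end_near. Qed.

End Survive.

(** * The image series *)

Section DeltaSeries.
Context {R : realType}.
Notation mu := (@lebesgue_measure R).
Notation p := (@bm_density R).
Implicit Types (a b c h t x y z q : R) (f g : R -> R).

Definition Delta_partial N z h t :=
  bilateral_partial N (fun m => p t 0 (z + 4 * m%:~R * h) - p t 0 (z + 2 * h * (2 * m%:~R + 1))).

(** The [n]-th images are at distance at least [n * h], so the image series is
    dominated by a geometric series of this ratio. *)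
Definition image_ratio h t := expR (- (h ^+ 2 / (2 * t))).

Lemma image_ratio_ge0 h t : 0 <= image_ratio h t. Proof. exact: expR_ge0. Qed.

Lemma image_ratio_lt1 h t : 0 < h -> 0 < t -> image_ratio h t < 1.
Proof. by move=> h0 t0; rewrite -expR0 ltr_expR oppr_lt0 divr_gt0 ?exprn_gt0 ?mulr_gt0. Qed.

Lemma bm_density_geometric h t a n : 0 < h -> 0 < t -> n%:R * h <= `|a| ->
  p t 0 a <= (Num.sqrt (2 * pi * t))^-1 * image_ratio h t ^+ n.
Proof.
move=> h0 t0 na; rewrite /bm_density ler_wpM2l ?invr_ge0 ?sqrtr_ge0//.
rewrite -expRM_natl ler_expR sub0r sqrrN mulNr mulrN lerN2.
have t2 : 0 < 2 * t by rewrite mulr_gt0.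
rewrite mulrA ler_pM2r ?invr_gt0//.
apply: (@le_trans _ _ ((n%:R * h) ^+ 2)).
  rewrite exprMn ler_wpM2r ?sqr_ge0// -natrX ler_nat.
  by case: n na => // n _; rewrite -[X in (X <= _)%N]muln1 leq_mul2l.
rewrite -(real_normK (num_real a)) lerXn2r// ?nnegrE ?normr_ge0//.
by rewrite mulr_ge0// ltW.
Qed.

Lemma Delta_term_bound z h t (m : int) (n : nat) : 0 < h -> 0 < t -> `|z| <= h ->
  m = n%:Z \/ m = - n.+1%:Z ->
  `|p t 0 (z + 4 * m%:~R * h) - p t 0 (z + 2 * h * (2 * m%:~R + 1))| <=
  (Num.sqrt (2 * pi * t))^-1 * image_ratio h t ^+ n.
Proof.
move=> h0 t0; rewrite ler_norml => /andP[z1 z2] mn.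
have n0 : 0 <= n%:R :> R by [].
have nh : 0 <= n%:R * h by rewrite mulr_ge0// ltW.
have H1 : n%:R * h <= `|z + 4 * m%:~R * h|.
  rewrite ler_normr; apply/orP; case: mn => ->.
    case: (n) n0 nh => [|k] _ _; first by rewrite mul0r; case: (leP 0 (z + 4 * 0%:~R * h)) => ?; [left|right; lra].
    left; rewrite -[k.+1%:~R]/(k.+1%:R : R) -natr1; have : 0 <= k%:R * h by rewrite mulr_ge0// ltW.
    lra.
  right; rewrite intrN -[n.+1%:~R]/(n.+1%:R : R) -natr1; lra.
have H2 : n%:R * h <= `|z + 2 * h * (2 * m%:~R + 1)|.
  rewrite ler_normr; apply/orP; case: mn => ->.
    left; rewrite -[n%:~R]/(n%:R : R); lra.
  right; rewrite intrN -[n.+1%:~R]/(n.+1%:R : R) -natr1; lra.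
have B1 := bm_density_geometric h0 t0 H1.
have B2 := bm_density_geometric h0 t0 H2.
have P1 := bm_density_ge0 t 0 (z + 4 * m%:~R * h).
have P2 := bm_density_ge0 t 0 (z + 2 * h * (2 * m%:~R + 1)).
by rewrite ler_norml; apply/andP; split; lra.
Qed.

Definition Delta_bound h t := 2 * (Num.sqrt (2 * pi * t))^-1 / (1 - image_ratio h t).

Lemma Delta_partial_bound N z h t : 0 < h -> 0 < t -> `|z| <= h ->
  `|Delta_partial N z h t| <= Delta_bound h t.
Proof.
move=> h0 t0 zh; rewrite /Delta_partial /bilateral_partial.
have q1 := image_ratio_lt1 h0 t0; have q0 := image_ratio_ge0 h t.
apply: le_trans (ler_norm_sum _ _ _) _.
pose K := (Num.sqrt (2 * pi * t))^-1.
have K0 : 0 <= K by rewrite invr_ge0 sqrtr_ge0.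
apply: (@le_trans _ _ (\sum_(n < N) (2 * K) * image_ratio h t ^+ n)).
  apply: ler_sum => n _; apply: le_trans (ler_normD _ _) _.
  rewrite [leRHS](_ : _ = K * image_ratio h t ^+ n + K * image_ratio h t ^+ n); last by ring.
  apply: lerD; first by apply: Delta_term_bound => //; left.
  by apply: Delta_term_bound => //; right.
apply: (@le_trans _ _ (series (geometric (2 * K) (image_ratio h t)) N)).
  by rewrite /series /= big_mkord.
apply: geometric_le_lim; rewrite ?mulr_ge0 ?expR_gt0//.
by rewrite ger0_norm.
Qed.

Lemma Delta_partial_cvg z h t : 0 < h -> 0 < t -> `|z| <= h ->
  (fun N => Delta_partial N z h t) @ \oo --> Delta z h t.
Proof.
move=> h0 t0 zh.
have q1 := image_ratio_lt1 h0 t0; have q0 := image_ratio_ge0 h t.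
pose K := (Num.sqrt (2 * pi * t))^-1.
have K0 : 0 < K by rewrite invr_gt0 sqrtr_gt0 !mulr_gt0// pi_gt0.
pose g (m : int) := expR (- (z + 4 * m%:~R * h) ^+ 2 / (2 * t)) -
    expR (- (z + 2 * h * (2 * m%:~R + 1)) ^+ 2 / (2 * t)).
have gE (m : int) : p t 0 (z + 4 * m%:~R * h) - p t 0 (z + 2 * h * (2 * m%:~R + 1)) = K * g m.
  by rewrite /bm_density !sub0r !sqrrN -mulrBr.
have gb (m : int) (n : nat) : m = n%:Z \/ m = - n.+1%:Z -> `|g m| <= image_ratio h t ^+ n.
  move=> /(Delta_term_bound h0 t0 zh); rewrite gE normrM (gtr0_norm K0).
  by rewrite ler_pM2l.
have cv (k : nat -> int) : (forall n, k n = n%:Z \/ k n = - n.+1%:Z) -> cvgn (series (fun n => g (k n))).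
  move=> kP; apply: normed_cvg.
  apply: (@series_le_cvg _ _ (geometric 1 (image_ratio h t))) => //.
  - by move=> n /=.
  - by move=> n; rewrite /= mul1r exprn_ge0.
  - by move=> n; rewrite /= mul1r; exact: gb.
  - by apply: is_cvg_geometric_series; rewrite ger0_norm.
rewrite /Delta -/K.
have E N : Delta_partial N z h t =
    K * (series (fun n => g n%:Z) N + series (fun n => g (- n.+1%:Z)) N).
  rewrite /Delta_partial /bilateral_partial /series /= !big_mkord -big_split /= mulr_sumr.
  by apply: eq_bigr => n _; rewrite [RHS]mulrDr; congr (_ + _); exact: gE.
rewrite (_ : (fun N => _) = (fun N => K * (series (fun n => g n%:Z) N + series (fun n => g (- n.+1%:Z)) N))); last first.
  exact/funext.
apply: cvgM; first exact: cvg_cst.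
by apply: cvgD; apply: cv => n; [left|right].
Qed.

Lemma Delta_bounded z h t : 0 < h -> 0 < t -> `|z| <= h -> `|Delta z h t| <= Delta_bound h t.
Proof.
move=> h0 t0 zh.
have cv : (fun N => `|Delta_partial N z h t|) @ \oo --> `|Delta z h t|.
  by apply: cvg_norm; exact: Delta_partial_cvg.
by apply: (cvgr_to_le cv); near=> N; exact: Delta_partial_bound.
Unshelve. all: by end_near. Qed.

Lemma measurable_Delta_partial d (T : measurableType d) (D : set T) N h (z t : T -> R) :
  measurable_fun D z -> measurable_fun D t ->
  measurable_fun D (fun w => Delta_partial N (z w) h (t w)).
Proof.
move=> mz mt; rewrite /Delta_partial /bilateral_partial.
apply: measurable_sum => n.
by apply: measurable_funD; apply: measurable_funB; apply: measurable_bm_density_joint => //;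
  apply: measurable_funD.
Qed.

Lemma measurable_Delta d (T : measurableType d) (D : set T) h (z t : T -> R) : 0 < h ->
  measurable_fun D z -> measurable_fun D t ->
  (forall w, D w -> `|z w| <= h /\ 0 < t w) ->
  measurable_fun D (fun w => Delta (z w) h (t w)).
Proof.
move=> h0 mz mt ztP.
apply: (measurable_fun_cvg (h := fun N w => Delta_partial N (z w) h (t w))).
  by move=> N; exact: measurable_Delta_partial.
by move=> w /ztP[zh t0]; exact: Delta_partial_cvg.
Qed.

Lemma heat_translate t a c f C : 0 < t -> bounded_measurable C f ->
  heat t (fun z => f (z - a)) c = \int[mu]_z (f z * p t 0 (z - c + a)).
Proof.
move=> t0 [mf _]; rewrite /heat -(Rintegral_shift a); last first.
  apply: measurable_funM; first exact: measurable_bm_density.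
  by apply: (measurableT_comp mf); exact: measurable_funB.
apply: eq_Rintegral => z _; rewrite mulrC; congr (f _ * _); first by ring.
by apply: bm_density_diff; ring.
Qed.

Lemma heat_flip t b c f C : 0 < t -> bounded_measurable C f ->
  heat t (fun z => f (b - z)) c = \int[mu]_z (f z * p t 0 (b - z - c)).
Proof.
move=> t0 [mf _]; rewrite heat_reflect//; rewrite /heat.
by apply: eq_Rintegral => z _; rewrite mulrC; congr (_ * _); apply: bm_density_diff; ring.
Qed.

Lemma integrable_bm_density0 t b (s : R) C f : 0 < t -> s = 1 \/ s = -1 -> bounded_measurable C f ->
  mu.-integrable setT (EFin \o (fun z => f z * p t 0 (s * z + b))).
Proof.
move=> t0 sP bf.
rewrite (_ : (fun z => f z * p t 0 (s * z + b)) = (fun z => p t (- s * b) z * f z)).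
  exact: heat_integrable bf.
apply/funext => z; rewrite mulrC; congr (_ * _); apply: bm_density_diff.
by case: sP => ->; ring.
Qed.

(** Moving the translations and reflections from [f] to the Gaussian kernel turns
    the images of [f] into the images of the kernel. *)
Lemma heat_images c h t f C N : 0 < t -> bounded_measurable C f ->
  heat t (images c h f N) c = \int[mu]_z (f z * Delta_partial N (z - c) h t) /\
  bounded_measurable (N%:R * 2 * (2 * C)) (images c h f N) /\
  mu.-integrable setT (EFin \o (fun z => f z * Delta_partial N (z - c) h t)).
Proof.
move=> t0 bf; have [mf fC] := bf.
have bt a : bounded_measurable C (fun z => f (z - a)).
  by split => //; apply: (measurableT_comp mf); exact: measurable_funB.
have br a : bounded_measurable C (fun z => f (a - z)).
  by split => //; apply: (measurableT_comp mf); exact: measurable_funB.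
pose k (m : int) z := p t 0 (z - c + 4 * m%:~R * h) - p t 0 (z - c + 2 * h * (2 * m%:~R + 1)).
have i1 a : mu.-integrable setT (EFin \o (fun z => f z * p t 0 (z - c + a))).
  have := integrable_bm_density0 (- c + a) t0 (or_introl erefl) bf.
  by under [X in _.-integrable _ (EFin \o X) -> _]eq_fun do rewrite mul1r addrA.
have kI m : mu.-integrable setT (EFin \o (fun z => f z * k m z)).
  rewrite (_ : _ \o _ = (fun z => (f z * p t 0 (z - c + 4 * m%:~R * h))%:E
      - (f z * p t 0 (z - c + 2 * h * (2 * m%:~R + 1)))%:E)%E); last first.
    by apply/funext => z /=; rewrite /k mulrBr EFinB.
  exact: (integrableB measurableT (i1 _) (i1 _)).
have imE m : image_term c h f m = (fun z => f (z - 4 * m%:~R * h)) \-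
    (fun z => f (2 * c - 2 * h * (2 * m%:~R + 1) - z)).
  by apply/funext => z; rewrite /image_term /=; congr (_ - _); congr f; ring.
have bi m : bounded_measurable (2 * C) (image_term c h f m).
  rewrite imE; split; first by apply: measurable_funB; [apply: (bt _).1|apply: (br _).1].
  move=> z /=; rewrite (_ : 2 * C = C + C); last by ring.
  by apply: le_trans (ler_normB _ _) _; apply: lerD.
have hi m : heat t (image_term c h f m) c = \int[mu]_z (f z * k m z).
  rewrite imE (heatB _ t0 (bt _) (br _)) (heat_translate _ _ t0 bf) (heat_flip _ _ t0 bf).
  rewrite -RintegralB//; last first.
    have := integrable_bm_density0 (2 * c - 2 * h * (2 * m%:~R + 1) - c) t0 (or_intror erefl) bf.
    apply: eq_integrable => // z _ /=; congr (_ * p t 0 _)%:E; ring.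
  apply: eq_Rintegral => z _; rewrite /k mulrBr; congr (_ - _ * _).
  by apply: bm_density_diff; ring.
elim: N => [|N [IH1 [IH2 IH3]]].
  have E0 : (fun z => f z * Delta_partial 0 (z - c) h t) = cst 0.
    by apply/funext => z; rewrite /Delta_partial /bilateral_partial big_ord0 mulr0.
  have E1 : images c h f 0 = cst 0.
    by apply/funext => z; rewrite /images /bilateral_partial big_ord0.
  rewrite E0 E1 heat_cst// Rintegral_cst// !mul0r; split => //; split.
    by split => // z; rewrite normr0.
  exact: integrable0.
have E1 : images c h f N.+1 = images c h f N \+ (image_term c h f N%:Z \+ image_term c h f (- N.+1%:Z)).
  by apply/funext => z; rewrite /images /bilateral_partial big_ord_recr.
have E0 : (fun z => f z * Delta_partial N.+1 (z - c) h t) =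
    (fun z => f z * Delta_partial N (z - c) h t + (f z * k N%:Z z + f z * k (- N.+1%:Z) z)).
  by apply/funext => z; rewrite /Delta_partial /bilateral_partial big_ord_recr /= !mulrDr.
have b2 : bounded_measurable (2 * C + 2 * C) (image_term c h f N%:Z \+ image_term c h f (- N.+1%:Z)).
  split; first by apply: measurable_funD; apply: (bi _).1.
  by move=> z /=; apply: le_trans (ler_normD _ _) _; apply: lerD; apply: (bi _).2.
have i2 : mu.-integrable setT (EFin \o (fun z => f z * k N%:Z z + f z * k (- N.+1%:Z) z)).
  exact: (integrableD measurableT (kI _) (kI _)).
have i3 : mu.-integrable setT (EFin \o (fun z => f z * Delta_partial N (z - c) h t + (f z * k N%:Z z + f z * k (- N.+1%:Z) z))).
  exact: (integrableD measurableT IH3 i2).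
rewrite E0 E1; split; last split => //.
  rewrite (heatD _ t0 IH2 b2) (heatD _ t0 (bi _) (bi _)) IH1 !hi.
  rewrite [RHS]RintegralD//; congr (_ + _); rewrite RintegralD//; exact: kI.
split; first by apply: measurable_funD; [exact: IH2.1|exact: b2.1].
move=> z /=; apply: le_trans (ler_normD _ _) _.
rewrite (_ : N.+1%:R * 2 * (2 * C) = N%:R * 2 * (2 * C) + (2 * C + 2 * C)); last by rewrite -natr1; ring.
by apply: lerD; [exact: IH2.2|exact: b2.2].
Qed.

End DeltaSeries.

(** * The survival formula *)

Section SurvivalFormula.
Context {R : realType}.
Notation mu := (@lebesgue_measure R).
Implicit Types (a z e r : R).
Variables (c h t : R).
Hypothesis h_gt0 : 0 < h.
Hypothesis t_gt0 : 0 < t.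

Let I : set R := `]c - h, c + h[.

Let mI : measurable I. Proof. exact: measurable_itv. Qed.

Lemma mu_itv_fin : (mu I < +oo)%E.
Proof. by rewrite /I lebesgue_measure_itv /=; case: ifP => _; rewrite ?ltry// -EFinD ltry. Qed.

Lemma I_norm z : I z -> `|z - c| <= h.
Proof.
rewrite /I /= in_itv /= => /andP[z1 z2].
by rewrite ler_norml; apply/andP; split; lra.
Qed.

Lemma measurable_Delta_shift : measurable_fun I (fun z => Delta (z - c) h t).
Proof.
apply: measurable_Delta => //; first exact: measurable_funB.
by move=> z /I_norm.
Qed.

Lemma image_integral_cvg (f : R -> R) C : bounded_measurable C f ->
  (fun N => \int[mu]_(z in I) (f z * Delta_partial N (z - c) h t)) @ \oo -->
  \int[mu]_(z in I) (f z * Delta (z - c) h t).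
Proof.
move=> [mf fC]; apply: (Rintegral_bounded_cvg (C := C * Delta_bound h t)) => //.
- exact: mu_itv_fin.
- move=> N; apply: measurable_funM; first exact: measurable_funTS.
  by apply: measurable_Delta_partial => //; exact: measurable_funB.
- by move=> N z /I_norm zc; rewrite normrM; apply: ler_pM => //; exact: Delta_partial_bound.
- move=> z /I_norm zc; apply: cvgM; first exact: cvg_cst.
  exact: Delta_partial_cvg.
Qed.

Definition cutoff (j : nat) z := Num.min 1 (j%:R * Num.max 0 (h - `|z - c|)).

Lemma cutoff_ge0 j z : 0 <= cutoff j z.
Proof. by rewrite le_min ler01 mulr_ge0// le_max lexx. Qed.

Lemma cutoff_le1 j z : cutoff j z <= 1.
Proof. by rewrite ge_min lexx. Qed.

Lemma cutoff_lipschitz j y z : `|cutoff j y - cutoff j z| <= j%:R * `|y - z|.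
Proof.
have minl (a b : R) : `|Num.min 1 a - Num.min 1 b| <= `|a - b|.
  rewrite /Num.min; case: ltP => ha; case: ltP => hb; rewrite ?subrr ?normr0//.
    by rewrite ger0_norm ?subr_ge0//; apply: le_trans (ler_norm _); lra.
  by rewrite distrC (distrC a) ger0_norm ?subr_ge0//; apply: le_trans (ler_norm _); lra.
have maxl (a b : R) : `|Num.max 0 a - Num.max 0 b| <= `|a - b|.
  rewrite /Num.max; case: ltP => ha; case: ltP => hb; rewrite ?subrr ?normr0//.
    by rewrite subr0 gtr0_norm//; apply: le_trans (ler_norm _); lra.
  by rewrite sub0r normrN gtr0_norm// distrC; apply: le_trans (ler_norm _); lra.
apply: le_trans (minl _ _) _; rewrite -mulrBr normrM ger0_norm// ler_wpM2l//.
apply: le_trans (maxl _ _) _.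
have -> : h - `|y - c| - (h - `|z - c|) = `|z - c| - `|y - c| by ring.
apply: le_trans (ler_dist_dist _ _) _.
by rewrite (distrC y) opprB addrA subrK.
Qed.

Lemma cutoff_out j z : h <= `|z - c| -> cutoff j z = 0.
Proof. by move=> hz; rewrite /cutoff max_l ?subr_le0// mulr0 min_r. Qed.

Lemma cutoff_near z : `|z - c| < h -> \forall j \near \oo, cutoff j z = 1.
Proof.
move=> zh; have d0 : 0 < h - `|z - c| by rewrite subr_gt0.
near=> j; rewrite /cutoff max_r ?ltW// min_l//.
rewrite -ler_pdivrMr//; near: j; exact: nbhs_infty_ger.
Unshelve. all: by end_near. Qed.

Lemma cutoff_bounded_lipschitz (f : R -> R) C L j : bounded_lipschitz C L f ->
  bounded_lipschitz C (C * j%:R + L) (fun z => f z * cutoff j z).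
Proof.
move=> [fC fL]; have C0 : 0 <= C by apply: le_trans (fC 0).
split=> [z|y z].
  rewrite normrM -[leRHS]mulr1; apply: ler_pM => //.
  by rewrite ger0_norm ?cutoff_ge0 ?cutoff_le1.
have -> : f y * cutoff j y - f z * cutoff j z = f y * (cutoff j y - cutoff j z) + (f y - f z) * cutoff j z by ring.
apply: le_trans (ler_normD _ _) _; rewrite [leRHS]mulrDl; apply: lerD.
  by rewrite normrM -mulrA; apply: ler_pM => //; exact: cutoff_lipschitz.
rewrite normrM -[leRHS]mulr1; apply: ler_pM => //.
by rewrite ger0_norm ?cutoff_ge0 ?cutoff_le1.
Qed.

Context d (S : measurableType d) (P : probability S R).
Variables (D : set R) (q : R -> R -> R -> R) (X : R -> {RV P >-> R}).
Hypothesis HM : markov_process D q c X.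
Variables (th w0 : R) (w : R -> R).
Hypothesis thP : th = 0 \/ th = 1 /\ 0 < c - h.
Hypothesis mw : measurable_fun setT w.
Hypothesis w0_gt0 : 0 < w0.
Hypothesis w_ge : forall z, c - h < z < c + h -> w0 <= w z.
Hypothesis ID : forall z, c - h < z < c + h -> D z.
Hypothesis qE : forall dt a z : R, 0 < dt -> c - h < a < c + h -> c - h < z < c + h ->
  q dt a z = w z / w a * reflected_kernel th dt a z.

(** The method of images needs functions that vanish outside of the interval; the
    general case follows by cutting [f] off near the end points, with bounded
    convergence on both sides. *)
Lemma survival_formula (f : R -> R) C L : bounded_lipschitz C L f -> (forall z, 0 <= f z) ->
  w c * survival_integral c X h w f t = \int[mu]_(z in I) (f z * Delta (z - c) h t).
Proof.
move=> fCL f_ge0; have bf := bounded_lipschitz_measurable fCL.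
have C0 : 0 <= C by apply: le_trans (fCL.1 0).
have bfj j := cutoff_bounded_lipschitz j fCL.
have E j : w c * survival_integral c X h w (fun z => f z * cutoff j z) t =
    \int[mu]_(z in I) (f z * cutoff j z * Delta (z - c) h t).
  have f0 z : h <= `|z - c| -> f z * cutoff j z = 0 by move=> hz; rewrite cutoff_out ?mulr0.
  have fj0 z : 0 <= f z * cutoff j z by rewrite mulr_ge0 ?cutoff_ge0.
  have H1 := survive_cvg HM h_gt0 thP mw w0_gt0 w_ge ID qE (bfj j) fj0 f0 t_gt0.
  have H2 := image_integral_cvg (bounded_lipschitz_measurable (bfj j)).
  rewrite -(cvg_lim _ H1)// -(cvg_lim _ H2)//; congr (limn _).
  apply/funext => N; have [-> _] := heat_images c h N t_gt0 (bounded_lipschitz_measurable (bfj j)).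
  rewrite [RHS]Rintegral_mkcond; apply: eq_Rintegral => z _; rewrite patchE.
  case: ifPn => // zI; rewrite f0 ?mul0r//.
  rewrite leNgt; apply: contra zI => zc; apply/mem_set; rewrite /I /= in_itv /=.
  by move: zc; rewrite ltr_norml => /andP[? ?]; apply/andP; split; lra.
have cvR : (fun j => \int[mu]_(z in I) (f z * cutoff j z * Delta (z - c) h t)) @ \oo -->
    \int[mu]_(z in I) (f z * Delta (z - c) h t).
  apply: (Rintegral_bounded_cvg (C := C * Delta_bound h t)) => //.
  - exact: mu_itv_fin.
  - move=> j; apply: measurable_funM; last exact: measurable_Delta_shift.
    by apply: measurable_funTS; exact: (bounded_lipschitz_measurable (bfj j)).1.
  - move=> j z /I_norm zc; rewrite normrM; apply: ler_pM => //; first exact: (bfj j).1.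
    exact: Delta_bounded.
  - move=> z Iz; apply: cvgM; last exact: cvg_cst.
    apply: cvg_near_cst; near=> j; rewrite (_ : cutoff j z = 1) ?mulr1//.
    near: j; apply: cutoff_near; move: Iz; rewrite /I /= in_itv /= => /andP[? ?].
    by rewrite ltr_norml; apply/andP; split; lra.
have cvL : (fun j => survival_integral c X h w (fun z => f z * cutoff j z) t) @ \oo -->
    survival_integral c X h w f t.
  have mX : measurable_fun setT (X t) by exact: measurable_funPT.
  apply: (Rintegral_bounded_cvg (C := C / w0)) => //.
  - by apply: (le_lt_trans (probability_le1 P measurableT)); rewrite ltry.
  - move=> j; apply: measurable_funM.
      apply: measurable_indic; apply: (@measurable_path_set _ _ _ _ X t); exact: open_stay_path_events.
    apply: (measurableT_comp (f := weighted I w (fun z => f z * cutoff j z))) => //.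
    apply: measurable_weighted => //; exact: (bounded_lipschitz_measurable (bfj j)).1.
  - move=> j o _; rewrite normrM -[leRHS]mul1r; apply: ler_pM => //.
      by rewrite indicE ger0_norm// lern1 leq_b1.
    by apply: (weighted_bounded _ w0_gt0 _ (bfj j).1) => z; rewrite /I /= in_itv; exact: w_ge.
  - move=> o _; apply: cvgM; first exact: cvg_cst.
    apply: cvg_near_cst; rewrite /weighted.
    have [Iz|nIz] := pselect (I (X t o)); last by near=> j; rewrite !indicE (memNset nIz) !mul0r.
    near=> j; rewrite (_ : cutoff j (X t o) = 1) ?mulr1//.
    near: j; apply: cutoff_near; move: Iz; rewrite /I /= in_itv /= => /andP[? ?].
    by rewrite ltr_norml; apply/andP; split; lra.
have cvL' : (fun j => w c * survival_integral c X h w (fun z => f z * cutoff j z) t) @ \oo -->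
    w c * survival_integral c X h w f t.
  by apply: cvgM; [exact: cvg_cst|exact: cvL].
rewrite -(cvg_lim _ cvL')// -(cvg_lim _ cvR)//; congr (limn _).
by apply/funext => j /=; rewrite E.
Unshelve. all: by end_near. Qed.

End SurvivalFormula.

(** * The q-binomial theorem *)

Section QBinomial.
Context {R : realType}.
Implicit Types (x y : R) (n i k M : nat).
Variable Q : R.

Fixpoint qbin n i : R :=
  match n, i with
  | _, 0 => 1
  | 0, _.+1 => 0
  | n'.+1, i'.+1 => qbin n' i' + Q ^+ i'.+1 * qbin n' i'.+1
  end.

Lemma qbin0 n : qbin n 0 = 1. Proof. by case: n. Qed.

Arguments qbin : simpl never.

Lemma qbinS n i : qbin n.+1 i.+1 = qbin n i + Q ^+ i.+1 * qbin n i.+1.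
Proof. by []. Qed.

Lemma qbin_small n i : (n < i)%N -> qbin n i = 0.
Proof.
elim: n i => [|n IH] [|i] // ni.
rewrite qbinS !IH ?mulr0 ?addr0//; exact: leqW.
Qed.

(** Gauss's q-binomial theorem, by peeling off the factor [1 + x]. *)
Lemma qbinomial_theorem n x :
  \prod_(j < n) (1 + x * Q ^+ j) = \sum_(i < n.+1) Q ^+ 'C(i, 2) * qbin n i * x ^+ i.
Proof.
elim: n x => [|n IH] x.
  by rewrite big_ord0 big_ord_recl big_ord0 /= addr0 qbin0 !mulr1.
rewrite big_ord_recl /= expr0 mulr1.
under eq_bigr do rewrite /bump /= add1n exprS mulrA.
rewrite (IH (x * Q)) mulrDl mul1r mulr_sumr [X in X + _]big_ord_recl.
rewrite [RHS]big_ord_recl !qbin0 !expr0 /= !mulr1 -addrA; congr (_ + _).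
have E1 : \sum_(i < n) Q ^+ 'C(bump 0 i, 2) * qbin n (bump 0 i) * (x * Q) ^+ bump 0 i =
   \sum_(i < n.+1) Q ^+ 'C(i.+1, 2) * qbin n i.+1 * (x * Q) ^+ i.+1.
  rewrite [RHS]big_ord_recr /= (qbin_small (ltnSn n)) mulr0 mul0r addr0.
  by apply: eq_bigr => i _; rewrite /bump /= add1n.
rewrite E1 -big_split /=; apply: eq_bigr => i _; rewrite /bump /= add1n.
rewrite qbinS binS bin1 addnC !exprD !exprMn !exprS.
ring.
Qed.

(** The q-Pochhammer symbol [(Q; Q)_n]. *)
Definition qpoch n : R := \prod_(j < n) (1 - Q ^+ j.+1).

Lemma qpochS n : qpoch n.+1 = qpoch n * (1 - Q ^+ n.+1).
Proof. by rewrite /qpoch big_ord_recr. Qed.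

Lemma qbin_qpoch n i : (i <= n)%N -> qbin n i * qpoch i * qpoch (n - i) = qpoch n.
Proof.
elim: n i => [|n IH] [|i] // ni; rewrite ?subn0.
- by rewrite /= /qpoch big_ord0 !mulr1.
- by rewrite qbin0 {1}/qpoch big_ord0 !mul1r.
rewrite subSS qbinS !qpochS.
have H1 := IH i ni.
have [->|ni'] := eqVneq i n.
  rewrite (qbin_small (ltnSn n)) mulr0 addr0 subnn.
  by rewrite mulrA mulrAC -[in X in X * _](subnn n) IH.
have lt : (i < n)%N by rewrite ltn_neqAle ni'.
have H2 := IH i.+1 lt.
have E : (n - i = (n - i.+1).+1)%N by rewrite subnSK.
have EQ : Q ^+ n.+1 = Q ^+ i.+1 * Q ^+ (n - i) by rewrite -exprD; congr (_ ^+ _); rewrite addSn subnKC// ltnW.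
rewrite EQ E qpochS -E.
transitivity (qbin n i * qpoch i * qpoch (n - i) * (1 - Q ^+ i.+1) +
  Q ^+ i.+1 * (qbin n i.+1 * qpoch i.+1 * qpoch (n - i.+1)) * (1 - Q ^+ (n - i))).
  by rewrite E !qpochS; ring.
by rewrite H1 H2; ring.
Qed.

Hypothesis Q_gt0 : 0 < Q.
Hypothesis Q_lt1 : Q < 1.

Let Qn_gt0 n : 0 < Q ^+ n. Proof. exact: exprn_gt0. Qed.
Let QSn_lt1 n : Q ^+ n.+1 < 1. Proof. by rewrite exprn_ilt1// ltW. Qed.

Lemma qpoch_gt0 n : 0 < qpoch n.
Proof. by apply: prodr_gt0 => i _; rewrite subr_gt0. Qed.

Lemma qpoch_le1 n : qpoch n <= 1.
Proof.
elim: n => [|n IH]; first by rewrite /qpoch big_ord0.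
rewrite qpochS -[leRHS]mulr1; apply: ler_pM => //.
- exact/ltW/qpoch_gt0.
- by rewrite subr_ge0 ltW.
- by rewrite gerBl ltW.
Qed.

Lemma qpoch_le n k : qpoch (n + k) <= qpoch n.
Proof.
elim: k => [|k IH]; first by rewrite addn0.
rewrite addnS qpochS; apply: le_trans IH; rewrite ler_piMr//; first exact/ltW/qpoch_gt0.
by rewrite gerBl ltW.
Qed.

Lemma qpoch_ge n k : qpoch n * (1 - Q ^+ n / (1 - Q)) <= qpoch (n + k).
Proof.
have Q1 : 0 < 1 - Q by rewrite subr_gt0.
suff H : qpoch n * (1 - Q ^+ n * (1 - Q ^+ k) / (1 - Q)) <= qpoch (n + k).
  apply: le_trans H; rewrite ler_pM2l ?qpoch_gt0// lerD2l lerN2.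
  rewrite ler_pM2r ?invr_gt0// ler_piMr ?gerBl ?ltW//.
elim: k => [|k IH]; first by rewrite addn0 expr0 subrr mulr0 mul0r subr0 mulr1.
rewrite addnS qpochS.
set u := Q ^+ n * (1 - Q ^+ k) / (1 - Q) in IH.
have -> : Q ^+ n * (1 - Q ^+ k.+1) / (1 - Q) = u + Q ^+ (n + k).
  by rewrite /u exprD exprS; field; rewrite gt_eqF.
have u0 : 0 <= u.
  rewrite /u divr_ge0 ?(ltW Q1)// mulr_ge0 ?(ltW (Qn_gt0 _))// subr_ge0.
  by rewrite exprn_ile1// ltW.
have Hle : qpoch (n + k) <= qpoch n by exact: qpoch_le.
have q1 : Q ^+ (n + k).+1 <= Q ^+ (n + k) by rewrite exprS ler_piMl ?ltW.
have P0 : 0 < qpoch n by exact: qpoch_gt0.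
apply: (@le_trans _ _ (qpoch (n + k) - qpoch n * Q ^+ (n + k))).
  move: IH; rewrite opprD addrA [leLHS]mulrDr; lra.
rewrite mulrBr mulr1 lerD2l lerN2.
apply: ler_pM => //; first exact/ltW/qpoch_gt0.
exact: ltW.
Qed.

Lemma qpoch_center M k : (k <= M)%N -> qpoch M ^+ 2 <= qpoch (M + k) * qpoch (M - k).
Proof.
elim: k => [|k IH] kM; first by rewrite addn0 subn0 expr2.
apply: le_trans (IH (ltnW kM)) _.
have E : (M - k = (M - k.+1).+1)%N by rewrite subnSK.
rewrite addnS qpochS E qpochS.
have le : Q ^+ (M + k).+1 <= Q ^+ (M - k.+1).+1.
  rewrite ler_wiXn2l ?ltW// ltnS; apply: leq_trans (leq_addr _ _); exact: leq_subr.
rewrite mulrA -[leRHS]mulrA [in leRHS](mulrC _ (qpoch (M - k.+1))) mulrA.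
rewrite ler_wpM2l ?lerD2l ?lerN2//.
by rewrite mulr_ge0// ltW// qpoch_gt0.
Qed.

(** The coefficient [qbin M.*2 i] divided by the central one, the latter being
    written as a quotient of q-Pochhammer symbols. *)
Definition central_ratio M i := qpoch M ^+ 2 / qpoch M.*2 * qbin M.*2 i.

(** By [qbin_qpoch] it is [qpoch M ^+ 2 / (qpoch (M + k) * qpoch (M - k))], and the
    extra factors [1 - Q ^+ j] all have [j > M - k]. *)
Lemma central_ratio_near1 M i k : (k <= M)%N -> (i = M + k)%N \/ (i = M - k)%N ->
  `|1 - central_ratio M i| <= Q ^+ (M - k) / (1 - Q).
Proof.
move=> kM iP.
have Q1 : 0 < 1 - Q by rewrite subr_gt0.
have i2 : (i <= M.*2)%N.
  by rewrite -addnn; case: iP => ->; [rewrite leq_add2l|apply: leq_trans (leq_subr _ _) (leq_addr _ _)].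
have P0 n : qpoch n != 0 by rewrite gt_eqF// qpoch_gt0.
have E : central_ratio M i = qpoch M ^+ 2 / (qpoch (M + k) * qpoch (M - k)).
  have := qbin_qpoch i2.
  have -> : qbin M.*2 i * qpoch i * qpoch (M.*2 - i) = qbin M.*2 i * (qpoch (M + k) * qpoch (M - k)).
    rewrite -mulrA; congr (_ * _); rewrite -addnn; case: iP => ->.
      by rewrite subnDl.
    by rewrite mulrC; congr (qpoch _ * _); rewrite -addnBA ?leq_subr// subKn.
  move=> H; have qb : qbin M.*2 i = qpoch M.*2 / (qpoch (M + k) * qpoch (M - k)).
    by rewrite -H; field; rewrite !P0.
  by rewrite /central_ratio qb; field; rewrite !P0.
have D0 : 0 < qpoch (M + k) * qpoch (M - k) by rewrite mulr_gt0 ?qpoch_gt0.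
have r1 : central_ratio M i <= 1 by rewrite E ler_pdivrMr// mul1r qpoch_center.
rewrite ger0_norm ?subr_ge0// lerBlDr addrC -lerBlDr.
rewrite E ler_pdivlMr// expr2.
have H := qpoch_ge (M - k) k; rewrite subnK// in H.
apply: (@le_trans _ _ (qpoch (M + k) * qpoch M)).
  by rewrite mulrCA ler_pM2l ?qpoch_gt0// mulrC.
by rewrite ler_pM2r ?qpoch_gt0// qpoch_le.
Qed.

End QBinomial.

(** * Positivity of the image series *)

Section DeltaPositive.
Context {R : realType}.
Notation p := (@bm_density R).
Implicit Types (a b h t x y z q rho T : R) (n i j k l M N : nat).

(** A lower bound for all finite products of [1 - x l] with
    [0 <= x l <= a * b ^+ l], obtained from [1 - x >= exp (- x / (1 - a))]. *)
Definition prod_floor a b : R := expR (- (a / (1 - a) / (1 - b))).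

Lemma prod_lower_bound M a b (x : nat -> R) : 0 <= a -> a < 1 -> 0 < b -> b < 1 ->
  (forall l, 0 <= x l <= a * b ^+ l) -> prod_floor a b <= \prod_(l < M) (1 - x l).
Proof.
move=> a0 a1 b0 b1 xb.
have a1' : 0 < 1 - a by rewrite subr_gt0.
have b1' : 0 < 1 - b by rewrite subr_gt0.
have bl l : b ^+ l <= 1 by rewrite exprn_ile1// ltW.
have F l : expR (- (x l / (1 - a))) <= 1 - x l.
  have /andP[x0 xab] := xb l.
  have xa : x l <= a by apply: le_trans xab _; rewrite ler_piMr.
  rewrite expRN -div1r ler_pdivrMr ?expR_gt0//.
  apply: (@le_trans _ _ ((1 - x l) * (1 + x l / (1 - a)))).
    have -> : (1 - x l) * (1 + x l / (1 - a)) = 1 + x l * (a - x l) / (1 - a) by field; rewrite gt_eqF.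
    by rewrite lerDl divr_ge0 ?mulr_ge0 ?subr_ge0// ltW.
  by rewrite ler_wpM2l ?subr_ge0 ?expR_ge1Dx// (le_trans xa)// ltW.
apply: (@le_trans _ _ (\prod_(l < M) expR (- (x l / (1 - a))))); last first.
  by apply: ler_prod => l _; rewrite expR_ge0 F.
rewrite -expR_sum ler_expR sumrN lerN2 -mulr_suml.
rewrite mulrAC ler_pM2r ?invr_gt0//.
apply: (@le_trans _ _ (series (geometric a b) M)).
  rewrite /series /= big_mkord; apply: ler_sum => l _.
  by have /andP[] := xb l.
by apply: geometric_le_lim => //; rewrite gtr0_norm.
Qed.

Variables (h : R).
Hypothesis h_gt0 : 0 < h.

Section Fixed.
Variables (z t : R).
Hypothesis t_gt0 : 0 < t.
Hypothesis zh : `|z| <= h.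

Let Q := expR (- (4 * h ^+ 2 / t)).
Let Q_gt0 : 0 < Q. Proof. exact: expR_gt0. Qed.
Let a_gt0 : 0 < 4 * h ^+ 2 / t. Proof. by rewrite divr_gt0 ?mulr_gt0 ?exprn_gt0. Qed.
Let Q_lt1 : Q < 1. Proof. by rewrite -expR0 ltr_expR oppr_lt0. Qed.

(* The image series is an alternating sum over the points [z + 2 * k * h];
   [phi M i] is the Gaussian at [k = i - M], and [y] and [Q] are the data of the
   q-binomial theorem for which its terms are the [phi M i] times the
   coefficients [qbin]. *)
Let phi M i := expR (- (z + 2 * (i%:R - M%:R) * h) ^+ 2 / (2 * t)).

Let side (s : R) l := expR (s * (2 * z * h / t) - 2 * h ^+ 2 / t * (1 + 2 * l%:R)).

Let y M := expR (- (2 * z * h / t) - 2 * h ^+ 2 / t * (1 - 2 * M%:R)).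

Let phiE M i : phi M i = phi M 0 * (Q ^+ 'C(i, 2) * y M ^+ i).
Proof.
elim: i => [|i IH]; first by rewrite bin0n !mulr1.
rewrite binS bin1 addnC exprD exprS.
transitivity (phi M i * (Q ^+ i * y M)); last by rewrite IH; ring.
rewrite /phi /Q -expRM_natl -!expRD; congr expR.
by rewrite -natr1; field; rewrite gt_eqF.
Qed.

(** The finite form of the Jacobi triple product: the alternating sum of the
    [phi M i], weighted by q-binomial coefficients, has factors [1 - side s l] in
    [(0, 1)]. Pulling out the factors larger than one gives the sign [(-1) ^+ M],
    hence the parity condition. *)
Let theta_product M : ~~ odd M ->
  phi M 0 * \prod_(j < M.*2) (1 - y M * Q ^+ j) =
  expR (- z ^+ 2 / (2 * t)) * (\prod_(l < M) (1 - side 1 l) * \prod_(l < M) (1 - side (-1) l)).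
Proof.
move=> oM.
have EP m : expR (- (z + 2 * (0 - m%:R) * h) ^+ 2 / (2 * t)) * \prod_(l < m) (side 1 l)^-1 =
    expR (- z ^+ 2 / (2 * t)).
  elim: m => [|m IH]; first by rewrite big_ord0 mulr1; congr expR; field; rewrite gt_eqF.
  rewrite big_ord_recr /= -IH mulrA mulrAC; congr (_ * _).
  rewrite /side -expRN -expRD; congr expR.
  by rewrite -natr1; field; rewrite gt_eqF.
rewrite -addnn big_split_ord /=.
have -> : \prod_(i < M) (1 - y M * Q ^+ (M + i)) = \prod_(l < M) (1 - side (-1) l).
  apply: eq_bigr => l _; congr (1 - _).
  rewrite /y /Q /side -expRM_natl -expRD; congr expR; rewrite natrD; field.
  by rewrite gt_eqF.
have -> : \prod_(i < M) (1 - y M * Q ^+ i) = \prod_(l < M) (side 1 l)^-1 * \prod_(l < M) (1 - side 1 l).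
  rewrite (reindex_inj rev_ord_inj) /=.
  transitivity (\prod_(l < M) (- 1 * ((side 1 l)^-1 * (1 - side 1 l)))).
    apply: eq_bigr => l _.
    have -> : y M * Q ^+ (M - l.+1) = (side 1 l)^-1.
      rewrite /y /Q /side -expRN -expRM_natl -expRD; congr expR.
      rewrite natrB// -natr1; field.
      by rewrite gt_eqF.
    by field; rewrite gt_eqF// expR_gt0.
  rewrite big_split /= prodr_const card_ord -signr_odd (negbTE oM) expr0 mul1r.
  by rewrite big_split.
rewrite mulrA [in LHS]mulrA -mulrA; congr (_ * _).
exact: EP.
Qed.

(** The weights of the triple product are far from their central value only where
    the Gaussian [phi M i] is small: their product is uniformly of order
    [exp (- 4 h^2 M / t)]. *)
Let phi_far M i k : (k <= M)%N -> (i = M + k)%N \/ (i = M - k)%N ->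
  phi M i * Q ^+ (M - k) <= expR (4 * h ^+ 2 / t) * expR (- (4 * h ^+ 2 / t) * M%:R).
Proof.
move=> kM iP.
have t2 : 0 < 2 * t by rewrite mulr_gt0.
rewrite /phi /Q -expRM_natl -!expRD ler_expR natrB//.
have /andP[z1 z2] : - h <= z <= h by rewrite -ler_norml.
have sq : (2 * k%:R * h) ^+ 2 - 4 * k%:R * h ^+ 2 <= (z + 2 * (i%:R - M%:R) * h) ^+ 2.
  have k0 : 0 <= k%:R :> R by [].
  have kh : 0 <= k%:R * h by rewrite mulr_ge0// ltW.
  have zk1 : - (h * (k%:R * h)) <= z * (k%:R * h) <= h * (k%:R * h).
    by apply/andP; split; rewrite ?ler_wpM2r// -mulNr ler_wpM2r.
  move: zk1 => /andP[zk1 zk2].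
  rewrite (_ : 4 * k%:R * h ^+ 2 = 4 * (h * (k%:R * h))); last by ring.
  have zz := sqr_ge0 z.
  case: iP => ->; rewrite ?natrD ?natrB//.
    rewrite (_ : (z + 2 * (M%:R + k%:R - M%:R) * h) ^+ 2 = z ^+ 2 + 4 * (z * (k%:R * h)) + (2 * k%:R * h) ^+ 2); last by ring.
    lra.
  rewrite (_ : (z + 2 * (M%:R - k%:R - M%:R) * h) ^+ 2 = z ^+ 2 - 4 * (z * (k%:R * h)) + (2 * k%:R * h) ^+ 2); last by ring.
  lra.
apply: (@le_trans _ _ (- ((2 * k%:R * h) ^+ 2 - 4 * k%:R * h ^+ 2) / (2 * t) + (M%:R - k%:R) * - (4 * h ^+ 2 / t))).
  by rewrite lerD2r ler_pM2r ?invr_gt0// lerN2.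
have -> : - ((2 * k%:R * h) ^+ 2 - 4 * k%:R * h ^+ 2) / (2 * t) + (M%:R - k%:R) * - (4 * h ^+ 2 / t) =
  (4 * h ^+ 2 / t) * ((- k%:R ^+ 2 + 3 * k%:R) / 2 - M%:R) by field; rewrite gt_eqF.
have -> : 4 * h ^+ 2 / t + - (4 * h ^+ 2 / t) * M%:R = (4 * h ^+ 2 / t) * (1 - M%:R) by ring.
rewrite ler_pM2l// lerD2r ler_pdivrMr//.
case: k {kM iP sq} => [|[|k]]; rewrite ?expr0n //=; try lra.
have -> : k.+2%:R = k%:R + 2 :> R by rewrite -addn2 natrD.
have : 0 <= k%:R :> R by [].
nra.
Qed.

Let K := (Num.sqrt (2 * pi * t))^-1.
Let K_gt0 : 0 < K. Proof. by rewrite invr_gt0 sqrtr_gt0 !mulr_gt0// pi_gt0. Qed.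

Lemma alternating_bilateral N (v : int -> R) :
  \sum_(i < (4 * N)%N) (-1) ^+ i * v (i%:Z - (2 * N)%N%:Z) =
  bilateral_partial N (fun m => v (2 * m) - v (2 * m + 1)).
Proof.
elim: N => [|N IH]; first by rewrite /bilateral_partial !big_ord0.
rewrite (_ : bilateral_partial N.+1 _ = bilateral_partial N (fun m => v (2 * m) - v (2 * m + 1)) +
  (v (2 * N%:Z) - v (2 * N%:Z + 1) + (v (2 * - N.+1%:Z) - v (2 * - N.+1%:Z + 1)))); last first.
  by rewrite /bilateral_partial big_ord_recr.
rewrite -IH; have -> : (4 * N.+1 = (4 * N).+4)%N by rewrite mulnS.
rewrite big_ord_recl big_ord_recl big_ord_recr big_ord_recr /=.
rewrite /bump /= !add1n !expr0 !expr1.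
have e4 : (-1) ^+ (4 * N)%N = 1 :> R by rewrite -signr_odd oddM /= expr0.
rewrite !exprS e4.
have -> : (0 : int) - (2 * N.+1)%N%:Z = 2 * - N.+1%:Z by lia.
have -> : (1 : int) - (2 * N.+1)%N%:Z = 2 * - N.+1%:Z + 1 by lia.
have -> : ((4 * N).+2%:Z - (2 * N.+1)%N%:Z)%R = 2 * N%:Z by lia.
have -> : ((4 * N).+3%:Z - (2 * N.+1)%N%:Z)%R = 2 * N%:Z + 1 by lia.
set S := \sum_(i < _) _; set S' := \sum_(i < _) _.
have -> : S = S'.
  apply: eq_bigr => i _; rewrite !add1n !exprS mulrA mulrNN !mul1r.
  by congr (_ * v _); lia.
ring.
Qed.

Let Delta_phi N : Delta_partial N z h t = K * \sum_(i < (4 * N)%N) (-1) ^+ i * phi (2 * N)%N i.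
Proof.
pose v (k : int) := K * expR (- (z + 2 * k%:~R * h) ^+ 2 / (2 * t)).
rewrite mulr_sumr; transitivity (bilateral_partial N (fun m => v (2 * m) - v (2 * m + 1))).
  apply: eq_bilateral_partial => m; rewrite /v /bm_density !sub0r !sqrrN; congr (_ * expR _ - _ * expR _).
    by rewrite intrM /=; congr (- _ ^+ 2 / _); ring.
  by rewrite intrD intrM /=; congr (- _ ^+ 2 / _); ring.
rewrite -alternating_bilateral; apply: eq_bigr => i _; rewrite /v mulrCA; congr (_ * (_ * expR _)).
by rewrite intrD intrN.
Qed.

(** The triple product bounds the weighted sum from below, and replacing the
    weights by one costs [err N], which tends to [0]. *)
Lemma Delta_lower_fixed a b : 0 <= a -> a < 1 -> 0 < b -> b < 1 ->
  Q <= b -> (forall l, side 1 l <= a * b ^+ l) -> (forall l, side (-1) l <= a * b ^+ l) ->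
  K * (expR (- z ^+ 2 / (2 * t)) * (prod_floor a b ^+ 2 * prod_floor b b ^+ 2)) <= Delta z h t.
Proof.
move=> a0 a1 b0 b1 Qb s1 s2.
pose E := expR (4 * h ^+ 2 / t) / (1 - Q).
have Q1 : 0 < 1 - Q by rewrite subr_gt0.
have E0 : 0 <= E by rewrite divr_ge0 ?expR_ge0// ltW.
pose m0 := expR (- z ^+ 2 / (2 * t)) * (prod_floor a b ^+ 2 * prod_floor b b ^+ 2).
pose err N := (4 * (expR (8 * h ^+ 2 / t) * E + expR (8 * h ^+ 2 / t) * expR (4 * h ^+ 2 / t))) *
   (N.+1%:R * expR (- (8 * h ^+ 2 / t * N.+1%:R))).
have main N : K * (m0 - err N) <= Delta_partial N z h t.
  rewrite Delta_phi ler_pM2l//.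
  set M := (2 * N)%N.
  have M4 : (4 * N = M.*2)%N by rewrite /M -mul2n mulnA.
  rewrite M4.
  have oM : ~~ odd M by rewrite /M oddM.
  have side0 s l : 0 <= side s l by exact: expR_ge0.
  have pM : 0 < qpoch Q M by exact: qpoch_gt0.
  have pM2 : 0 < qpoch Q M.*2 by exact: qpoch_gt0.
  have WS : \sum_(i < M.*2.+1) (-1) ^+ i * phi M i * central_ratio Q M i =
     qpoch Q M ^+ 2 / qpoch Q M.*2 * (expR (- z ^+ 2 / (2 * t)) *
       (\prod_(l < M) (1 - side 1 l) * \prod_(l < M) (1 - side (-1) l))).
    rewrite -(theta_product oM).
    have -> : \prod_(j < M.*2) (1 - y M * Q ^+ j) = \prod_(j < M.*2) (1 + (- y M) * Q ^+ j).
      by apply: eq_bigr => j _; rewrite mulNr.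
    rewrite qbinomial_theorem mulr_sumr mulr_sumr; apply: eq_bigr => i _.
    rewrite phiE /central_ratio -[- y M]mulN1r exprMn; ring.
  have WSge : m0 <= \sum_(i < M.*2.+1) (-1) ^+ i * phi M i * central_ratio Q M i.
    have e0 := expR_ge0 (- z ^+ 2 / (2 * t)).
    have f1 : prod_floor a b <= \prod_(l < M) (1 - side 1 l).
      by apply: prod_lower_bound => // l; rewrite side0 s1.
    have f2 : prod_floor a b <= \prod_(l < M) (1 - side (-1) l).
      by apply: prod_lower_bound => // l; rewrite side0 s2.
    have f3 : prod_floor b b <= qpoch Q M.
      apply: (prod_lower_bound M (x := fun l => Q ^+ l.+1)) => //; first exact: ltW.
      move=> l; rewrite exprn_ge0 ?(ltW Q_gt0)//= exprS.
      apply: ler_pM => //; first exact: ltW.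
        by rewrite exprn_ge0 ?(ltW Q_gt0).
      by rewrite lerXn2r ?nnegrE ?(ltW Q_gt0)// ltW.
    have p0 a' b' : 0 <= prod_floor a' b' by exact: expR_ge0.
    rewrite WS /m0 [leRHS]mulrCA ler_wpM2l// [leLHS]mulrC; apply: ler_pM.
    - by rewrite exprn_ge0.
    - by rewrite exprn_ge0.
    - apply: (@le_trans _ _ (qpoch Q M ^+ 2)).
        by rewrite lerXn2r ?nnegrE// ltW.
      by rewrite ler_peMr ?exprn_ge0 ?(ltW pM)// invf_ge1// qpoch_le1.
    - by rewrite expr2; apply: ler_pM.
  have phi0 i : 0 <= phi M i by exact: expR_ge0.
  have ik (i : 'I_(M.*2.+1)) : exists2 k, (k <= M)%N & (nat_of_ord i = M + k)%N \/ (nat_of_ord i = M - k)%N.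
    case: i => i /=; rewrite ltnS -addnn => iM.
    case: (leqP M i) => Mi; first by exists (i - M)%N; [rewrite leq_subLR|left; rewrite subnKC].
    by exists (M - i)%N; [rewrite leq_subr|right; rewrite subKn// ltnW].
  pose B := expR (4 * h ^+ 2 / t) * expR (- (4 * h ^+ 2 / t) * M%:R).
  have B0 : 0 <= B by rewrite mulr_ge0 ?expR_ge0.
  have diff : \sum_(i < M.*2.+1) (-1) ^+ i * phi M i * central_ratio Q M i -
      \sum_(i < M.*2.+1) (-1) ^+ i * phi M i <= M.*2.+1%:R * (B / (1 - Q)).
    rewrite -sumrB; apply: le_trans (ler_norm _) _.
    apply: le_trans (ler_norm_sum _ _ _) _.
    rewrite mulr_natl -[in leRHS](card_ord M.*2.+1) -sumr_const; apply: ler_sum => i _.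
    rewrite -[X in _ - X]mulr1 -mulrBr normrM normrM normrX normrN1 expr1n mul1r ger0_norm//.
    rewrite distrC; have [k kM kP] := ik i.
    apply: (@le_trans _ _ (phi M i * (Q ^+ (M - k) / (1 - Q)))).
      by rewrite ler_wpM2l// central_ratio_near1.
    by rewrite mulrA ler_pM2r ?invr_gt0//; exact: phi_far.
  have last : phi M M.*2 <= B.
    have := @phi_far M M.*2 M (leqnn M); rewrite subnn expr0 mulr1; apply.
    by left; rewrite addnn.
  have split : \sum_(i < M.*2.+1) (-1) ^+ i * phi M i = \sum_(i < M.*2) (-1) ^+ i * phi M i + phi M M.*2.
    by rewrite big_ord_recr /= -signr_odd odd_double expr0 mul1r.
  have errB : M.*2.+1%:R * (B / (1 - Q)) + B <= err N.
    have BE : B = expR (4 * h ^+ 2 / t) * (expR (8 * h ^+ 2 / t) * expR (- (8 * h ^+ 2 / t * N.+1%:R))).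
      rewrite /B; congr (_ * _); rewrite -expRD; congr expR.
      by rewrite /M natrM -natr1; field; rewrite gt_eqF.
    rewrite /err; set X := expR (- (8 * _ / t * _)) in BE *; set Y := expR (8 * _ / t) in BE *.
    have X0 : 0 <= X by exact: expR_ge0.
    have Y0 : 0 <= Y by exact: expR_ge0.
    have -> : 4 * (Y * E + Y * expR (4 * h ^+ 2 / t)) * (N.+1%:R * X) = (4 * N.+1%:R) * (B / (1 - Q)) + (4 * N.+1%:R) * B.
      by rewrite BE /E; ring.
    apply: lerD.
      rewrite ler_wpM2r ?divr_ge0 ?(ltW Q1)// -natrM ler_nat -M4 mulnS.
      by rewrite -[X in (X <= _)%N]add1n leq_add2r.
    by rewrite ler_peMl// -natrM ler1n.
  move: WSge diff; rewrite split; move: (\sum_(i < M.*2.+1) _) (\sum_(i < M.*2) _) => U V.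
  move: (M.*2.+1%:R * _) errB => W errB; lra.
have cv1 : (fun N => K * (m0 - err N)) @ \oo --> K * (m0 - 0).
  apply: cvgM; first exact: cvg_cst.
  apply: cvgB; first exact: cvg_cst.
  rewrite -[X in _ --> X](mulr0 (4 * (expR (8 * h ^+ 2 / t) * E + expR (8 * h ^+ 2 / t) * expR (4 * h ^+ 2 / t)))).
  apply: cvgM; first exact: cvg_cst.
  by apply: nat_expRN_cvg0; rewrite divr_gt0 ?mulr_gt0 ?exprn_gt0.
rewrite subr0 in cv1.
by apply: (ler_cvg_to cv1 (Delta_partial_cvg h_gt0 t_gt0 zh)); apply: nearW.
Qed.

End Fixed.

(** As long as [z] stays away from the end points and [t] is bounded, the factors of
    the triple product obey one geometric bound. *)
Lemma Delta_lower_bound rho T : 0 <= rho -> rho < h -> 0 < T ->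
  exists2 k : R, 0 < k & forall z t, `|z| <= rho -> 0 < t -> t <= T ->
    (Num.sqrt (2 * pi * t))^-1 * (expR (- z ^+ 2 / (2 * t)) * k) <= Delta z h t.
Proof.
move=> rho0 rh T0.
pose a := expR (- (2 * h * (h - rho) / T)).
pose b := expR (- (4 * h ^+ 2 / T)).
have a1 : a < 1 by rewrite -expR0 ltr_expR oppr_lt0 divr_gt0 ?mulr_gt0// subr_gt0.
have b1 : b < 1 by rewrite -expR0 ltr_expR oppr_lt0 divr_gt0 ?mulr_gt0// exprn_gt0.
have b0 : 0 < b by exact: expR_gt0.
exists (prod_floor a b ^+ 2 * prod_floor b b ^+ 2).
  by rewrite mulr_gt0// exprn_gt0// expR_gt0.
move=> z t zr t0 tT.
have tT' : T^-1 <= t^-1 by rewrite lef_pV2.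
have zh : `|z| <= h by rewrite (le_trans zr)// ltW.
have sideb (s : R) l : `|s| = 1 -> expR (s * (2 * z * h / t) - 2 * h ^+ 2 / t * (1 + 2 * l%:R)) <= a * b ^+ l.
  move=> s1; rewrite /a /b -expRM_natl -expRD ler_expR.
  have sz : s * z <= rho by apply: le_trans (ler_norm _) _; rewrite normrM s1 mul1r.
  have -> : s * (2 * z * h / t) - 2 * h ^+ 2 / t * (1 + 2 * l%:R) =
    - ((2 * h * (h - s * z) + 4 * h ^+ 2 * l%:R) * t^-1) by field; rewrite gt_eqF.
  have -> : - (2 * h * (h - rho) / T) + l%:R * - (4 * h ^+ 2 / T) =
    - ((2 * h * (h - rho) + 4 * h ^+ 2 * l%:R) * T^-1) by field; rewrite gt_eqF.
  rewrite lerN2; apply: ler_pM => //.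
  - by rewrite addr_ge0// !mulr_ge0 ?sqr_ge0 ?subr_ge0 ?(ltW rh) ?(ltW h_gt0).
  - by rewrite invr_ge0 ltW.
  - by rewrite lerD2r ler_wpM2l ?mulr_ge0 ?(ltW h_gt0)// lerD2l lerN2.
apply: Delta_lower_fixed => //.
- exact: expR_ge0.
- by rewrite ler_expR lerN2 ler_wpM2l// mulr_ge0// sqr_ge0.
- by move=> l; apply: sideb; rewrite normr1.
- by move=> l; apply: sideb; rewrite normrN1.
Qed.

Lemma Delta_gt0 z t : `|z| < h -> 0 < t -> 0 < Delta z h t.
Proof.
move=> zh t0; have [k k0 H] := Delta_lower_bound (normr_ge0 z) zh t0.
apply: lt_le_trans (H z t (lexx _) t0 (lexx _)).
by rewrite !mulr_gt0 ?expR_gt0// invr_gt0 sqrtr_gt0 !mulr_gt0// pi_gt0.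
Qed.

End DeltaPositive.

(** * Integrals over rectangles *)

Section Rectangle.
Context {R : realType}.
Notation mu := (@lebesgue_measure R).

Lemma Fubini_rectangle (D1 D2 : set R) (F : R -> R -> R) C :
  measurable D1 -> measurable D2 -> (mu D1 < +oo)%E -> (mu D2 < +oo)%E ->
  measurable_fun (D1 `*` D2) (fun xy => F xy.1 xy.2) ->
  (forall x y, D1 x -> D2 y -> `|F x y| <= C) ->
  mu.-integrable D1 (EFin \o (fun x => \int[mu]_(y in D2) F x y)) /\
  \int[mu]_(x in D1) \int[mu]_(y in D2) F x y = \int[mu]_(y in D2) \int[mu]_(x in D1) F x y.
Proof.
move=> mD1 mD2 f1 f2 mF FC.
pose G := (fun xy : R * R => F xy.1 xy.2) \_ (D1 `*` D2).
have mD : measurable (D1 `*` D2) by exact: measurableX.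
have iG : (mu \x mu)%E.-integrable setT (EFin \o G).
  rewrite (_ : EFin \o G = (EFin \o (fun xy => F xy.1 xy.2)) \_ (D1 `*` D2)); last by rewrite restrict_EFin.
  apply: (iffLR (integrable_mkcond (mu := (mu \x mu)%E) _ mD)).
  apply: (@integrable_bounded_on _ _ _ _ _ _ C) => //.
    by rewrite /= product_measure1E// lte_mul_pinfty// ge0_fin_numE.
  by move=> [x y] [/= X1 Y2]; exact: FC.
have mG : measurable_fun setT G by apply/measurable_EFinP; exact: (measurable_int _ iG).
have mF1 x : D1 x -> measurable_fun D2 (F x).
  move=> D1x; apply/(measurable_restrictT _ mD2).
  rewrite (_ : _ \_ _ = G \o pair x); first exact: measurableT_comp.
  apply/funext => y; rewrite /G /= !patchE; congr (if _ then _ else _).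
  by apply/idP/idP => /set_mem H; apply/mem_set; [split|case: H].
have mF2 y : D2 y -> measurable_fun D1 (F^~ y).
  move=> D2y; apply/(measurable_restrictT _ mD1).
  rewrite (_ : _ \_ _ = G \o (fun x => (x, y))); first exact: measurableT_comp.
  apply/funext => x; rewrite /G /= !patchE; congr (if _ then _ else _).
  by apply/idP/idP => /set_mem H; apply/mem_set; [split|case: H].
have E1 x : (\int[mu]_y (EFin \o G) (x, y) = (((fun x => \int[mu]_(y in D2) F x y) \_ D1) x)%:E)%E.
  rewrite patchE; case: ifPn => [/set_mem Dx|nDx]; last first.
    apply: integral0_eq => y _ /=; rewrite /G patchE memNset//= => -[/= /mem_set].
    by rewrite (negbTE nDx).
  rewrite /Rintegral fineK; last first.
    by apply: integrable_fin_num => //; apply: (@integrable_bounded_on _ _ _ _ _ _ C) => //; [exact: mF1|move=> y; exact: FC].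
  rewrite [RHS]integral_mkcond; apply: eq_integral => y _ /=; rewrite /G !patchE.
  by case: ifPn => [/set_mem[]/= _ /mem_set ->//|/negP H]; case: ifPn => // /set_mem Dy; case: H; exact/mem_set.
have E2 y : (\int[mu]_x (EFin \o G) (x, y) = (((fun y => \int[mu]_(x in D1) F x y) \_ D2) y)%:E)%E.
  rewrite patchE; case: ifPn => [/set_mem Dy|nDy]; last first.
    apply: integral0_eq => x _ /=; rewrite /G patchE memNset//= => -[_ /= /mem_set].
    by rewrite (negbTE nDy).
  rewrite /Rintegral fineK; last first.
    by apply: integrable_fin_num => //; apply: (@integrable_bounded_on _ _ _ _ _ _ C) => //; [exact: mF2|move=> x D1x; exact: FC].
  rewrite [RHS]integral_mkcond; apply: eq_integral => x _ /=; rewrite /G !patchE.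
  by case: ifPn => [/set_mem[]/= /mem_set -> _//|/negP H]; case: ifPn => // /set_mem Dx; case: H; exact/mem_set.
split.
  apply: (iffRL (integrable_mkcond (mu := mu) (EFin \o _) mD1)); rewrite restrict_EFin.
  apply: eq_integrable (integrable_fubini_F iG) => // x _; exact: E1.
rewrite Rintegral_mkcond [RHS]Rintegral_mkcond; congr fine.
transitivity (\int[mu]_x \int[mu]_y (EFin \o G) (x, y))%E.
  by apply: eq_integral => x _; rewrite E1.
by rewrite (Fubini iG); apply: eq_integral => y _; exact: E2.
Qed.

Lemma measurable_section_integral (J D : set R) (F : R -> R -> R) :
  measurable J -> measurable D -> measurable_fun (J `*` D) (fun xy => F xy.1 xy.2) ->
  (forall x y, J x -> D y -> 0 <= F x y) ->
  measurable_fun J (fun x => \int[mu]_(y in D) (F x y)%:E)%E.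
Proof.
move=> mJ mD mF F0; have mJD : measurable (J `*` D) by exact: measurableX.
pose G := (fun xy : R * R => (F xy.1 xy.2)%:E) \_ (J `*` D).
have mG : measurable_fun setT G.
  by apply/(measurable_restrictT _ mJD)/measurable_EFinP.
have G0 xy : (0 <= G xy)%E.
  by rewrite /G patchE; case: ifPn => // /set_mem [Jx Dy]; rewrite lee_fin F0.
have := measurable_fun_fubini_tonelli_F (m2 := mu) _ mG G0 => /(measurable_funTS (D := J)).
apply: eq_measurable_fun => x /set_mem Jx.
rewrite /fubini_F [RHS]integral_mkcond; apply: eq_integral => y _; rewrite /G !patchE.
by case: ifPn => [/set_mem[]/= _ /mem_set ->//|/negP H]; case: ifPn => // /set_mem Dy; case: H; exact/mem_set.
Qed.

End Rectangle.

(** * The heat equation *)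

Section HeatEquation.
Context {R : realType}.
Notation mu := (@lebesgue_measure R).
Notation p := (@bm_density R).
Implicit Types (t u z c h : R).

Lemma Rintegral_derive (F f : R -> R) (a b : R) : a < b ->
  (forall x, a <= x <= b -> is_derive x 1 F (f x)) ->
  (forall x, a <= x <= b -> {for x, continuous f}) ->
  \int[mu]_(x in `[a, b]) f x = F b - F a.
Proof.
move=> ab dF cf.
have cF x : a <= x <= b -> {for x, continuous F}.
  by move=> xab; apply: differentiable_continuous; apply/derivable1_diffP; have ? := dF x xab; exact: ex_derive.
rewrite /Rintegral (continuous_FTC2 (F := F) ab)//.
- by apply: continuous_in_subspaceT => x /set_mem /=; rewrite in_itv /=; exact: cf.
- split=> [x||].
  + rewrite in_itv /= => /andP[x1 x2]; have := dF x; rewrite !ltW// => /(_ isT) h; exact: ex_derive.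
  + by apply: cvg_at_right_filter; apply: cF; rewrite lexx ltW.
  + by apply: cvg_at_left_filter; apply: cF; rewrite lexx ltW.
- move=> x; rewrite in_itv /= => /andP[x1 x2]; rewrite derive1E; have := dF x; rewrite !ltW// => /(_ isT) h.
  exact: derive_val.
Qed.

Lemma is_derive_bm_density_space t (u : R) : 0 < t -> is_derive u 1 (p t 0) (- (u / t) * p t 0 u).
Proof.
move=> t0; rewrite /bm_density.
apply: is_derive_eq.
rewrite /GRing.scale /=; set s := (Num.sqrt _)^-1; set e := expR _.
by field; exact: lt0r_neq0.
Qed.

(** The time derivative of [p t 0 u], and half of its second derivative in [u]. *)
Definition time_derivative t (u : R) := p t 0 u * (u ^+ 2 / (2 * t ^+ 2) - (2 * t)^-1).

Lemma is_derive_bm_density_time t u : 0 < t -> is_derive t 1 (fun s => p s 0 u) (time_derivative t u).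
Proof.
move=> t0; rewrite /time_derivative /bm_density.
have c0 : 0 < 2 * pi * t :> R by rewrite !mulr_gt0// pi_gt0.
have t2 : 2 * t != 0 by rewrite mulf_neq0// lt0r_neq0.
have s0 : Num.sqrt (2 * pi * t) != 0 by rewrite sqrtr_eq0 -ltNge.
have dc : is_derive t (1:R) (fun s : R => 2 * pi * s) (2 * pi).
  by apply: is_derive_eq; rewrite /GRing.scale /= mulr1.
have ds : is_derive t (1:R) (fun s : R => Num.sqrt (2 * pi * s)) (2 * pi * (2 * Num.sqrt (2 * pi * t))^-1).
  by apply: (is_derive_eq (is_derive1_comp (is_derive1_sqrt c0) dc)); rewrite /GRing.scale /= mulrC.
have dq : is_derive t (1:R) (fun s : R => (Num.sqrt (2 * pi * s))^-1) (- (Num.sqrt (2 * pi * t)) ^- 2 *: (2 * pi * (2 * Num.sqrt (2 * pi * t))^-1)).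
  exact: is_deriveV.
apply: is_derive_eq.
rewrite /GRing.scale /=; set e := expR _.
have s2 : 2 * pi = Num.sqrt (2 * pi * t) ^+ 2 / t.
  by rewrite sqr_sqrtr ?ltW// mulfK// lt0r_neq0.
move: s0 s2; set s := Num.sqrt _ => s0 s2; rewrite s2.
by field; rewrite s0 lt0r_neq0.
Qed.

Lemma is_derive_continuous (f : R -> R) (x a : R) : is_derive x 1 f a -> {for x, continuous f}.
Proof. by move=> fa; apply: differentiable_continuous; apply/derivable1_diffP; exact: ex_derive. Qed.

Lemma continuous_bm_density t : 0 < t -> continuous (p t 0).
Proof. by move=> t0 u; exact: (is_derive_continuous (is_derive_bm_density_space u t0)). Qed.

Lemma continuous_time_derivative_space t : 0 < t -> continuous (time_derivative t).
Proof.
move=> t0 u; rewrite /time_derivative.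
apply: cvgM; first exact: continuous_bm_density.
apply: cvgB; last exact: cvg_cst.
apply: cvgM; last exact: cvg_cst.
by apply: cvgM; exact: cvg_id.
Qed.

Lemma continuous_time_derivative_time t u : 0 < t -> {for t, continuous (time_derivative^~ u)}.
Proof.
move=> t0; rewrite /time_derivative.
apply: cvgM; first exact: (is_derive_continuous (is_derive_bm_density_time u t0)).
apply: cvgB.
  apply: cvgM; first exact: cvg_cst.
  apply: cvgV; first by rewrite mulf_neq0// ?expf_neq0// lt0r_neq0.
  by apply: cvgM; [exact: cvg_cst|apply: cvgM; exact: cvg_id].
apply: cvgV; first by rewrite mulf_neq0// lt0r_neq0.
by apply: cvgM; [exact: cvg_cst|exact: cvg_id].
Qed.

Lemma measurable_time_derivative d (E : measurableType d) (D : set E) (t u : E -> R) :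
  measurable_fun D t -> measurable_fun D u -> measurable_fun D (fun e => time_derivative (t e) (u e)).
Proof.
move=> mt mu'; apply: measurable_funM; first exact: measurable_bm_density_joint.
apply: measurable_funB.
  apply: measurable_funM; first exact: measurable_funX.
  apply: (measurableT_comp measurable_inv); apply: measurable_funM => //.
  exact: measurable_funX.
by apply: (measurableT_comp measurable_inv); apply: measurable_funM.
Qed.

Lemma bm_density_le t x y : 0 < t -> p t x y <= (Num.sqrt (2 * pi * t))^-1.
Proof.
move=> t0; rewrite /bm_density -[leRHS]mulr1 ler_wpM2l ?invr_ge0 ?sqrtr_ge0//.
by rewrite mulNr expRN_le1// divr_ge0 ?sqr_ge0// mulr_ge0// ltW.
Qed.

End HeatEquation.

(** * Balance of the parabola mass *)

Section Balance.
Context {R : realType}.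
Notation mu := (@lebesgue_measure R).
Notation p := (@bm_density R).
Variable h : R.
Hypothesis h_gt0 : 0 < h.
Implicit Types (v : R -> R -> R) (t u z c : R).

Let I : set R := `[- h, h].

Definition parabola z := h ^+ 2 - z ^+ 2.

(** The parabola is the mean exit time of Brownian motion from [(- h, h)] started
    at [z]; its integral is the quantity whose decay measures the mass of [v]. *)
Definition parabola_mass v t := \int[mu]_(z in I) (parabola z * v t z).

(** The time derivative of [parabola_mass v] when [v] solves the heat equation:
    [parabola] has second derivative [- 2] and slopes [2 * h], [- 2 * h] at the
    two ends, where it vanishes. *)
Definition flux v t := h * (v t h + v t (- h)) - \int[mu]_(z in I) v t z.

(** Continuity and integrability are included so that the property passes to sums
    and differences. *)
Definition balanced v := [/\ forall t, 0 < t -> continuous (v t),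
  forall t1 t2, 0 < t1 -> t1 < t2 -> mu.-integrable `[t1, t2] (EFin \o flux v) &
  forall t1 t2, 0 < t1 -> t1 < t2 ->
    parabola_mass v t2 - parabola_mass v t1 = \int[mu]_(t in `[t1, t2]) flux v t].

Let mI : measurable I. Proof. exact: measurable_itv. Qed.

Let fI (a b : R) : (mu `[a, b]%classic < +oo)%E.
Proof. by rewrite lebesgue_measure_itv /=; case: ifP => _; rewrite ?ltry// -EFinD ltry. Qed.

Lemma parabola_continuous : continuous parabola.
Proof. by move=> z; apply: cvgB; [exact: cvg_cst|apply: cvgM; exact: cvg_id]. Qed.

Lemma parabola_range z : I z -> 0 <= parabola z <= h ^+ 2.
Proof.
have h0 := h_gt0.
rewrite /I /= in_itv /= => /andP[z1 z2]; rewrite /parabola; apply/andP; split; nra.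
Qed.

Lemma continuous_translate (g : R -> R) c : continuous g -> continuous (fun z => g (z + c)).
Proof.
move=> cg z; apply: (@continuous_comp _ _ _ (fun z : R => z + c) g); last exact: cg.
by apply: cvgD; [exact: cvg_id|exact: cvg_cst].
Qed.

Lemma continuous_integrable_itv (f : R -> R) (a b : R) : continuous f ->
  mu.-integrable `[a, b] (EFin \o f).
Proof.
move=> cf; apply: continuous_compact_integrable; first exact: segment_compact.
by apply: continuous_subspaceT.
Qed.

(** Green's identity: half of [parabola * v' - parabola' * v] is a primitive of
    [parabola * v'' / 2 + v]. *)
Lemma flux_bm_density t c : 0 < t ->
  \int[mu]_(z in I) (parabola z * time_derivative t (z + c)) = flux (fun s z => p s 0 (z + c)) t.
Proof.
move=> t0; have h0 := h_gt0.
have cp : continuous (fun z => p t 0 (z + c)).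
  by apply: continuous_translate; exact: continuous_bm_density.
have cd : continuous (fun z => parabola z * time_derivative t (z + c)).
  move=> z; apply: cvgM; first exact: parabola_continuous.
  exact: (continuous_translate (continuous_time_derivative_space t0)).
pose F z := 2^-1 * (parabola z * (- ((z + c) / t) * p t 0 (z + c)) + 2 * z * p t 0 (z + c)).
have dp z : is_derive z (1:R) (fun z => p t 0 (z + c)) (- ((z + c) / t) * p t 0 (z + c)).
  have da : is_derive z (1:R) (fun z => z + c) (1:R) by apply: is_derive_eq; rewrite addr0.
  have H := @is_derive1_comp _ (p t 0) (fun z : R => z + c) z _ _ (is_derive_bm_density_space (z + c) t0) da.
  by apply: (is_derive_eq H); rewrite mulr1.
have : \int[mu]_(z in I) (parabola z * time_derivative t (z + c) + p t 0 (z + c)) = F h - F (- h).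
  apply: Rintegral_derive; first lra.
    move=> z _; rewrite /F /parabola; apply: is_derive_eq.
    rewrite /GRing.scale /= /time_derivative; set e := p t 0 _.
    by field; exact: lt0r_neq0.
  by move=> z _; apply: cvgD; [exact: cd|exact: cp].
rewrite RintegralD//; [|exact: continuous_integrable_itv|exact: continuous_integrable_itv].
move=> E; rewrite /flux -[LHS](addrK (\int[mu]_(x in I) p t 0 (x + c))) E /F /parabola.
by congr (_ - _); field; exact: lt0r_neq0.
Qed.

(** [flux_bm_density] integrated in time, with the integrals exchanged. *)
Lemma balanced_bm_density c : balanced (fun t z => p t 0 (z + c)).
Proof.
have h0 := h_gt0.
have key t1 t2 : 0 < t1 -> t1 < t2 ->
    mu.-integrable `[t1, t2] (EFin \o flux (fun t z => p t 0 (z + c))) /\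
    parabola_mass (fun t z => p t 0 (z + c)) t2 - parabola_mass (fun t z => p t 0 (z + c)) t1 =
      \int[mu]_(t in `[t1, t2]) flux (fun t z => p t 0 (z + c)) t.
  move=> t10 t12.
  have t0 t : `[t1, t2]%classic t -> 0 < t by rewrite /= in_itv /= => /andP[? _]; exact: lt_le_trans t10 _.
  pose K := (Num.sqrt (2 * pi * t1))^-1.
  pose C := h ^+ 2 * (K * ((h + `|c|) ^+ 2 / (2 * t1 ^+ 2) + (2 * t1)^-1)).
  have [||iF EF] := @Fubini_rectangle R `[t1, t2] I
     (fun t z => parabola z * time_derivative t (z + c)) C (measurable_itv _) mI (fI _ _) (fI _ _).
    apply: measurable_funM.
      by apply: measurable_funTS; apply: measurable_funB => //; exact: measurable_funX.
    by apply: measurable_funTS; apply: measurable_time_derivative => //; exact: measurable_funD.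
    move=> t z Dt Iz; have tp := t0 t Dt.
    have t1t : t1 <= t by move: Dt; rewrite /= in_itv /= => /andP[].
    have /andP[f0 f1] := parabola_range Iz.
    rewrite normrM (ger0_norm f0) /C; apply: ler_pM => //.
    rewrite /time_derivative normrM ger0_norm ?bm_density_ge0//; apply: ler_pM => //.
    - exact: bm_density_ge0.
    - apply: le_trans (bm_density_le _ _ tp) _; rewrite /K lef_pV2 ?posrE ?sqrtr_gt0 ?mulr_gt0 ?pi_gt0//.
      by apply: ler_wsqrtr; rewrite ler_wpM2l// mulr_ge0// pi_ge0.
    - apply: le_trans (ler_normB _ _) _; apply: lerD; last first.
        have tt : 0 < 2 * t by rewrite mulr_gt0.
        by rewrite gtr0_norm ?invr_gt0// lef_pV2 ?posrE ?mulr_gt0// ler_pM2l.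
      have u0 : 0 <= (z + c) ^+ 2 by exact: sqr_ge0.
      have d0 : 0 < 2 * t ^+ 2 by rewrite mulr_gt0// exprn_gt0.
      have d1 : 0 < 2 * t1 ^+ 2 by rewrite mulr_gt0// exprn_gt0.
      rewrite ger0_norm; last by rewrite divr_ge0// ltW.
      apply: ler_pM => //; first by rewrite invr_ge0 ltW.
        rewrite -[leLHS]real_normK ?num_real// ler_pXn2r ?nnegrE//; last by rewrite addr_ge0// ltW.
        apply: le_trans (ler_normD _ _) _; rewrite lerD2r.
        by move: Iz; rewrite /I /= in_itv /= => /andP[? ?]; rewrite ler_norml; apply/andP; split; lra.
      by rewrite lef_pV2 ?posrE// ler_pM2l// ler_pXn2r// nnegrE ltW.
  split.
    apply: eq_integrable iF; first exact: measurable_itv.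
    by move=> t /set_mem Dt; rewrite /comp; congr EFin; apply: flux_bm_density; exact: t0.
  have <- : \int[mu]_(t in `[t1, t2]) \int[mu]_(z in I) (parabola z * time_derivative t (z + c)) =
      \int[mu]_(t in `[t1, t2]) flux (fun t3 z => p t3 0 (z + c)) t.
    by apply: eq_Rintegral => t /set_mem Dt; apply: flux_bm_density; exact: t0.
  rewrite EF /parabola_mass -RintegralB; [|exact: mI|..]; last 2 first.
  - apply: continuous_integrable_itv => z; apply: cvgM; first exact: parabola_continuous.
    by apply: (continuous_translate (continuous_bm_density _)); exact: lt_trans t12.
  - apply: continuous_integrable_itv => z; apply: cvgM; first exact: parabola_continuous.
    exact: (continuous_translate (continuous_bm_density _)).
  apply: eq_Rintegral => z _.
  symmetry; apply: (Rintegral_derive (F := fun t => parabola z * p t 0 (z + c))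
    (f := fun t => parabola z * time_derivative t (z + c)) t12).
    move=> t /andP[ht1 ht2]; have tp : 0 < t by exact: lt_le_trans ht1.
    have := is_derive_bm_density_time (z + c) tp => H.
    exact: is_derive_eq.
  move=> t /andP[ht1 ht2]; have tp : 0 < t by exact: lt_le_trans ht1.
  apply: cvgM; first exact: cvg_cst.
  exact: continuous_time_derivative_time.
split; last 2 first.
- by move=> t1 t2 t10 t12; have [] := key _ _ t10 t12.
- by move=> t1 t2 t10 t12; have [] := key _ _ t10 t12.
by move=> t t0; apply: (continuous_translate (continuous_bm_density _)).
Qed.

Lemma balancedB v1 v2 : balanced v1 -> balanced v2 -> balanced (fun t z => v1 t z - v2 t z).
Proof.
move=> [c1 i1 e1] [c2 i2 e2].
have E t : 0 < t -> flux (fun t z => v1 t z - v2 t z) t = flux v1 t - flux v2 t.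
  move=> t0; rewrite /flux RintegralB//; [ring|apply: continuous_integrable_itv; exact: c1|apply: continuous_integrable_itv; exact: c2].
have ci v t : 0 < t -> continuous (v t) -> mu.-integrable I (EFin \o (fun z => parabola z * v t z)).
  move=> t0 cv; apply: continuous_integrable_itv => z; apply: cvgM; first exact: parabola_continuous.
  exact: cv.
have M t : 0 < t -> parabola_mass (fun t z => v1 t z - v2 t z) t = parabola_mass v1 t - parabola_mass v2 t.
  move=> t0; rewrite /parabola_mass -RintegralB//; [|exact: ci (c1 _ t0)|exact: ci (c2 _ t0)].
  by apply: eq_Rintegral => z _; rewrite mulrBr.
have p0 t1 t t2 : 0 < t1 -> `[t1, t2]%classic t -> 0 < t.
  by move=> t10; rewrite /= in_itv /= => /andP[? _]; exact: lt_le_trans t10 _.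
split.
- by move=> t t0 z; apply: cvgB; [exact: c1|exact: c2].
- move=> t1 t2 t10 t12; have mt : measurable (`[t1, t2]%classic : set R) by exact: measurable_itv.
  have ib : mu.-integrable `[t1, t2] ((EFin \o flux v1) \- (EFin \o flux v2))%E.
    by apply: integrableB; [exact: mt|exact: i1|exact: i2].
  apply: eq_integrable ib; first exact: mt.
  move=> t /set_mem Dt; rewrite /comp E; last exact: p0 Dt.
  by rewrite EFinB.
- move=> t1 t2 t10 t12; rewrite !M//; last exact: lt_trans t12.
  have -> : \int[mu]_(t in `[t1, t2]) flux (fun t0 z => v1 t0 z - v2 t0 z) t =
      \int[mu]_(t in `[t1, t2]) (flux v1 t - flux v2 t).
    by apply: eq_Rintegral => t /set_mem Dt; apply: E; exact: p0 Dt.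
  rewrite RintegralB; [|exact: measurable_itv|exact: i1|exact: i2].
  by rewrite -e1// -e2//; ring.
Qed.

Lemma balanced0 : balanced (fun _ _ => 0).
Proof.
have E : flux (fun _ _ => 0) = cst 0.
  by apply/funext => t; rewrite /flux Rintegral_cst// mul0r addr0 mulr0 subr0.
split; first by move=> t _; exact: cst_continuous.
  by move=> t1 t2 _ _; rewrite E; apply: continuous_integrable_itv; exact: cst_continuous.
move=> t1 t2 _ _; rewrite E subrr; under eq_Rintegral do rewrite /=.
by rewrite Rintegral_cst// mul0r.
Qed.

Lemma balancedD v1 v2 : balanced v1 -> balanced v2 -> balanced (fun t z => v1 t z + v2 t z).
Proof.
move=> b1 b2; have := balancedB b1 (balancedB balanced0 b2).
rewrite (_ : (fun t z => _) = (fun t z => v1 t z + v2 t z))//.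
by apply/funext => t; apply/funext => z; rewrite sub0r opprK.
Qed.

Lemma balanced_bilateral N (v : int -> R -> R -> R) : (forall m, balanced (v m)) ->
  balanced (fun t z => bilateral_partial N (fun m => v m t z)).
Proof.
move=> bv; rewrite /bilateral_partial; elim: N => [|N IH].
  rewrite (_ : (fun t z => _) = (fun _ _ => 0)); first exact: balanced0.
  by apply/funext => t; apply/funext => z; rewrite big_ord0.
have := balancedD IH (balancedD (bv N%:Z) (bv (- N.+1%:Z))).
rewrite (_ : (fun t z => _) = (fun t z => \sum_(n < N.+1) (v n%:Z t z + v (- n.+1%:Z) t z)))//.
by apply/funext => t; apply/funext => z; rewrite big_ord_recr.
Qed.

Lemma balanced_Delta_partial N : balanced (fun t z => Delta_partial N z h t).
Proof.
pose v1 (m : int) t z := p t 0 (z + 4 * m%:~R * h).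
pose v2 (m : int) t z := p t 0 (z + 2 * h * (2 * m%:~R + 1)).
have bv m : balanced (fun t z => v1 m t z - v2 m t z).
  exact: (@balancedB (v1 m) (v2 m) (balanced_bm_density _) (balanced_bm_density _)).
exact: (@balanced_bilateral N _ bv).
Qed.

(** The images of [h] and of [- h] are the same points, with opposite signs up to
    a shift of the index. *)
Lemma Delta_partial_edges N t :
  Delta_partial N h h t + Delta_partial N (- h) h t =
  p t 0 (4 * N%:R * h + h) - p t 0 (4 * N%:R * h - h).
Proof.
pose phi (m : int) := p t 0 (4 * m%:~R * h - h).
have E : bilateral_partial N (fun m => phi (m + 1)) = bilateral_partial N (fun m => phi m - (p t 0 (h + 4 * m%:~R * h)
   - p t 0 (h + 2 * h * (2 * m%:~R + 1)) + (p t 0 (- h + 4 * m%:~R * h) - p t 0 (- h + 2 * h * (2 * m%:~R + 1))))).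
  apply: eq_bilateral_partial => m; rewrite /phi intrD.
  set A := p _ _ _; set B := p _ _ _; set C := p _ _ _; set D := p _ _ _; set G := p _ _ _; set H := p _ _ _.
  have -> : C = H by congr (p _ _ _); ring.
  have -> : G = B by congr (p _ _ _); ring.
  have -> : A = D by congr (p _ _ _); ring.
  by ring.
have := bilateral_partial_shift N phi; rewrite E bilateral_partialB.
rewrite (_ : bilateral_partial N (fun m => _ + _) = Delta_partial N h h t + Delta_partial N (- h) h t); last first.
  by rewrite /Delta_partial /bilateral_partial -big_split /=; apply: eq_bigr => i _; ring.
have -> : phi N%:Z = p t 0 (4 * N%:R * h - h) by [].
have -> : phi (- N%:Z) = p t 0 (4 * N%:R * h + h).
  by apply: bm_density_diff; rewrite intrN; ring.
by lra.
Qed.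

Lemma Delta_partial_edges_cvg0 t : 0 < t ->
  (fun N => Delta_partial N h h t + Delta_partial N (- h) h t) @ \oo --> 0.
Proof.
move=> t0; have h0 := h_gt0; have q1 := image_ratio_lt1 h_gt0 t0; have q0 := image_ratio_ge0 h t.
have b (N : nat) (a : R) : N%:R * h <= a -> p t 0 a <= (Num.sqrt (2 * pi * t))^-1 * image_ratio h t ^+ N.
  by move=> Na; apply: bm_density_geometric => //; apply: le_trans (ler_norm _).
have cv : (fun N => (Num.sqrt (2 * pi * t))^-1 * image_ratio h t ^+ N) @ \oo --> 0.
  rewrite -[X in _ --> X](mulr0 (Num.sqrt (2 * pi * t))^-1); apply: cvgM; first exact: cvg_cst.
  by apply: cvg_expr; rewrite ger0_norm.
apply/cvgr0Pnorm_lt => e e0; near=> N.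
have Nlt : (Num.sqrt (2 * pi * t))^-1 * image_ratio h t ^+ N < e.
  by near: N; exact: (cvgr_lt _ cv _ e0).
have N0 : 1 <= N%:R :> R by near: N; exact: nbhs_infty_ger.
rewrite Delta_partial_edges.
have nh : 0 <= N%:R * h by rewrite mulr_ge0// ltW.
have hN : h <= N%:R * h by rewrite ler_peMl// ltW.
have := b N (4 * N%:R * h + h) ltac:(lra); have := b N (4 * N%:R * h - h) ltac:(lra).
have := bm_density_ge0 t 0 (4 * N%:R * h + h); have := bm_density_ge0 t 0 (4 * N%:R * h - h).
by move=> *; rewrite ltr_norml; apply/andP; split; lra.
Unshelve. all: by end_near. Qed.

Definition Delta_mass t := \int[mu]_(z in I) Delta z h t.

Definition Delta_parabola_mass t := \int[mu]_(z in I) (parabola z * Delta z h t).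

Let I_le z : I z -> `|z| <= h.
Proof. by rewrite /I /= in_itv /= ler_norml. Qed.

Lemma flux_cvg t : 0 < t -> (fun N => flux (fun t z => Delta_partial N z h t) t) @ \oo --> - Delta_mass t.
Proof.
move=> t0; rewrite /flux -[- Delta_mass t]add0r -[X in X + _](mulr0 h).
apply: cvgB; first by apply: cvgM; [exact: cvg_cst|exact: Delta_partial_edges_cvg0].
apply: (Rintegral_bounded_cvg (C := Delta_bound h t)) => //.
- exact: fI.
- by move=> N; apply: measurable_Delta_partial.
- by move=> N z /I_le zh; exact: Delta_partial_bound.
- by move=> z /I_le zh; exact: Delta_partial_cvg.
Qed.

Lemma parabola_mass_cvg t : 0 < t ->
  (fun N => parabola_mass (fun t z => Delta_partial N z h t) t) @ \oo --> Delta_parabola_mass t.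
Proof.
move=> t0; apply: (Rintegral_bounded_cvg (C := h ^+ 2 * Delta_bound h t)) => //.
- exact: fI.
- move=> N; apply: measurable_funM; last exact: measurable_Delta_partial.
  by apply: measurable_funTS; apply: continuous_measurable_fun; exact: parabola_continuous.
- move=> N z Iz; have /andP[f0 f1] := parabola_range Iz.
  by rewrite normrM (ger0_norm f0); apply: ler_pM => //; apply: Delta_partial_bound => //; exact: I_le.
- by move=> z /I_le zh; apply: cvgM; [exact: cvg_cst|exact: Delta_partial_cvg].
Qed.

Lemma Delta_bound_le t1 t2 t : 0 < t1 -> t1 <= t -> t <= t2 ->
  Delta_bound h t <= 2 * (Num.sqrt (2 * pi * t1))^-1 / (1 - image_ratio h t2).
Proof.
move=> t10 t1t tt2; have tp : 0 < t by exact: lt_le_trans t1t.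
have t2p : 0 < t2 by exact: lt_le_trans tt2.
have pi0 : 0 < 2 * pi :> R by rewrite mulr_gt0// pi_gt0.
rewrite /Delta_bound -[leLHS]mulrA -[leRHS]mulrA ler_pM2l//; apply: ler_pM; rewrite ?invr_ge0 ?sqrtr_ge0//.
- by rewrite subr_ge0 ltW// image_ratio_lt1.
- by rewrite lef_pV2 ?posrE ?sqrtr_gt0 ?mulr_gt0 ?pi_gt0//; apply: ler_wsqrtr; rewrite ler_pM2l// mulr_gt0.
- rewrite lef_pV2 ?posrE ?subr_gt0 ?image_ratio_lt1// lerD2l lerN2 /image_ratio ler_expR lerN2.
  rewrite ler_pM2l ?exprn_gt0// lef_pV2 ?posrE ?mulr_gt0// ler_pM2l//.
Qed.

Lemma mu_I : fine (mu I) = 2 * h.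
Proof.
have h0 := h_gt0.
rewrite /I lebesgue_measure_itv /= lte_fin ifT; last lra.
by rewrite /=; ring.
Qed.

Lemma Rintegral_I_le (f : R -> R) (C : R) : measurable_fun I f -> (forall z, I z -> `|f z| <= C) ->
  `|\int[mu]_(z in I) f z| <= C * (2 * h).
Proof.
move=> mf fC; have if_ : mu.-integrable I (EFin \o f).
  by apply: (@integrable_bounded_on _ _ _ _ _ _ C) => //; exact: fI.
apply: le_trans (le_normr_Rintegral _ _) _ => //.
rewrite -mu_I -Rintegral_cst//; apply: le_Rintegral => //.
- exact: integrable_norm.
- by apply: (@integrable_bounded_on _ _ _ _ _ _ `|C|) => //; exact: fI.
Qed.

Lemma Delta_massE t : 0 < t ->
  (\int[mu]_(z in `](- h)%R, h[) (Delta z h t)%:E = (Delta_mass t)%:E)%E.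
Proof.
move=> t0; have mD : measurable_fun I (fun z => Delta z h t).
  by apply: measurable_Delta => // z /I_le.
rewrite -(integral_itv_bndoo true false); last first.
  apply/measurable_EFinP; apply: measurable_funS mD => //.
  by apply: subset_itv; rewrite bnd_simp.
rewrite /Delta_mass /Rintegral fineK//; apply: integrable_fin_num => //.
apply: (@integrable_bounded_on _ _ _ _ _ _ (Delta_bound h t)) => //; first exact: fI.
by move=> z /I_le zh; exact: Delta_bounded.
Qed.

Lemma measurable_Delta_mass (J : set R) : measurable J -> (forall t, J t -> 0 < t) ->
  measurable_fun J Delta_mass.
Proof.
move=> mJ J0; have mo : measurable (`]- h, h[%classic : set R) by exact: measurable_itv.
apply/measurable_EFinP.
apply: (eq_measurable_fun (fun t => \int[mu]_(z in `](- h)%R, h[) (Delta z h t)%:E)%E).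
  by move=> t /set_mem Jt; rewrite /= Delta_massE//; exact: J0.
apply: (@measurable_section_integral R J `]- h, h[ (fun t z => Delta z h t)) => //.
- apply: measurable_Delta => //; try exact: measurable_funTS.
  by move=> [t z] [/= /J0 t0]; rewrite in_itv /= => /andP[? ?]; rewrite ler_norml !ltW.
- move=> t z /J0 t0; rewrite /= in_itv /= => /andP[? ?]; apply/ltW/Delta_gt0 => //.
  by rewrite ltr_norml; apply/andP.
Qed.

Lemma Delta_mass_ge0 t : 0 < t -> 0 <= Delta_mass t.
Proof.
move=> t0; rewrite -lee_fin -Delta_massE//; apply: integral_ge0 => z.
rewrite /= in_itv /= => /andP[? ?]; rewrite lee_fin; apply/ltW/Delta_gt0 => //.
by rewrite ltr_norml; apply/andP.
Qed.

Lemma integrable_Delta_mass t1 t2 : 0 < t1 -> t1 < t2 -> mu.-integrable `[t1, t2] (EFin \o Delta_mass).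
Proof.
move=> t10 t12; pose C := 2 * (Num.sqrt (2 * pi * t1))^-1 / (1 - image_ratio h t2).
apply: (@integrable_bounded_on _ _ _ _ _ _ (C * (2 * h))) => //; first exact: fI.
  by apply: measurable_Delta_mass => // t; rewrite /= in_itv /= => /andP[? _]; exact: lt_le_trans t10 _.
move=> t; rewrite /= in_itv /= => /andP[t1t tt2]; have t0 := lt_le_trans t10 t1t.
apply: Rintegral_I_le.
  by apply: measurable_Delta => // z /I_le.
by move=> z /I_le zh; apply: le_trans (Delta_bound_le t10 t1t tt2); exact: Delta_bounded.
Qed.

(** The boundary terms of the partial sums vanish in the limit, which leaves
    the mass as the only loss. *)
Lemma Delta_parabola_mass_balance t1 t2 : 0 < t1 -> t1 < t2 ->
  Delta_parabola_mass t1 - Delta_parabola_mass t2 = \int[mu]_(t in `[t1, t2]) Delta_mass t.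
Proof.
move=> t10 t12; have t20 : 0 < t2 by exact: lt_trans t12.
have h0 := h_gt0.
pose C := 2 * (Num.sqrt (2 * pi * t1))^-1 / (1 - image_ratio h t2).
have cvR : (fun N => \int[mu]_(t in `[t1, t2]) flux (fun t z => Delta_partial N z h t) t) @ \oo -->
    \int[mu]_(t in `[t1, t2]) (- Delta_mass t).
  apply: (Rintegral_bounded_cvg (C := C * (4 * h))) => //.
  - exact: fI.
  - by move=> N; apply/measurable_EFinP; have [_ + _] := balanced_Delta_partial N; move=> /(_ _ _ t10 t12) /measurable_int.
  - move=> N t; rewrite /= in_itv /= => /andP[t1t tt2]; have tp : 0 < t by exact: lt_le_trans t1t.
    have DC z : `|z| <= h -> `|Delta_partial N z h t| <= C.
      by move=> zh; apply: le_trans (Delta_bound_le t10 t1t tt2); exact: Delta_partial_bound.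
    have D1 := DC h ltac:(by rewrite ger0_norm// ltW).
    have D2 := DC (- h) ltac:(by rewrite normrN ger0_norm// ltW).
    have D3 := @Rintegral_I_le (fun z => Delta_partial N z h t) C (measurable_Delta_partial _ _ _ _) (fun z Iz => DC z (I_le Iz)).
    rewrite /flux; apply: le_trans (ler_normB _ _) _; rewrite normrM (gtr0_norm h0).
    rewrite (_ : C * (4 * h) = h * (C + C) + C * (2 * h)); last by ring.
    apply: lerD; last exact: D3.
    by rewrite ler_pM2l//; apply: le_trans (ler_normD _ _) _; exact: lerD.
  - by move=> t; rewrite /= in_itv /= => /andP[t1t _]; apply: flux_cvg; exact: lt_le_trans t1t.
have cvL : (fun N => parabola_mass (fun t z => Delta_partial N z h t) t2 -
      parabola_mass (fun t z => Delta_partial N z h t) t1) @ \oo --> Delta_parabola_mass t2 - Delta_parabola_mass t1.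
  by apply: cvgB; exact: parabola_mass_cvg.
have E : Delta_parabola_mass t2 - Delta_parabola_mass t1 = \int[mu]_(t in `[t1, t2]) (- Delta_mass t).
  rewrite -(cvg_lim _ cvL)// -(cvg_lim _ cvR)//; congr (limn _); apply/funext => N.
  by have [_ _ ->] := balanced_Delta_partial N.
rewrite -[LHS]opprB E -[RHS]opprK; congr (- _).
rewrite -[RHS]sub0r -[X in _ = X - _](mul0r (fine (mu `[t1, t2]))) -Rintegral_cst// -RintegralB//.
- by apply: eq_Rintegral => t _ /=; rewrite sub0r.
- by apply: continuous_integrable_itv; exact: cst_continuous.
- exact: integrable_Delta_mass.
Qed.

(** Every image other than [z] itself is at distance at least [h]. *)
Lemma Delta_near_gaussian z t : 0 < t -> `|z| <= h ->
  `|Delta z h t - p t 0 z| <=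
  5 * (Num.sqrt (2 * pi * t))^-1 * image_ratio h t / (1 - image_ratio h t).
Proof.
move=> t0 zh; have h0 := h_gt0.
have q1 := image_ratio_lt1 h0 t0; have q0 := image_ratio_ge0 h t.
pose K := (Num.sqrt (2 * pi * t))^-1.
have K0 : 0 <= K by rewrite invr_ge0 sqrtr_ge0.
pose r := image_ratio h t.
have cv : (fun N => `|Delta_partial N.+1 z h t - p t 0 z|) @ \oo --> `|Delta z h t - p t 0 z|.
  apply: cvg_norm; apply: cvgB; last exact: cvg_cst.
  by rewrite (cvg_shiftS (fun N => Delta_partial N z h t)); exact: Delta_partial_cvg.
apply: (cvgr_to_le cv); near=> N.
have /andP[z1 z2] : - h <= z <= h by rewrite -ler_norml.
have one a : h <= `|a| -> p t 0 a <= K * r.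
  move=> ha; have := @bm_density_geometric _ h t a 1 h0 t0.
  by rewrite expr1; apply; rewrite mul1r.
have head : `|(p t 0 (z + 4 * 0%:Z%:~R * h) - p t 0 (z + 2 * h * (2 * 0%:Z%:~R + 1)))
   + (p t 0 (z + 4 * (- 1%:Z)%:~R * h) - p t 0 (z + 2 * h * (2 * (- 1%:Z)%:~R + 1))) - p t 0 z| <= 3 * (K * r).
  rewrite !mulr0 mul0r !addr0 !add0r.
  have A1 := one (z + 2 * h * 1) ltac:(by rewrite ger0_norm; lra).
  have A2 := one (z + 4 * (- 1%:Z)%:~R * h) ltac:(by rewrite ler0_norm; rewrite (_ : (- 1%:Z)%:~R = -1)//; lra).
  have A3 := one (z + 2 * h * (2 * (- 1%:Z)%:~R + 1)) ltac:(by rewrite ler0_norm; rewrite (_ : (- 1%:Z)%:~R = -1)//; lra).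
  move: A1 A2 A3 (bm_density_ge0 t 0 (z + 2 * h * 1)) (bm_density_ge0 t 0 (z + 4 * (- 1%:Z)%:~R * h))
   (bm_density_ge0 t 0 (z + 2 * h * (2 * (- 1%:Z)%:~R + 1))) => *.
  by rewrite ler_norml; apply/andP; split; lra.
have tail : `|\sum_(n < N) (let m := n.+1%:Z in
     (p t 0 (z + 4 * m%:~R * h) - p t 0 (z + 2 * h * (2 * m%:~R + 1))) +
     (let m := - n.+2%:Z in p t 0 (z + 4 * m%:~R * h) - p t 0 (z + 2 * h * (2 * m%:~R + 1))))| <= 2 * K * r / (1 - r).
  apply: le_trans (ler_norm_sum _ _ _) _.
  apply: (@le_trans _ _ (\sum_(n < N) (2 * K * r) * r ^+ n)).
    apply: ler_sum => n _ /=; apply: le_trans (ler_normD _ _) _.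
    rewrite [leRHS](_ : _ = K * r ^+ n.+1 + K * r ^+ n.+1); last by rewrite exprS; ring.
    apply: lerD; first by apply: Delta_term_bound => //; left.
    by apply: Delta_term_bound => //; right.
  apply: (@le_trans _ _ (series (geometric (2 * K * r) r) N)); first by rewrite /series /= big_mkord.
  by apply: geometric_le_lim; rewrite ?mulr_ge0 ?expR_gt0// ger0_norm.
rewrite /Delta_partial /bilateral_partial big_ord_recl addrAC; apply: le_trans (ler_normD _ _) _.
have K3 : 3 * (K * r) <= 3 * K * r / (1 - r).
  rewrite mulrA ler_pdivlMr ?subr_gt0// ler_piMr//; last by rewrite /r; lra.
  by do 2?[apply: mulr_ge0 => //].
rewrite (_ : 5 * _ * _ / _ = 3 * K * r / (1 - r) + 2 * K * r / (1 - r)); last by rewrite -/K -/r; ring.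
by apply: lerD; [exact: le_trans K3|].
Unshelve. all: by end_near. Qed.

End Balance.

(** * The total survival mass *)

Section InitialMass.
Context {R : realType}.
Notation mu := (@lebesgue_measure R).
Notation p := (@bm_density R).
Variable h : R.
Hypothesis h_gt0 : 0 < h.
Implicit Types (t u z c e : R).

Let I : set R := `[- h, h].

Let mI : measurable I. Proof. exact: measurable_itv. Qed.

Let fI (a b : R) : (mu `[a, b]%classic < +oo)%E.
Proof. by rewrite lebesgue_measure_itv /=; case: ifP => _; rewrite ?ltry// -EFinD ltry. Qed.

Let I_le z : I z -> `|z| <= h.
Proof. by rewrite /I /= in_itv /= ler_norml. Qed.

Let f z := if `|z| <= h then parabola h z else 0.

Let f_bounded : bounded_measurable (h ^+ 2) f.
Proof.
split.
  apply: measurable_fun_ifT => //.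
    by apply: measurable_fun_ler => //; exact: measurableT_comp.
  by apply: continuous_measurable_fun; exact: parabola_continuous.
move=> z; rewrite /f; case: ifP => [|_]; last by rewrite normr0 sqr_ge0.
rewrite ler_norml => zI; have /andP[f0 f1] := @parabola_range _ h h_gt0 z zI.
by rewrite ger0_norm.
Qed.

(** The difference between [h ^+ 2] and the parabola is at most [e ^+ 2] for
    [|z| < e], and at most [h ^+ 2] where the Gaussian has little mass. *)
Lemma gaussian_parabola e t : 0 < t -> 0 <= e -> e <= h ->
  h ^+ 2 - e ^+ 2 - h ^+ 2 * Num.sqrt 2 * expR (- e ^+ 2 / (4 * t)) <=
    \int[mu]_(z in I) (parabola h z * p t 0 z) <= h ^+ 2.
Proof.
move=> t0 e0 eh.
have -> : \int[mu]_(z in I) (parabola h z * p t 0 z) = heat t f 0.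
  rewrite Rintegral_mkcond; apply: eq_Rintegral => z _; rewrite patchE /f.
  rewrite (_ : (z \in I) = (`|z| <= h)); first by case: ifP; rewrite ?mulr0// mulrC.
  by rewrite ler_norml; apply/idP/idP => [/set_mem|H]//; exact/mem_set.
have f0 z : 0 <= f z <= h ^+ 2.
  rewrite /f; case: ifP => [|_]; last by rewrite lexx sqr_ge0.
  by rewrite ler_norml => zI; have := @parabola_range _ h h_gt0 z zI.
have bc c : bounded_measurable `|c| (cst c : R -> R) by exact: bounded_measurable_cst.
apply/andP; split; last first.
  rewrite -[leRHS](heat_cst _ 0 t0); apply: (le_heat 0 t0 f_bounded (bc _)) => z /=.
  by have /andP[] := f0 z.
pose g z := if e <= `|z| then h ^+ 2 else 0.
have bg : bounded_measurable (h ^+ 2) g.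
  split.
    apply: measurable_fun_ifT => //.
    by apply: measurable_fun_ler => //; exact: measurableT_comp.
  by move=> z; rewrite /g; case: ifP => _; rewrite ?normr0 ?ger0_norm ?sqr_ge0.
have far : `|heat t g 0| <= h ^+ 2 * Num.sqrt 2 * expR (- e ^+ 2 / (4 * t)).
  by apply: heat_far => // z; rewrite sub0r normrN /g => ze; rewrite leNgt ze.
have bc' : bounded_measurable (`|h ^+ 2 - e ^+ 2| + h ^+ 2) (cst (h ^+ 2 - e ^+ 2) \- g).
  split; first by apply: measurable_funB => //; exact: bg.1.
  by move=> z /=; apply: le_trans (ler_normB _ _) _; rewrite lerD2l; exact: bg.2.
have le1 : heat t (cst (h ^+ 2 - e ^+ 2) \- g) 0 <= heat t f 0.
  apply: (le_heat 0 t0 bc' f_bounded) => z /=; have /andP[fz0 _] := f0 z.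
  rewrite /g; case: (leP e `|z|) => ez.
    by apply: le_trans fz0; rewrite addrAC subrr add0r oppr_le0 sqr_ge0.
  rewrite subr0 /f (le_trans (ltW ez) eh) /parabola lerD2l lerN2.
  by rewrite -[leLHS]real_normK ?num_real// ler_pXn2r ?nnegrE// ltW.
rewrite (heatB 0 t0 (bc _) bg) heat_cst// in le1.
by apply: le_trans le1; rewrite lerD2l lerN2; exact: le_trans (ler_norm _) far.
Qed.

Lemma le_sqrtr (x y : R) : 0 <= x -> x ^+ 2 <= y -> x <= Num.sqrt y.
Proof. by move=> x0 xy; rewrite -(ger0_norm x0) -sqrtr_sqr; exact: ler_wsqrtr. Qed.

Lemma sqrtr_le (x y : R) : 0 <= y -> x <= y ^+ 2 -> Num.sqrt x <= y.
Proof. by move=> y0 xy; rewrite -(ger0_norm y0) -sqrtr_sqr; exact: ler_wsqrtr. Qed.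

Lemma expRN_le_inv (a : R) : 0 < a -> expR (- a) <= a^-1.
Proof.
move=> a0; rewrite expRN lef_pV2 ?posrE ?expR_gt0//.
by apply: le_trans (expR_ge1Dx a); rewrite lerDr.
Qed.

(** For short times [Delta] is close to a Dirac mass at [0], where the parabola is
    [h ^+ 2]. The constant is not sharp. *)
Lemma Delta_parabola_mass_near s : 0 < s -> 2 * s <= h ->
  `|Delta_parabola_mass h (s ^+ 2) - h ^+ 2| <= 60 * h * s.
Proof.
move=> s0 sh; have h0 := h_gt0; have t0 : 0 < s ^+ 2 by rewrite exprn_gt0.
pose r := image_ratio h (s ^+ 2).
have r_le : r <= 2 * s ^+ 2 / h ^+ 2.
  rewrite /r /image_ratio; apply: le_trans (expRN_le_inv _) _; first by rewrite divr_gt0 ?mulr_gt0// exprn_gt0.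
  by rewrite invf_div.
have r_half : r <= 2^-1.
  apply: le_trans r_le _; rewrite ler_pdivrMr ?exprn_gt0//; nra.
have r0 : 0 <= r by exact: image_ratio_ge0.
pose K := (Num.sqrt (2 * pi * s ^+ 2))^-1.
have K0 : 0 <= K by rewrite invr_ge0 sqrtr_ge0.
have K_le : K <= s^-1.
  rewrite /K lef_pV2 ?posrE ?sqrtr_gt0 ?mulr_gt0 ?pi_gt0//.
  apply: le_sqrtr; first exact: ltW.
  by rewrite ler_peMl ?sqr_ge0//; have := pi_ge2 R; lra.
pose E := 5 * K * r / (1 - r).
have E_le : E <= 20 * s / h ^+ 2.
  apply: (@le_trans _ _ (5 * s^-1 * (2 * s ^+ 2 / h ^+ 2) * 2)); last first.
    by apply: eq_lexx; field; rewrite !lt0r_neq0.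
  apply: ler_pM; rewrite ?invr_ge0 ?subr_ge0//; [|lra| |].
  - by rewrite !mulr_ge0.
  - apply: ler_pM => //; first by rewrite mulr_ge0.
    by rewrite ler_pM2l.
  - by rewrite -[leRHS]invrK lef_pV2 ?posrE; lra.
have mW : measurable_fun I (fun z => parabola h z * Delta z h (s ^+ 2)).
  apply: measurable_funM; last by apply: measurable_Delta => // z /I_le.
  by apply: measurable_funTS; apply: continuous_measurable_fun; exact: parabola_continuous.
have cG : continuous (fun z => parabola h z * p (s ^+ 2) 0 z).
  by move=> z; apply: cvgM; [exact: parabola_continuous|exact: continuous_bm_density].
pose G := \int[mu]_(z in I) (parabola h z * p (s ^+ 2) 0 z).
have WG : `|Delta_parabola_mass h (s ^+ 2) - G| <= h ^+ 2 * E * (2 * h).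
  rewrite /G /Delta_parabola_mass -RintegralB//; last 2 first.
  - apply: (@integrable_bounded_on _ _ _ _ _ _ (h ^+ 2 * Delta_bound h (s ^+ 2))) => //; first exact: fI.
    move=> z Iz; have /andP[f0 f1] := @parabola_range _ h h_gt0 z Iz.
    by rewrite normrM (ger0_norm f0); apply: ler_pM => //; apply: Delta_bounded => //; exact: I_le.
  - exact: continuous_integrable_itv.
  apply: (@Rintegral_I_le R h h_gt0).
    by apply: measurable_funB => //; apply: measurable_funTS; exact: continuous_measurable_fun.
  move=> z Iz; have /andP[f0 f1] := @parabola_range _ h h_gt0 z Iz.
  rewrite -mulrBr normrM (ger0_norm f0); apply: ler_pM => //.
  by apply: Delta_near_gaussian => //; exact: I_le.
have hs0 : 0 <= h * s by rewrite mulr_ge0// ltW.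
have := @gaussian_parabola (Num.sqrt (h * s)) (s ^+ 2) t0 (sqrtr_ge0 _).
rewrite sqr_sqrtr// -/G => /(_ _)/andP[|G1 G2].
  apply: sqrtr_le; first exact: ltW.
  by rewrite expr2 ler_pM2l//; lra.
have x_le : expR (- (h * s) / (4 * s ^+ 2)) <= 4 * s / h.
  rewrite mulNr; apply: le_trans (expRN_le_inv _) _; first by rewrite divr_gt0 ?mulr_gt0.
  by apply: eq_lexx; field; rewrite !lt0r_neq0.
have s2 : Num.sqrt 2 <= 2 :> R.
  by apply: sqrtr_le => //; lra.
have T_le : h ^+ 2 * Num.sqrt 2 * expR (- (h * s) / (4 * s ^+ 2)) <= 8 * (h * s).
  apply: (@le_trans _ _ (h ^+ 2 * 2 * (4 * s / h))); last first.
    by apply: eq_lexx; field; rewrite !lt0r_neq0.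
  apply: ler_pM => //; first by rewrite mulr_ge0 ?sqrtr_ge0 ?sqr_ge0.
  by rewrite ler_pM2l ?exprn_gt0.
have W_le : h ^+ 2 * E * (2 * h) <= 40 * (h * s).
  apply: (@le_trans _ _ (h ^+ 2 * (20 * s / h ^+ 2) * (2 * h))); last first.
    by apply: eq_lexx; field; rewrite !lt0r_neq0.
  by rewrite ler_pM2r ?mulr_gt0// ler_pM2l ?exprn_gt0.
move: WG; rewrite ler_norml => /andP[W1 W2].
by rewrite ler_norml; apply/andP; split; lra.
Qed.

Notation W := (Delta_parabola_mass h).
Notation M := (Delta_mass h).

Let openI : set R := `]- h, h[.

Lemma Delta_parabola_ge0 t z : 0 < t -> I z -> 0 <= parabola h z * Delta z h t.
Proof.
move=> t0 Iz; have /andP[f0 _] := @parabola_range _ h h_gt0 z Iz.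
have := I_le Iz; rewrite le_eqVlt => /orP[/eqP zh|zh].
  by rewrite /parabola -(real_normK (num_real z)) zh subrr mul0r.
by rewrite mulr_ge0// ltW// Delta_gt0.
Qed.

Lemma Delta_parabola_mass_ge0 t : 0 < t -> 0 <= W t.
Proof. by move=> t0; apply: Rintegral_ge0 => z; exact: Delta_parabola_ge0. Qed.

Let mW t : 0 < t -> measurable_fun I (fun z => parabola h z * Delta z h t).
Proof.
move=> t0; apply: measurable_funM; last by apply: measurable_Delta => // z /I_le.
by apply: measurable_funTS; apply: continuous_measurable_fun; exact: parabola_continuous.
Qed.

Lemma Delta_parabola_mass_le t : 0 < t -> W t <= h ^+ 2 * M t.
Proof.
move=> t0; have h0 := h_gt0; have sub : openI `<=` I by apply: subset_itv; rewrite bnd_simp.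
have mop : measurable openI by exact: measurable_itv.
have openP z : openI z -> `|z| < h by rewrite /openI /= in_itv /= ltr_norml.
have mo := measurable_funS mI sub (mW t0).
have <- : fine (\int[mu]_(z in openI) (parabola h z * Delta z h t)%:E)%E = W t.
  by rewrite -(integral_itv_bndoo true false)//; exact/measurable_EFinP.
have -> : h ^+ 2 * M t = fine (\int[mu]_(z in openI) (h ^+ 2 * Delta z h t)%:E)%E.
  under eq_integral do rewrite EFinM.
  rewrite ge0_integralZl_EFin ?sqr_ge0//.
  - by rewrite Delta_massE.
  - by move=> z /openP zh; rewrite lee_fin ltW// Delta_gt0.
  - by apply/measurable_EFinP; apply: measurable_Delta => // z /openP /ltW.
have fin1 : (\int[mu]_(z in openI) (h ^+ 2 * Delta z h t)%:E < +oo)%E.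
  under eq_integral do rewrite EFinM.
  rewrite ge0_integralZl_EFin ?sqr_ge0//.
  - by rewrite Delta_massE// -EFinM ltry.
  - by move=> z /openP zh; rewrite lee_fin ltW// Delta_gt0.
  - by apply/measurable_EFinP; apply: measurable_Delta => // z /openP /ltW.
have le1 : (\int[mu]_(z in openI) (parabola h z * Delta z h t)%:E <=
            \int[mu]_(z in openI) (h ^+ 2 * Delta z h t)%:E)%E.
  apply: ge0_le_integral => //.
  - by move=> z /sub Iz; rewrite lee_fin Delta_parabola_ge0.
  - exact/measurable_EFinP.
  - apply/measurable_EFinP; apply: measurable_funM => //.
    by apply: measurable_Delta => // z /openP /ltW.
  - move=> z /[dup] /openP zh /sub Iz; rewrite lee_fin; apply: ler_wpM2r.
      by rewrite ltW// Delta_gt0.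
    by have /andP[] := @parabola_range _ h h_gt0 z Iz.
apply: fine_le => //; rewrite ge0_fin_numE//; last 2 first.
- by apply: integral_ge0 => z /sub Iz; rewrite lee_fin Delta_parabola_ge0.
- by apply: integral_ge0 => z /openP zh; rewrite lee_fin mulr_ge0 ?sqr_ge0// ltW// Delta_gt0.
exact: le_lt_trans fin1.
Qed.

Let mass_integral t1 t2 : 0 < t1 -> t1 < t2 ->
  (\int[mu]_(t in `[t1, t2]) (M t)%:E = (W t1 - W t2)%:E)%E.
Proof.
move=> t10 t12; rewrite Delta_parabola_mass_balance// /Rintegral fineK//.
by apply: integrable_fin_num => //; exact: integrable_Delta_mass.
Qed.

Lemma Delta_parabola_mass_nincr t1 t2 : 0 < t1 -> t1 <= t2 -> W t2 <= W t1.
Proof.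
move=> t10; rewrite le_eqVlt => /orP[/eqP <-//|t12].
rewrite -subr_ge0 Delta_parabola_mass_balance//; apply: Rintegral_ge0 => t.
by rewrite /= in_itv /= => /andP[? _]; apply: Delta_mass_ge0 => //; exact: lt_le_trans t10 _.
Qed.

Section NearZero.
Variable r : R.
Hypothesis r_gt0 : 0 < r.

(* [s n ^+ 2] is a sequence of times below [r] that decreases to [0], in the range
   of [Delta_parabola_mass_near]. *)
Let rho := Num.min (h / 2) (Num.min 1 r / 2).
Let s (n : nat) : R := rho / n.+1%:R.

Let rho_gt0 : 0 < rho.
Proof. by have h0 := h_gt0; have r0 := r_gt0; rewrite /rho !lt_min !divr_gt0// lt_min ltr01. Qed.

Let s_gt0 n : 0 < s n. Proof. by rewrite divr_gt0. Qed.

Let s_le n : s n <= rho.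
Proof. by rewrite /s ler_pdivrMr// ler_peMr ?ler1n//; exact: ltW. Qed.

Let sq_lt n : s n ^+ 2 < r.
Proof.
have r0 := r_gt0; have s0 := s_gt0 n; have sr := s_le n.
have : rho <= Num.min 1 r / 2 by rewrite /rho ge_min lexx orbT.
have : Num.min 1 r <= 1 by rewrite ge_min lexx.
have : Num.min 1 r <= r by rewrite ge_min lexx orbT.
move=> A B C; rewrite expr2; nra.
Qed.

Let s_cvg0 : s @ \oo --> 0.
Proof.
rewrite -(mulr0 rho); apply: cvgM; first exact: cvg_cst.
exact: cvg_harmonic.
Qed.

Let W_cvg : (fun n => W (s n ^+ 2)) @ \oo --> h ^+ 2.
Proof.
have h0 := h_gt0.
apply/cvgrPdist_le => e e0.
have cv : (fun n => 60 * h * s n) @ \oo --> 0.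
  by rewrite -(mulr0 (60 * h)); apply: cvgM; [exact: cvg_cst|exact: s_cvg0].
near=> n; rewrite distrC; apply: le_trans (Delta_parabola_mass_near (s_gt0 n) _) _.
  have := s_le n; have : rho <= h / 2 by rewrite /rho ge_min lexx.
  lra.
by near: n; exact: (cvgr_le _ cv _ e0).
Unshelve. all: by end_near. Qed.

(** Up to time [r] the loss per unit of time is at least [W r / h ^+ 2], and the
    total loss is at most the initial value [h ^+ 2]. *)
Lemma Delta_parabola_mass_decay : W r <= h ^+ 4 / r.
Proof.
have h0 := h_gt0; have r0 := r_gt0.
have key n : (r - s n ^+ 2) * W r <= h ^+ 2 * W (s n ^+ 2).
  have a0 : 0 < s n ^+ 2 by rewrite exprn_gt0.
  apply: (@le_trans _ _ (h ^+ 2 * (W (s n ^+ 2) - W r))); last first.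
    by rewrite ler_pM2l ?exprn_gt0// gerBl Delta_parabola_mass_ge0.
  rewrite Delta_parabola_mass_balance// -ler_pdivrMl ?exprn_gt0//.
  have -> : (h ^+ 2)^-1 * ((r - s n ^+ 2) * W r) = \int[mu]_(t in `[s n ^+ 2, r]) (W r / h ^+ 2).
    rewrite Rintegral_cst//= lebesgue_measure_itv /= lte_fin sq_lt /=; ring.
  apply: le_Rintegral => //.
  - by apply: continuous_integrable_itv; exact: cst_continuous.
  - exact: integrable_Delta_mass.
  - move=> t; rewrite /= in_itv /= => /andP[at_ tr]; have t0 := lt_le_trans a0 at_.
    rewrite ler_pdivrMr ?exprn_gt0// mulrC; apply: le_trans (Delta_parabola_mass_le t0).
    exact: Delta_parabola_mass_nincr.
have cvL : (fun n => (r - s n ^+ 2) * W r) @ \oo --> (r - 0 * 0) * W r.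
  by apply: cvgM; [apply: cvgB; [exact: cvg_cst|apply: cvgM; exact: s_cvg0]|exact: cvg_cst].
have cvR : (fun n => h ^+ 2 * W (s n ^+ 2)) @ \oo --> h ^+ 2 * h ^+ 2.
  by apply: cvgM; [exact: cvg_cst|exact: W_cvg].
have : (r - 0 * 0) * W r <= h ^+ 2 * h ^+ 2 by apply: (ler_cvg_to cvL cvR); exact: nearW.
by rewrite mul0r subr0 ler_pdivlMr// mulrC -exprD.
Qed.

(** The balance from time [0], where the parabola mass is [h ^+ 2], to time [r]. *)
Lemma Delta_mass_integral : (\int[mu]_(t in `]0%R, r[) (M t)%:E = (h ^+ 2 - W r)%:E)%E.
Proof.
pose F (n : nat) : set R := `[s n ^+ 2, r]%classic.
have a0 n : 0 < s n ^+ 2 by rewrite exprn_gt0.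
have F0 n t : F n t -> 0 < t by rewrite /F /= in_itv /= => /andP[? _]; exact: lt_le_trans (a0 n) _.
have mF n : measurable (F n) by exact: measurable_itv.
have UF : \bigcup_n F n = `]0, r]%classic.
  apply/seteqP; split=> t.
    by move=> [n _ Fnt]; have t0 := F0 n t Fnt; move: Fnt; rewrite /F /= !in_itv /= t0 => /andP[].
  rewrite /= in_itv /= => /andP[t0 tr].
  have cv2 : (fun n => s n * s n) @ \oo --> (0 * 0 : R) by apply: cvgM; exact: s_cvg0.
  rewrite mulr0 in cv2.
  have [n _ /(_ n (leqnn _)) /= Hn] := cvgr_le _ cv2 _ t0.
  by exists n => //; rewrite /F /= in_itv /= tr andbT expr2.
have cv : (fun n => \int[mu]_(t in F n) (M t)%:E)%E @ \oo --> (\int[mu]_(t in `]0%R, r]) (M t)%:E)%E.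
  rewrite -UF; apply: ge0_nondecreasing_set_cvg_integral => //.
  - apply/nondecreasing_seqP => n; rewrite subsetEset; apply: subset_itv; rewrite bnd_simp//.
    rewrite ler_pXn2r ?nnegrE ?divr_ge0 ?(ltW rho_gt0)// /s ler_pM2l// lef_pV2 ?posrE// ler_nat //.
  - by move=> n; apply/measurable_EFinP; apply: measurable_Delta_mass => // t; exact: F0.
  - by move=> n t Ft; rewrite lee_fin; apply: Delta_mass_ge0 => //; exact: F0 Ft.
have cv' : (fun n => \int[mu]_(t in F n) (M t)%:E)%E @ \oo --> (h ^+ 2 - W r)%:E.
  rewrite (_ : (fun n => _) = (fun n => (W (s n ^+ 2) - W r)%:E)).
    by apply: cvg_EFin; [exact: nearW|apply: cvgB; [exact: W_cvg|exact: cvg_cst]].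
  by apply/funext => n; rewrite mass_integral.
rewrite -(cvg_lim _ cv')// (cvg_lim _ cv)//.
symmetry; apply: (integral_itv_bndoo false false).
apply/measurable_EFinP; apply: measurable_Delta_mass => // t.
by rewrite /= in_itv /= => /andP[].
Qed.

End NearZero.

End InitialMass.

(** * Exit times of continuous paths *)

Section ExitTime.
Context {R : realType}.
Implicit Types (g : R -> R) (T a b s t r : R).

Lemma exit_time_ge T a b g r : (r%:E <= exit_time T a b g)%E <->
  forall s, 0 < s -> s <= T -> s < r -> a < g s < b.
Proof.
split=> [H s s0 sT sr|H].
  apply: contrapT => gs; suff : (exit_time T a b g <= s%:E)%E.
    by move=> /(le_trans H); rewrite lee_fin leNgt sr.
  by apply: ereal_inf_lbound; exists s => //=; rewrite s0 sT.
apply: le_ereal_inf_tmp => _ /= [s [/andP[s0 sT] gs] <-]; rewrite lee_fin leNgt.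
by apply/negP => sr; apply: gs; exact: H.
Qed.

Lemma exit_time_ge0 T a b g : (0 <= exit_time T a b g)%E.
Proof. by apply/exit_time_ge => s s0 _; rewrite ltNge ltW. Qed.

Lemma exit_time_le_end T a b g : 0 < T -> ~ (a < g T < b) -> (exit_time T a b g <= T%:E)%E.
Proof. by move=> T0 gT; apply: ereal_inf_lbound; exists T => //=; rewrite T0 lexx. Qed.

Lemma exit_time_pinfty T a b g : (forall s, 0 < s -> s <= T -> a < g s < b) ->
  exit_time T a b g = +oo%E.
Proof.
move=> H; rewrite /exit_time (_ : [set t%:E | t in _] = set0) ?ereal_inf0//.
by rewrite -subset0 => _ [s /= [/andP[s0 sT] []]]; exact: H.
Qed.

(** The inequality is strict because a continuous path that is in the open
    interval at time [t] stays there a little longer. *)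
Lemma exit_time_gt T a b g t : 0 < t -> t < T -> {within `[0, T], continuous g} -> a < g 0 < b ->
  (t%:E < exit_time T a b g)%E <-> forall s, 0 <= s <= t -> a < g s < b.
Proof.
move=> t0 tT cg g0; split=> [H s /andP[]|H].
  rewrite le_eqVlt => /orP[/eqP <-//|s0 st].
  have [r' tr rle] : exists2 r : R, t < r & (r%:E <= exit_time T a b g)%E.
    case: (exit_time T a b g) H => [x|_|//]; first by rewrite lte_fin => tx; exists x.
    by exists (t + 1); [rewrite ltrDl|rewrite leey].
  move/exit_time_ge : rle; apply => //; first by rewrite (le_trans st)// ltW.
  exact: le_lt_trans tr.
have tT' : 0 <= t <= T by rewrite !ltW.
have gt : `]a, b[%classic (g t) by rewrite /= in_itv /= H// lexx ltW.
have [e e0 He] := open_path_stable cg tT' (interval_open (a := BRight a) (b := BLeft b) isT isT) gt.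
apply: (@lt_le_trans _ _ (t + e)%:E); first by rewrite lte_fin ltrDl.
apply/exit_time_ge => s s0 sT ste.
have [st|ts] := leP s t; first by apply: H; rewrite ltW.
have : `]a, b[%classic (g s).
  by apply: He; [rewrite ltW|rewrite distrC gtr0_norm ?subr_gt0// ltrBlDl].
by rewrite /= in_itv.
Qed.

Context d (S : measurableType d) (P : probability S R) (B : R -> {RV P >-> R}).
Variables (T c h : R).
Hypothesis T_gt0 : 0 < T.
Hypothesis h_gt0 : 0 < h.
Hypothesis B_cont : forall o, {within `[0, T], continuous (fun t => B t o)}.

Let stay (a b : R) := [set o | open_stay (b - a) c h (fun u => B (a + u) o)].

Let stayP a b o : 0 <= a -> a < b -> b <= T ->
  stay a b o <-> forall s, a <= s <= b -> c - h < B s o < c + h.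
Proof.
move=> a0 ab bT; have ba0 : 0 < b - a by rewrite subr_gt0.
have cB : {within `[0, b - a], continuous (fun u => B (a + u) o)}.
  apply/subspace_continuousP => s; rewrite /= in_itv /= => /andP[s0 sb].
  apply/cvgrPdist_lt => e e0.
  have sT : 0 <= a + s <= T by apply/andP; split; lra.
  have oU : open (ball (B (a + s) o) (e : R)) by exact: ball_open.
  have xU : ball (B (a + s) o) (e : R) (B (a + s) o) by exact: ballxx.
  have [e1 e10 He] := open_path_stable (@B_cont o) sT oU xU.
  rewrite near_withinE; near=> u; rewrite /= in_itv /= => /andP[u0 ub]; apply: He; first by apply/andP; split; lra.
  rewrite (_ : a + s - (a + u) = s - u); last by ring.
  by near: u; exact: (@cvgr_dist_lt _ _ _ _ _ id s).
rewrite /stay /= (open_stayP _ ba0 h_gt0 cB); split=> H s /andP[s1 s2].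
  by rewrite -(subrKC a s); apply: H; apply/andP; split; lra.
by apply: H; apply/andP; split; lra.
Unshelve. all: by end_near. Qed.

Let measurable_stay a b : a < b -> measurable (stay a b).
Proof.
move=> ab; have ba0 : 0 < b - a by rewrite subr_gt0.
apply: (@measurable_path_set _ _ _ _ (fun u => B (a + u)) (b - a)).
exact: open_stay_path_events.
Qed.

(** [r <= tau] means that the path is in the interval at all times of
    [(0, T]] before [r], which is a countable union of compact time intervals. *)
Lemma measurable_exit_time :
  measurable_fun setT (fun o => exit_time T (c - h) (c + h) (fun t => B t o)).
Proof.
apply: (measurability _ (ErealGenCInfty.measurableE R)) => _ [_ [r ->] <-]; rewrite setTI.
have [r0|r0] := leP r 0.
  rewrite (_ : _ @^-1` _ = setT)//; apply/seteqP; split => // o _ /=.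
  rewrite in_itv /= andbT; apply: le_trans (exit_time_ge0 _ _ _ _); by rewrite lee_fin.
pose m := Num.min r T.
have m0 : 0 < m by rewrite lt_min r0.
pose al (n : nat) : R := m / n.+3%:R.
pose be (n : nat) : R := if T < r then T else r - al n.
have mT : m <= T by rewrite ge_min lexx orbT.
have mr : m <= r by rewrite ge_min lexx.
have al0 n : 0 < al n by rewrite divr_gt0.
have al2 n : 2 * al n < m.
  by rewrite /al mulrCA gtr_pMr// ltr_pdivrMr// mul1r ltr_nat.
have abe n : al n < be n by have := al0 n; have := al2 n; rewrite /be; case: ifP => _; lra.
have beT n : be n <= T by have := al0 n; rewrite /be; case: (ltP T r) => Tr; lra.
have al_cvg : al @ \oo --> 0.
  by have := margin_cvg m; rewrite -cvg_shiftS.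
rewrite (_ : _ @^-1` _ = \bigcap_n stay (al n) (be n)).
  by apply: bigcap_measurableType => n _; exact: measurable_stay.
apply/seteqP; split => o /=.
  rewrite in_itv /= andbT => /exit_time_ge H n _.
  apply/stayP => // [|s /andP[s1 s2]]; first exact: ltW.
  apply: H; first exact: lt_le_trans s1.
    by rewrite (le_trans s2).
  by apply: (le_lt_trans s2); have := al0 n; rewrite /be; case: (ltP T r) => Tr; lra.
move=> H; rewrite in_itv /= andbT; apply/exit_time_ge => s s0 sT sr.
have [n _ Hn] : \forall n \near \oo, al n <= s /\ al n <= r - s.
  have rs : 0 < r - s by rewrite subr_gt0.
  near=> n; split; near: n; [exact: (cvgr_le _ al_cvg _ s0)|exact: (cvgr_le _ al_cvg _ rs)].
have [n1 n2] := Hn n (leqnn n).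
apply: ((stayP o (ltW (al0 n)) (abe n) (beT n)).1 (H n I) s).
by rewrite n1 /be; case: (ltP T r) => Tr; lra.
Unshelve. all: by end_near. Qed.

Lemma ae_measure_eq (A A' : set S) : measurable A -> measurable A' ->
  {ae P, forall o, A o <-> A' o} -> P A = P A'.
Proof.
move=> mA mA' AA'; rewrite -(setIT A) -(setIT A') -!integral_indic//.
apply: ge0_ae_eq_integral => //; try by [move=> o _; rewrite lee_fin | apply/measurable_EFinP; exact: measurable_indic].
apply: filterS AA' => o H _; rewrite !indicE; congr ((nat_of_bool _)%:R%:E).
by apply/idP/idP => /set_mem /H /mem_set.
Qed.

Hypothesis B_start : {ae P, forall o, B 0 o = c}.

Notation tau o := (exit_time T (c - h) (c + h) (fun t => B t o)).

Let start_in o : B 0 o = c -> c - h < B 0 o < c + h.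
Proof. by have h0 := h_gt0; move=> ->; apply/andP; split; lra. Qed.

(** A path that is outside of the interval at time [T] has exit time at most [T],
    and the mean of [tau] is the integral of the probabilities of [t < tau]. *)
Lemma mean_exit_time_layer_cake : {ae P, forall o, ~ (c - h < B T o < c + h)} ->
  mean_exit_time B T (c - h) (c + h) =
  (\int[lebesgue_measure]_(t in `]0%R, T[) P (path_set B (open_stay t c h)))%E.
Proof.
move=> BT; have mtau := measurable_exit_time.
pose X o := fine (mine (tau o) T%:E).
have fX o : ((X o)%:E = mine (tau o) T%:E)%E.
  rewrite /X fineK// ge0_fin_numE.
    by rewrite (@le_lt_trans _ _ T%:E) ?ltry// ge_min lexx orbT.
  by rewrite le_min exit_time_ge0 lee_fin ltW.
have mX : measurable_fun setT X.
  apply: (measurableT_comp (f := fine)) => //.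
  by apply: measurable_mine.
pose XR : {RV P >-> R} := mfun_Sub (mem_set mX).
have X0 o : 0 <= X o by rewrite -lee_fin fX le_min exit_time_ge0 lee_fin ltW.
transitivity ('E_P[XR])%E.
  rewrite unlock; apply: ge0_ae_eq_integral => //.
  - exact/measurable_EFinP.
  - by move=> o _; exact: exit_time_ge0.
  - by move=> o _; rewrite lee_fin.
  - apply: filterS BT => o BTo _; rewrite /= fX min_l//.
    exact: exit_time_le_end.
rewrite ge0_expectation_ccdf// -integral_itv_obnd_cbnd; last first.
  by apply: measurable_funTS; exact: ccdf_measurable.
rewrite integral_mkcond [RHS]integral_mkcond; apply: eq_integral => t _; rewrite !patchE.
have [/set_mem|] := boolP (t \in `]0%R, T[%classic).
  rewrite /= in_itv /= => /andP[t0 tT]; rewrite mem_set /=; last by rewrite in_itv /= t0.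
  rewrite /ccdf; apply: ae_measure_eq.
  - by rewrite -[X in measurable X]setTI; apply: (measurable_funPT XR).
  - by apply: (@measurable_path_set _ _ _ _ B t); exact: open_stay_path_events.
  apply: filterS B_start => o /start_in B0.
  have tT' : t <= T by exact: ltW.
  have cB : {within `[0, t], continuous (fun t => B t o)}.
    apply: continuous_subspaceW (@B_cont o); apply: subset_itvl; rewrite bnd_simp; exact: tT'.
  rewrite /path_set /= in_itv /= andbT -lte_fin fX lt_min lte_fin tT andbT.
  by rewrite exit_time_gt// open_stayP.
rewrite notin_setE /= in_itv /= => tI; case: ifPn => // /set_mem; rewrite /= in_itv /= andbT => t0.
have E : XR @^-1` `]t, +oo[ = set0.
  rewrite -subset0 => o; rewrite /= in_itv /= andbT -lte_fin fX lt_min lte_fin => /andP[_ tT].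
  by apply: tI; rewrite t0.
by rewrite (_ : ccdf XR t = P (XR @^-1` `]t, +oo[))// E measure0.
Qed.

(** By continuity of the probability along [t n], with probability at least [delta]
    the path never leaves the interval, and then its exit time is infinite. *)
Lemma mean_exit_time_pinfty (delta t0 : R) : t0 < T -> 0 < delta ->
  {ae P, forall o, c - h < B T o < c + h} ->
  (forall t, t0 < t -> 0 < t -> t < T -> (delta%:E <= P (path_set B (open_stay t c h)))%E) ->
  mean_exit_time B T (c - h) (c + h) = +oo%E.
Proof.
move=> t0T delta0 BT stay_ge; have mtau := measurable_exit_time.
pose t (n : nat) : R := T - margin T n.
have tT n : t n < T by rewrite /t gtrBl margin_gt0.
have tp n : 0 < t n by rewrite /t subr_gt0 margin_lt.
pose E (n : nat) := path_set B (open_stay (t n) c h).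
have mE n : measurable (E n).
  by apply: (@measurable_path_set _ _ _ _ B (t n)); exact: open_stay_path_events.
have EP n o : E n o <-> forall s, 0 <= s <= t n -> c - h < B s o < c + h.
  have tT' : t n <= T by exact: ltW.
  have cB : {within `[0, t n], continuous (fun t => B t o)}.
    apply: continuous_subspaceW (@B_cont o); apply: subset_itvl; rewrite bnd_simp; exact: tT'.
  by rewrite /E /path_set /= open_stayP.
have cvE : (P \o E) @ \oo --> P (\bigcap_n E n).
  apply: nonincreasing_cvg_mu => //.
  - by rewrite (le_lt_trans (probability_le1 P (mE 0)))// ltry.
  - exact: bigcap_measurableType.
  - move=> m n mn; rewrite subsetEset => o /EP H; apply/EP => s /andP[s0 st].
    apply: H; rewrite s0 (le_trans st)// /t lerD2l lerN2; exact: margin_le.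
have PE : (delta%:E <= P (\bigcap_n E n))%E.
  rewrite -(cvg_lim _ cvE)//; apply: lime_ge; first by apply/cvg_ex; exists (P (\bigcap_n E n)).
  have dT : 0 < T - t0 by rewrite subr_gt0.
  near=> n; apply: stay_ge => //; rewrite /t ltrBrDr -ltrBrDl.
  by near: n; exact: (cvgr_lt _ (@margin_cvg R T) _ dT).
apply/eqP; rewrite -leye_eq leNgt; apply/negP => fin.
have itau : P.-integrable setT (fun o => tau o).
  apply/integrableP; split => //.
  under eq_integral do rewrite gee0_abs ?exit_time_ge0//.
  exact: fin.
have : {ae P, forall o, ~ (\bigcap_n E n) o}.
  have := integrable_ae measurableT itau.
  apply: filterS2 BT => o BTo /(_ I) + H; rewrite exit_time_pinfty// => s s0 sT.
  move: sT; rewrite le_eqVlt => /orP[/eqP ->//|sT].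
  have dT : 0 < T - s by rewrite subr_gt0.
  have [n _ Hn] := cvgr_le _ (@margin_cvg R T) _ dT.
  apply: ((EP n o).1 (H n I) s); rewrite ltW//= /t lerBrDr -lerBrDl.
  exact: Hn (leqnn n).
move=> nE; have P0 : P (\bigcap_n E n) = 0%E.
  rewrite -(measure0 P); apply: ae_measure_eq => //; first exact: bigcap_measurableType.
  by apply: filterS nE => o No; split.
by move: PE; rewrite P0 lee_fin leNgt delta0.
Unshelve. all: by end_near. Qed.

End ExitTime.

(** * Survival of a bridge *)

Section GaussianLipschitz.
Context {R : realType}.
Notation p := (@bm_density R).
Implicit Types (s t x y z u : R).

Definition bm_density_slope s : R := (Num.sqrt (2 * pi * s))^-1 * ((1 + 2 * s) / s).

Lemma bm_density_slope_bound s u : 0 < s -> `|- (u / s) * p s 0 u| <= bm_density_slope s.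
Proof.
move=> s0; rewrite /bm_density_slope mulNr normrN normrM (ger0_norm (bm_density_ge0 _ _ _)).
rewrite normrM (gtr0_norm (x := s^-1)) ?invr_gt0// /bm_density sub0r sqrrN mulNr expRN.
set K := (Num.sqrt _)^-1; have K0 : 0 <= K by rewrite invr_ge0 sqrtr_ge0.
rewrite [leLHS](_ : _ = K * ((`|u| / expR (u ^+ 2 / (2 * s))) / s)); last by ring.
rewrite ler_wpM2l// ler_pM2r ?invr_gt0// ler_pdivrMr ?expR_gt0//.
have v0 : 0 <= u ^+ 2 / (2 * s) by rewrite divr_ge0 ?sqr_ge0// mulr_ge0// ltW.
apply: (@le_trans _ _ ((1 + 2 * s) * (1 + u ^+ 2 / (2 * s)))); last first.
  by rewrite ler_wpM2l ?expR_ge1Dx// addr_ge0// mulr_ge0// ltW.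
have -> : (1 + 2 * s) * (1 + u ^+ 2 / (2 * s)) = 1 + 2 * s + u ^+ 2 / (2 * s) + u ^+ 2.
  by field; rewrite lt0r_neq0.
rewrite -(real_normK (num_real u)) in v0 *.
have := sqr_ge0 (`|u| - 1); have := normr_ge0 u; rewrite !expr2; move: v0; rewrite expr2; set X := _ / _.
by nra.
Qed.

Lemma bm_density_bounded_lipschitz s y : 0 < s ->
  bounded_lipschitz (Num.sqrt (2 * pi * s))^-1 (bm_density_slope s) (fun z => p s z y).
Proof.
move=> s0; split=> [z|].
  by rewrite ger0_norm ?bm_density_ge0// bm_density_le.
have E z : p s z y = p s 0 (z - y) by apply: bm_density_diff; ring.
have key a b : a <= b -> `|p s 0 b - p s 0 a| <= bm_density_slope s * `|b - a|.
  move=> ab; have [||e _ ->] := @MVT_segment R (p s 0) (fun u => - (u / s) * p s 0 u) a b ab.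
  - by move=> u _; exact: is_derive_bm_density_space.
  - by apply: continuous_subspaceT; exact: continuous_bm_density.
  by rewrite normrM ler_wpM2r// bm_density_slope_bound.
move=> u v; rewrite !E; have -> : u - v = (u - y) - (v - y) by ring.
have [uv|/ltW uv] := leP (u - y) (v - y); last exact: key.
by rewrite distrC [X in _ * X]distrC; exact: key.
Qed.

Lemma bounded_lipschitz_max0 (C L : R) f : bounded_lipschitz C L f ->
  bounded_lipschitz C L (fun z => Num.max 0 (f z)).
Proof.
move=> [fC fL]; split=> [z|y z].
  by rewrite /Num.max; case: ltP => // _; rewrite normr0 (le_trans _ (fC z)).
apply: le_trans (fL y z); rewrite /Num.max; case: ltP => hy; case: ltP => hz; rewrite ?subrr ?normr0//.
  by rewrite subr0 gtr0_norm//; apply: le_trans (ler_norm _); lra.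
by rewrite sub0r normrN gtr0_norm// distrC; apply: le_trans (ler_norm _); lra.
Qed.

Lemma bounded_lipschitz_comb (C C' L L' : R) f g (a b : R) : bounded_lipschitz C L f ->
  bounded_lipschitz C' L' g ->
  bounded_lipschitz (`|a| * C + `|b| * C') (`|a| * L + `|b| * L') (fun z => a * f z + b * g z).
Proof.
move=> [fC fL] [gC gL]; split=> [z|y z].
  by apply: le_trans (ler_normD _ _) _; rewrite !normrM lerD// ler_wpM2l.
have -> : a * f y + b * g y - (a * f z + b * g z) = a * (f y - f z) + b * (g y - g z) by ring.
apply: le_trans (ler_normD _ _) _; rewrite !normrM mulrDl -!mulrA.
by rewrite lerD// ler_wpM2l.
Qed.

End GaussianLipschitz.

Section BridgeSurvival.
Context {R : realType}.
Notation mu := (@lebesgue_measure R).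
Notation p := (@bm_density R).
Implicit Types (s t z : R).
Variables (c h T y : R).
Hypothesis h_gt0 : 0 < h.
Hypothesis T_gt0 : 0 < T.

Let I : set R := `]c - h, c + h[.

Let mI : measurable I. Proof. exact: measurable_itv. Qed.

Context d (S : measurableType d) (P : probability S R).
Variables (D : set R) (q : R -> R -> R -> R) (X : R -> {RV P >-> R}).
Hypothesis HM : markov_process D q c X.
Variables (th w0 : R) (w : R -> R).
Hypothesis thP : th = 0 \/ th = 1 /\ 0 < c - h.
Hypothesis mw : measurable_fun setT w.
Hypothesis w0_gt0 : 0 < w0.
Hypothesis w_ge : forall z, c - h < z < c + h -> w0 <= w z.
Hypothesis ID : forall z, c - h < z < c + h -> D z.
Hypothesis qE : forall dt a z : R, 0 < dt -> c - h < a < c + h -> c - h < z < c + h ->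
  q dt a z = w z / w a * reflected_kernel th dt a z.
Hypothesis qyE : forall dt a : R, 0 < dt -> c - h < a < c + h ->
  q dt a y = w y / w a * reflected_kernel th dt a y.
Hypothesis wy_gt0 : 0 < w y.
Hypothesis kernel_ge0 : forall dt a : R, 0 < dt -> c - h < a < c + h -> 0 <= reflected_kernel th dt a y.
Hypothesis kernelT_gt0 : 0 < reflected_kernel th T c y.

(** The density of the bridge at time [t] relative to the process, up to the weights
    [w c / w z]; these cancel against the ones of [survival_formula]. *)
Definition bridge_ratio t z := reflected_kernel th (T - t) z y / reflected_kernel th T c y.

Context d' (S' : measurableType d') (P' : probability S' R) (B : R -> {RV P' >-> R}).
Hypothesis HB : bridge_of X q T c y B.

Let c_in : c - h < c < c + h.
Proof. by have h0 := h_gt0; apply/andP; split; lra. Qed.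

Let wc_gt0 : 0 < w c. Proof. exact: lt_le_trans w0_gt0 (w_ge c_in). Qed.

(** At time [0] the bridge density is one at the starting point. *)
Lemma bridge_start : {ae P', forall o, B 0 o = c}.
Proof.
have A0 : path_events 0 [set g : R -> R | [set c] (g 0)] by apply: path_events_at; rewrite ?lexx.
have T0 : (0 : R) <= 0 < T by rewrite lexx T_gt0.
have m0 : measurable [set o | [set c] (X 0 o)] by exact: measurable_at.
have m0' : measurable [set o | [set c] (B 0 o)] by exact: measurable_at.
have PX : P [set o | [set c] (X 0 o)] = 1%E.
  rewrite -(probability_setT P); apply: ae_measure_eq => //.
  by apply: filterS (markov_start HM) => o Xo; split.
have PB : P' [set o | [set c] (B 0 o)] = 1%E.
  rewrite (bridge_law HB T0 A0) -PX -[RHS]mul1e -integral_cst//.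
  apply: eq_integral => o /set_mem /= ->.
  by rewrite subr0 divff// qyE// mulf_neq0// ?lt0r_neq0// divr_gt0.
exists (~` [set o | [set c] (B 0 o)]); split => //; first exact: measurableC.
by rewrite probability_setC// PB subee.
Qed.

(* [reflected_kernel 1] is negative on the negative half-line; its positive part is
   Lipschitz and nonnegative everywhere, and agrees with it on the interval. *)
Let clipped t z := Num.max 0 (bridge_ratio t z).

Let clippedE t z : t < T -> c - h < z < c + h -> clipped t z = bridge_ratio t z.
Proof.
move=> tT zI; rewrite /clipped max_r// divr_ge0 ?(ltW kernelT_gt0)//.
by apply: kernel_ge0 => //; rewrite subr_gt0.
Qed.

Let clipped_lipschitz t : t < T -> exists C L, bounded_lipschitz C L (clipped t).
Proof.
move=> tT; have s0 : 0 < T - t by rewrite subr_gt0.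
eexists; eexists; apply: bounded_lipschitz_max0.
rewrite (_ : bridge_ratio t = fun z => (reflected_kernel th T c y)^-1 * p (T - t) z y +
   (- (th / reflected_kernel th T c y)) * p (T - t) z (- y)).
  exact: bounded_lipschitz_comb (bm_density_bounded_lipschitz y s0) (bm_density_bounded_lipschitz (- y) s0).
by apply/funext => z; rewrite /bridge_ratio /reflected_kernel; set k := (_ - _)^-1; ring.
Qed.

Lemma bridge_survival t : 0 < t -> t < T ->
  P' (path_set B (open_stay t c h)) =
  (\int[mu]_(z in `](- h)%R, h[) (bridge_ratio t (z + c) * Delta z h t)%:E)%E.
Proof.
move=> t0 tT; have [C [L fCL]] := clipped_lipschitz tT.
have f0 z : 0 <= clipped t z by rewrite le_max lexx.
have H := survival_formula h_gt0 t0 HM thP mw w0_gt0 w_ge ID qE fCL f0.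
have tT' : 0 <= t < T by rewrite ltW.
have mA := open_stay_path_events c h t0.
have pA := measurable_path_set X mA.
rewrite (bridge_law HB tT' mA).
transitivity ((w c * survival_integral c X h w (clipped t) t)%:E).
  have cX o : {within `[0, t], continuous (fun t => X t o)}.
    have sub : (`[0, t]%classic : set R) `<=` `[0, +oo[%classic by apply: subset_itvl.
    by apply: continuous_subspaceW sub _; exact: (markov_continuous HM).
  have E o : path_set X (open_stay t c h) o ->
      q (T - t) (X t o) y / q T c y = w c * weighted I w (clipped t) (X t o).
    move=> /(open_stayP _ t0 h_gt0 (@cX o)) Ho.
    have Xt : c - h < X t o < c + h by apply: Ho; rewrite lexx ltW.
    have wX : 0 < w (X t o) by exact: lt_le_trans (w_ge Xt).
    rewrite /weighted indicE mem_set /=; last by rewrite /I /= in_itv.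
    rewrite mul1r clippedE// !qyE ?subr_gt0// /bridge_ratio.
    by field; rewrite !lt0r_neq0.
  pose g o := \1_(path_set X (open_stay t c h)) o * weighted I w (clipped t) (X t o).
  have C0 : 0 <= C by apply: le_trans (fCL.1 0).
  have mX : measurable_fun setT (X t) by exact: measurable_funPT.
  have ig : P.-integrable setT (EFin \o g).
    apply: (@integrable_bounded _ _ _ _ _ (C / w0)).
      apply: measurable_funM; first exact: measurable_indic.
      apply: (measurableT_comp (f := weighted I w (clipped t))) => //.
      apply: measurable_weighted => //; exact: (bounded_lipschitz_measurable fCL).1.
    move=> o; rewrite normrM -[leRHS]mul1r; apply: ler_pM => //.
      by rewrite indicE ger0_norm// lern1 leq_b1.
    by apply: (weighted_bounded _ w0_gt0 _ fCL.1) => z; rewrite /I /= in_itv; exact: w_ge.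
  rewrite EFinM /survival_integral /Rintegral fineK; last exact: integrable_fin_num.
  rewrite -integralZl//= integral_mkcond; apply: eq_integral => o _.
  rewrite patchE /g indicE; case: ifPn => [/set_mem Ao|_]; first by rewrite E// mul1r.
  by rewrite mul0r mule0.
rewrite H /Rintegral fineK; last first.
  apply: integrable_fin_num => //; apply: (@integrable_bounded_on _ _ _ _ _ _ (C * Delta_bound h t)) => //.
  - exact: mu_itv_fin.
  - apply: measurable_funM; last exact: measurable_Delta_shift.
    by apply: measurable_funTS; exact: (bounded_lipschitz_measurable fCL).1.
  - by move=> z /I_norm zc; rewrite normrM; apply: ler_pM => //; [exact: fCL.1|exact: Delta_bounded].
rewrite integral_mkcond -(integral_shift c); last first.
  apply/(measurable_restrictT _ mI)/measurable_EFinP.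
  apply: measurable_funM; last exact: measurable_Delta_shift.
  by apply: measurable_funTS; exact: (bounded_lipschitz_measurable fCL).1.
rewrite [RHS]integral_mkcond; apply: eq_integral => z _; rewrite !patchE.
have -> : (c + z \in I) = (z \in `]- h, h[%classic).
  by rewrite !mem_setE !in_itv /= !ltrD2l.
case: ifPn => [/set_mem|//]; rewrite /= in_itv /= => /andP[z1 z2].
rewrite clippedE//; last by apply/andP; split; lra.
by rewrite (addrC c) addrK.
Qed.

End BridgeSurvival.

(** * Mean exit times of small intervals *)

Section SmallInterval.
Context {R : realType}.
Notation mu := (@lebesgue_measure R).
Implicit Types (t z : R).
Variables (h t0 T e C : R) (kap : R -> R -> R).
Hypothesis h_gt0 : 0 < h.
Hypothesis t0_gt0 : 0 < t0.
Hypothesis t0_lt : t0 < T.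
Hypothesis e_ge0 : 0 <= e.
Hypothesis e_le1 : e <= 1.
Hypothesis C_ge0 : 0 <= C.
Hypothesis mkap : measurable_fun (`]0, T[ `*` `]- h, h[) (fun tz => kap tz.1 tz.2).
Hypothesis kap_ge0 : forall t z, 0 < t < T -> - h < z < h -> 0 <= kap t z.
Hypothesis kap_le : forall t z, 0 < t < T -> - h < z < h -> kap t z <= C.
Hypothesis kap_near : forall t z, 0 < t < t0 -> - h < z < h -> `|kap t z - 1| <= e.

Let J : set R := `]- h, h[.

Notation inner t := (\int[mu]_(z in J) (kap t z * Delta z h t)%:E)%E.

Let mJ : measurable J. Proof. exact: measurable_itv. Qed.

Let JP z : J z -> - h < z < h. Proof. by rewrite /J /= in_itv. Qed.

Let Delta_pos t z : 0 < t -> J z -> 0 <= Delta z h t.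
Proof. by move=> t_gt0 /JP zh; apply/ltW/Delta_gt0 => //; rewrite ltr_norml. Qed.

Let inner_ge0 t : 0 < t < T -> (0 <= inner t)%E.
Proof.
move=> /[dup] tT /andP[tp _]; apply: integral_ge0 => z Jz; rewrite lee_fin mulr_ge0//.
  exact/kap_ge0/JP.
exact: Delta_pos.
Qed.

Let mDelta : measurable_fun (`]0, T[ `*` J) (fun tz => Delta tz.2 h tz.1).
Proof.
apply: measurable_Delta => //; try exact: measurable_funTS.
move=> [t z] [/=]; rewrite in_itv /= => /andP[tp _] /JP /andP[z1 z2]; split => //.
by rewrite ler_norml !ltW.
Qed.

Let m_inner : measurable_fun `]0, T[ (fun t => inner t).
Proof.
apply: (@measurable_section_integral R `]0, T[ J (fun t z => kap t z * Delta z h t)) => //.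
  exact: measurable_funM.
move=> t z; rewrite /= in_itv /= => tT Jz; rewrite mulr_ge0//; first exact/kap_ge0/JP.
by apply: Delta_pos => //; case/andP: tT.
Qed.

Let sections t : 0 < t < T -> measurable_fun J (kap t) /\ measurable_fun J (fun z => Delta z h t).
Proof.
move=> tT; have mTJ : measurable (`]0, T[ `*` J) by exact: measurableX.
have sub : pair t @` J `<=` `]0, T[ `*` J.
  by move=> _ [z Jz <-]; split => //=; rewrite in_itv.
have mp : measurable_fun J (pair t) by exact: measurable_funTS.
by split; [have := measurable_comp mTJ sub mkap mp|have := measurable_comp mTJ sub mDelta mp].
Qed.

Let inner_le t k : 0 < t < T -> 0 <= k -> (forall z, J z -> kap t z <= k) ->
  (inner t <= k%:E * (Delta_mass h t)%:E)%E.
Proof.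
move=> tT k0 H; have [mk mD] := sections tT; have tp : 0 < t by case/andP: tT.
rewrite -Delta_massE// -ge0_integralZl_EFin//; last 2 first.
- by move=> z Jz; rewrite lee_fin Delta_pos.
- exact/measurable_EFinP.
apply: ge0_le_integral => //.
- by move=> z Jz; rewrite lee_fin mulr_ge0 ?Delta_pos//; exact/kap_ge0/JP.
- by apply/measurable_EFinP; exact: measurable_funM.
- by apply/measurable_EFinP; exact: measurable_funM.
- by move=> z Jz; rewrite -EFinM lee_fin ler_wpM2r ?H// Delta_pos.
Qed.

Let inner_ge t k : 0 < t < T -> 0 <= k -> (forall z, J z -> k <= kap t z) ->
  (k%:E * (Delta_mass h t)%:E <= inner t)%E.
Proof.
move=> tT k0 H; have [mk mD] := sections tT; have tp : 0 < t by case/andP: tT.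
rewrite -Delta_massE// -ge0_integralZl_EFin//; last 2 first.
- by move=> z Jz; rewrite lee_fin Delta_pos.
- exact/measurable_EFinP.
apply: ge0_le_integral => //.
- by move=> z Jz; rewrite mule_ge0// lee_fin Delta_pos.
- by apply/measurable_EFinP; exact: measurable_funM.
- by apply/measurable_EFinP; exact: measurable_funM.
- by move=> z Jz; rewrite -EFinM lee_fin ler_wpM2r ?H// Delta_pos.
Qed.

(** Times after [t0] are dropped; before [t0] the survival mass is nearly [h ^+ 2]. *)
Lemma small_interval_lower :
  (((1 - e) * (h ^+ 2 - h ^+ 4 / t0))%:E <= \int[mu]_(t in `]0%R, T[) inner t)%E.
Proof.
apply: (@le_trans _ _ (\int[mu]_(t in `]0%R, t0[) ((1 - e)%:E * (Delta_mass h t)%:E))%E).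
  rewrite ge0_integralZl_EFin ?subr_ge0//; last 2 first.
  - by move=> t; rewrite /= in_itv /= => /andP[tp _]; rewrite lee_fin Delta_mass_ge0.
  - apply/measurable_EFinP; apply: measurable_Delta_mass => // t.
    by rewrite /= in_itv /= => /andP[].
  rewrite Delta_mass_integral// -EFinM lee_fin ler_wpM2l ?subr_ge0//.
  by rewrite lerD2l lerN2 Delta_parabola_mass_decay.
apply: (@le_trans _ _ (\int[mu]_(t in `]0%R, t0[) inner t)%E); last first.
  apply: ge0_subset_integral => //.
  by apply: subset_itvl; rewrite bnd_simp ltW.
have sub : `]0, t0[%classic `<=` (`]0, T[%classic : set R).
  by apply: subset_itvl; rewrite bnd_simp ltW.
apply: ge0_le_integral => //.
- move=> t; rewrite /= in_itv /= => /andP[tp _].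
  by rewrite mule_ge0// lee_fin ?subr_ge0// Delta_mass_ge0.
- apply/measurable_EFinP; apply: measurable_funM => //; apply: measurable_Delta_mass => // t.
  by rewrite /= in_itv /= => /andP[].
- exact: measurable_funS m_inner.
- move=> t; rewrite /= in_itv /= => tt0; apply: inner_ge; rewrite ?subr_ge0//.
    by case/andP: tt0 => -> /= /lt_trans; apply.
  move=> z /JP zh; have := kap_near tt0 zh; rewrite ler_norml => /andP[+ _].
  by rewrite lerBrDr addrC.
Qed.

(** After [t0] the survival mass left is only of order [h ^+ 4]. *)
Lemma small_interval_upper :
  (\int[mu]_(t in `]0%R, T[) inner t <= ((1 + e) * h ^+ 2 + C * (h ^+ 4 / t0))%:E)%E.
Proof.
have h0 := h_gt0; have T0 : 0 < T by exact: lt_trans t0_lt.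
have U : `]0, T[%classic = `]0, t0[%classic `|` `[t0, T[%classic :> set R.
  by rewrite -itv_bndbnd_setU// bnd_simp ltW.
rewrite U ge0_integral_setU//; last 3 first.
- by rewrite -U.
- by rewrite -U => t; rewrite /= in_itv /=; exact: inner_ge0.
- apply/disj_setPLR => t; rewrite /= !in_itv /= => /andP[_ tt0].
  by apply/negP; rewrite negb_and -ltNge tt0.
have sub1 : `]0, t0[%classic `<=` (`]0, T[%classic : set R) by rewrite U; exact: subsetUl.
have sub2 : `[t0, T[%classic `<=` (`]0, T[%classic : set R) by rewrite U; exact: subsetUr.
rewrite EFinD; apply: leeD.
  apply: (@le_trans _ _ (\int[mu]_(t in `]0%R, t0[) ((1 + e)%:E * (Delta_mass h t)%:E))%E).
    apply: ge0_le_integral => //.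
    - by move=> t /sub1; rewrite /= in_itv /=; exact: inner_ge0.
    - exact: measurable_funS m_inner.
    - apply/measurable_EFinP; apply: measurable_funM => //; apply: measurable_Delta_mass => // t.
      by rewrite /= in_itv /= => /andP[].
    - move=> t; rewrite /= in_itv /= => tt0; apply: inner_le; rewrite ?addr_ge0//.
        by case/andP: tt0 => -> /= /lt_trans; apply.
      move=> z /JP zh; have := kap_near tt0 zh; rewrite ler_norml => /andP[_].
      by rewrite lerBlDl.
  rewrite ge0_integralZl_EFin ?addr_ge0//; last 2 first.
  - by move=> t; rewrite /= in_itv /= => /andP[tp _]; rewrite lee_fin Delta_mass_ge0.
  - apply/measurable_EFinP; apply: measurable_Delta_mass => // t.
    by rewrite /= in_itv /= => /andP[].
  rewrite Delta_mass_integral// -EFinM lee_fin ler_wpM2l ?addr_ge0//.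
  by rewrite gerBl Delta_parabola_mass_ge0.
apply: (@le_trans _ _ (\int[mu]_(t in `[t0, T[) (C%:E * (Delta_mass h t)%:E))%E).
  apply: ge0_le_integral => //.
  - by move=> t /sub2; rewrite /= in_itv /=; exact: inner_ge0.
  - exact: measurable_funS m_inner.
  - apply/measurable_EFinP; apply: measurable_funM => //; apply: measurable_Delta_mass => // t.
    by move=> /sub2; rewrite /= in_itv /= => /andP[].
  - move=> t /sub2; rewrite /= in_itv /= => tT; apply: inner_le => // z /JP zh.
    exact: kap_le.
have p2 t : `[t0, T]%classic t -> 0 < t by rewrite /= in_itv /= => /andP[+ _]; exact: lt_le_trans.
rewrite ge0_integralZl_EFin//; last 2 first.
- by move=> t /sub2; rewrite /= in_itv /= => /andP[tp _]; rewrite lee_fin Delta_mass_ge0.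
- apply/measurable_EFinP; apply: measurable_Delta_mass => // t /sub2.
  by rewrite /= in_itv /= => /andP[].
rewrite EFinM; apply: lee_wpmul2l; first by rewrite lee_fin.
apply: (@le_trans _ _ (\int[mu]_(t in `[t0, T]) (Delta_mass h t)%:E)%E).
  apply: ge0_subset_integral => //.
  - by apply/measurable_EFinP; apply: measurable_Delta_mass => // t; exact: p2.
  - by move=> t /p2 tp; rewrite lee_fin Delta_mass_ge0.
  - by apply: subset_itvl; rewrite bnd_simp.
have := Delta_parabola_mass_balance h_gt0 t0_gt0 t0_lt; rewrite /Rintegral => E.
rewrite -[leLHS]fineK; last first.
  by apply: integrable_fin_num => //; exact: integrable_Delta_mass.
rewrite -E lee_fin; apply: le_trans (Delta_parabola_mass_decay h_gt0 t0_gt0).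
by rewrite gerBl Delta_parabola_mass_ge0.
Qed.

End SmallInterval.

Lemma scaled_bounds (R : realType) (h t0 C e e0 M : R) : 0 < h -> 0 < t0 -> 0 <= C -> 0 <= e ->
  e <= e0 / 2 -> (C + 1) / t0 * h ^+ 2 <= e0 / 2 ->
  (1 - e) * (h ^+ 2 - h ^+ 4 / t0) <= M -> M <= (1 + e) * h ^+ 2 + C * (h ^+ 4 / t0) ->
  `|1 - h ^- 2 * M| <= e0.
Proof.
move=> h0 t00 C0 ep e2 q0 H1 H2; have hh : 0 < h ^+ 2 by exact: exprn_gt0.
have hn : h != 0 by exact: lt0r_neq0.
have tn : t0 != 0 by exact: lt0r_neq0.
have L1 : (1 - e) * (1 - h ^+ 2 / t0) <= h ^- 2 * M.
  rewrite ler_pdivlMl//; apply: le_trans H1; apply: eq_lexx; by field.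
have L2 : h ^- 2 * M <= 1 + e + C / t0 * h ^+ 2.
  rewrite ler_pdivrMl//; apply: (le_trans H2); apply: eq_lexx; by field.
have q1 : (C + 1) / t0 * h ^+ 2 = C / t0 * h ^+ 2 + h ^+ 2 / t0 by field.
have q2 : 0 <= C / t0 * h ^+ 2 by exact: mulr_ge0 (divr_ge0 C0 (ltW t00)) (ltW hh).
have q3 : 0 <= h ^+ 2 / t0 by exact: divr_ge0 (ltW hh) (ltW t00).
have q4 : 0 <= e * (h ^+ 2 / t0) by exact: mulr_ge0.
rewrite q1 in q0; move: q0 q2 q3 q4 L1 L2.
set A := C / t0 * h ^+ 2; set B := h ^+ 2 / t0; set X := h ^- 2 * M => *.
by rewrite distrC ler_norml; apply/andP; split; lra.
Qed.

Section BridgeRatio.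
Context {R : realType}.
Notation mu := (@lebesgue_measure R).
Notation p := (@bm_density R).
Implicit Types (s t z r a : R).

Lemma bm_density_away s t0 x y a : 0 < s -> s <= t0 -> 0 < a -> a <= `|x - y| ->
  p s x y <= 2 * Num.sqrt t0 / a ^+ 2.
Proof.
move=> s0 st a0 axy; have sq0 : 0 < Num.sqrt s by rewrite sqrtr_gt0.
have a2 : a ^+ 2 <= (x - y) ^+ 2.
  by rewrite -[leRHS]real_normK ?num_real// ler_pXn2r ?nnegrE ?(ltW a0).
have d0 : 0 < (x - y) ^+ 2 by apply: lt_le_trans a2; rewrite exprn_gt0.
have K_le : (Num.sqrt (2 * pi * s))^-1 <= (Num.sqrt s)^-1.
  rewrite lef_pV2 ?posrE ?sqrtr_gt0 ?mulr_gt0 ?pi_gt0//; apply: ler_wsqrtr.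
  by rewrite ler_peMl ?(ltW s0)//; have := pi_ge2 R; lra.
apply: (@le_trans _ _ ((Num.sqrt s)^-1 * (2 * s / a ^+ 2))).
  rewrite /bm_density; apply: ler_pM => //.
  rewrite mulNr; apply: le_trans (expRN_le_inv _) _; first by rewrite divr_gt0// mulr_gt0.
  rewrite invf_div ler_pM2l ?mulr_gt0// lef_pV2 ?posrE// exprn_gt0//.
rewrite -{2}(sqr_sqrtr (ltW s0)).
rewrite [leLHS](_ : _ = 2 * Num.sqrt s / a ^+ 2); last by field; rewrite !lt0r_neq0.
by rewrite ler_pM2r ?invr_gt0 ?exprn_gt0// ler_pM2l// ler_wsqrtr.
Qed.

Lemma continuous_bm_density_joint (T : topologicalType) (s u : T -> R) (x : T) : 0 < s x ->
  {for x, continuous s} -> {for x, continuous u} -> {for x, continuous (fun w => p (s w) 0 (u w))}.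
Proof.
move=> s0 cs cu; rewrite /bm_density; apply: cvgM.
  apply: cvgV; first by rewrite lt0r_neq0// sqrtr_gt0 !mulr_gt0// pi_gt0.
  apply: (@continuous_comp _ _ _ (fun w => 2 * pi * s w) Num.sqrt); last exact: sqrt_continuous.
  by apply: cvgM; [exact: cvg_cst|exact: cs].
apply: (@continuous_comp _ _ _ (fun w => - (0 - u w) ^+ 2 / (2 * s w)) expR); last exact: continuous_expR.
apply: cvgM.
  apply: cvgN; rewrite (_ : (fun w => (0 - u w) ^+ 2) = (fun w => u w * u w)).
    by rewrite sub0r sqrrN expr2; apply: cvgM; exact: cu.
  by apply/funext => w; rewrite sub0r sqrrN expr2.
apply: cvgV; first by rewrite mulf_neq0// lt0r_neq0.
by apply: cvgM; [exact: cvg_cst|exact: cs].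
Qed.

Variables (c y T th : R).
Hypothesis T_gt0 : 0 < T.
Hypothesis thP : th = 0 \/ th = 1.
Hypothesis kernelT_gt0 : 0 < reflected_kernel th T c y.

Notation ratio t z := (bridge_ratio c T y th t (z + c)).

(** The ratio is jointly continuous, and equals one at time [0] and position [c]. *)
Lemma bridge_ratio_near e : 0 < e -> exists r t0 : R, [/\ 0 < r, 0 < t0, t0 < T &
  forall t z, 0 < t < t0 -> - r < z < r -> `|ratio t z - 1| <= e].
Proof.
move=> e0.
have c1 : {for ((0, 0) : R * R), continuous (fun w : R * R => ratio w.1 w.2)}.
  have cs : {for ((0, 0) : R * R), continuous (fun w : R * R => T - w.1)}.
    by apply: cvgB; [exact: cvg_cst|exact: cvg_fst].
  have cu k : {for ((0, 0) : R * R), continuous (fun w : R * R => w.2 + k)}.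
    by apply: cvgD; [exact: cvg_snd|exact: cvg_cst].
  have E w : ratio w.1 w.2 = (p (T - w.1) 0 (w.2 + (c - y)) - th * p (T - w.1) 0 (w.2 + (c + y))) /
      reflected_kernel th T c y.
    rewrite /bridge_ratio /reflected_kernel; congr ((_ - _ * _) / _); apply: bm_density_diff; ring.
  rewrite (funext E).
  have T0 : 0 < T - ((0, 0) : R * R).1 by rewrite /= subr0.
  have cp (k : R) : {for ((0, 0) : R * R), continuous (fun w : R * R => p (T - w.1) 0 (w.2 + k))}.
    exact: (@continuous_bm_density_joint (R * R)%type (fun w => T - w.1) (fun w => w.2 + k) (0, 0) T0 cs (cu k)).
  apply: cvgM; last exact: cvg_cst.
  apply: cvgB; first exact: cp.
  by apply: cvgM; [exact: cvg_cst|exact: cp].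
have v1 : ratio 0 0 = 1 by rewrite /bridge_ratio subr0 add0r divff// lt0r_neq0.
have /cvgrPdist_le/(_ e e0) := c1.
rewrite /= v1 => /nbhs_ballP[r /= r0 Hr].
exists r, (Num.min r (T / 2)); split => //.
- by rewrite lt_min r0 divr_gt0.
- by rewrite gt_min; apply/orP; right; have T0 := T_gt0; lra.
- move=> t z /andP[t0]; rewrite lt_min => /andP[tr _] zr.
  rewrite distrC; apply: (Hr (t, z)); split; rewrite /ball /= sub0r normrN.
    by rewrite gtr0_norm.
  by rewrite ltr_norml.
Qed.

(** Away from its centre the Gaussian density is bounded uniformly in time, although
    its maximum blows up as [t] tends to [T]. *)
Lemma bridge_ratio_le a t z : 0 < a -> a <= `|z + c - y| -> 0 < t < T ->
  ratio t z <= 2 * Num.sqrt T / a ^+ 2 / reflected_kernel th T c y.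
Proof.
move=> a0 az /andP[t0 tT]; rewrite /bridge_ratio ler_pM2r ?invr_gt0//.
apply: (@le_trans _ _ (p (T - t) (z + c) y)).
  by rewrite gerBl mulr_ge0 ?bm_density_ge0//; case: thP => ->.
by apply: bm_density_away => //; lra.
Qed.

Lemma measurable_bridge_ratio (D : set (R * R)) :
  measurable_fun D (fun tz : R * R => ratio tz.1 tz.2).
Proof.
rewrite /bridge_ratio /reflected_kernel; apply: measurable_funTS.
apply: measurable_funM => //; apply: measurable_funB; last apply: measurable_funM => //.
- by apply: measurable_bm_density_joint => //; [exact: measurable_funB|exact: measurable_funD].
- by apply: measurable_bm_density_joint => //; [exact: measurable_funB|exact: measurable_funD].
Qed.

Hypothesis y_neq : y != c.
Variable h1 : R.
Hypothesis h1_gt0 : 0 < h1.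
Hypothesis kernel_ge0 : forall s z, 0 < s -> - h1 < z < h1 -> 0 <= reflected_kernel th s (z + c) y.
Variable m : R -> \bar R.
Hypothesis mE : forall h, 0 < h -> h < h1 ->
  m h = (\int[mu]_(t in `]0%R, T[) \int[mu]_(z in `](- h)%R, h[) (ratio t z * Delta z h t)%:E)%E.

(** The ratio is within [e] of one before some [t0] and bounded afterwards, so that
    the scaled mean is within [e + O(h ^+ 2)] of one. *)
Lemma scaled_mean_cvg1 : ((h ^- 2)%:E * m h)%E @[h --> 0^'+] --> 1%E.
Proof.
pose a := `|c - y| / 2; have a0 : 0 < a by rewrite divr_gt0// normr_gt0 subr_eq0 eq_sym.
pose C : R := 2 * Num.sqrt T / a ^+ 2 / reflected_kernel th T c y.
have C0 : 0 <= C by rewrite !divr_ge0 ?mulr_ge0 ?sqrtr_ge0 ?sqr_ge0// ltW.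
have bounds (e : R) : 0 < e -> e <= 1 -> exists r t0 : R, [/\ 0 < r, 0 < t0 & forall h : R, 0 < h -> h < r ->
    (((1 - e) * (h ^+ 2 - h ^+ 4 / t0))%:E <= m h)%E /\ (m h <= ((1 + e) * h ^+ 2 + C * (h ^+ 4 / t0))%:E)%E].
  move=> e0 e1; have [r [t0 [r0 t00 t0T near1]]] := bridge_ratio_near e0.
  exists (Num.min r (Num.min a h1)), t0; split => //; first by rewrite !lt_min r0 a0.
  move=> h h0; rewrite !lt_min => /and3P[hr ha hh1]; rewrite mE//.
  have ge0 t z : 0 < t < T -> - h < z < h -> 0 <= ratio t z.
    move=> /andP[_ tT] /andP[z1 z2]; rewrite divr_ge0 ?(ltW kernelT_gt0)//.
    by apply: kernel_ge0; rewrite ?subr_gt0//; apply/andP; split; lra.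
  have near2 t z : 0 < t < t0 -> - h < z < h -> `|ratio t z - 1| <= e.
    by move=> tt /andP[z1 z2]; apply: near1 => //; apply/andP; split; lra.
  have le t z : 0 < t < T -> - h < z < h -> ratio t z <= C.
    move=> tT /andP[z1 z2]; apply: bridge_ratio_le => //.
    have : `|c - y| <= `|z + c - y| + `|z|.
      by rewrite -[X in _ <= _ + X]normrN; apply: le_trans (ler_normD _ _); apply: eq_lexx; congr (`|_|); ring.
    have : `|z| < h by rewrite ltr_norml z1 z2.
    have : `|c - y| = 2 * a by rewrite /a; field.
    lra.
  split.
    exact: (small_interval_lower h0 t00 t0T e1 (@measurable_bridge_ratio _) ge0 near2).
  exact: (small_interval_upper h0 t00 t0T (ltW e0) C0 (@measurable_bridge_ratio _) ge0 le near2).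
have h0E : \forall h \near (0 : R)^'+, 0 < h by exact: nbhs_right_gt.
have finm : \forall h \near (0 : R)^'+, m h \is a fin_num.
  have [r [t0 [r0 t00 H]]] := bounds 1 ltr01 (lexx _).
  near=> h; have hp : 0 < h by near: h.
  have hr : h < r by near: h; exact: nbhs_right_lt.
  have [H1 H2] := H h hp hr.
  by rewrite fin_numE; apply/andP; split; [rewrite -ltNye (lt_le_trans _ H1)// ltNyr|rewrite -ltey (le_lt_trans H2)// ltry].
apply/fine_cvgP; split.
  by apply: filterS finm => h mh; rewrite fin_numM.
apply/cvgrPdist_le => e0 e00 /=.
pose e := Num.min 1 (e0 / 2).
have ep : 0 < e by rewrite lt_min ltr01 divr_gt0.
have e1 : e <= 1 by rewrite ge_min lexx.
have e2 : e <= e0 / 2 by rewrite ge_min lexx orbT.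
have [r [t0 [r0 t00 H]]] := bounds e ep e1.
near=> h.
have h0 : 0 < h by near: h.
have hr : h < r by near: h; exact: nbhs_right_lt.
have mh : m h \is a fin_num by near: h.
have [H1 H2] := H h h0 hr.
rewrite -(fineK mh) !lee_fin in H1 H2.
rewrite fineM//=; set M := fine (m h) in H1 H2 *.
have hs : h ^+ 2 < e0 / 2 / ((C + 1) / t0).
  have h2 : h < Num.min 1 (e0 / 2 / ((C + 1) / t0)).
    near: h; apply: nbhs_right_lt; rewrite lt_min ltr01 !divr_gt0//.
    by rewrite ltr_wpDl.
  move: h2; rewrite lt_min => /andP[h21 h22]; apply: le_lt_trans h22.
  by rewrite expr2 ger_pMr// ltW.
have q0 : (C + 1) / t0 * h ^+ 2 <= e0 / 2.
  by rewrite mulrC -ler_pdivlMr ?ltW// divr_gt0// ltr_wpDl.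
exact: (scaled_bounds h0 t00 C0 (ltW ep) e2 q0 H1 H2).
Unshelve. all: by end_near. Qed.

End BridgeRatio.

(** * Survival up to the final time *)

Section EndPoint.
Context {R : realType}.
Notation mu := (@lebesgue_measure R).
Notation p := (@bm_density R).
Implicit Types (s t z r : R).
Variables (y th r : R).
Hypothesis r_gt0 : 0 < r.
Hypothesis thP : th = 0 \/ th = 1 /\ r < y.

Let J : set R := `[y - r, y + r].

(** As [s] tends to [0] the Gaussian centred at [y] concentrates in [J], while the one
    centred at [- y] is at distance at least [r] from [J]. *)
Lemma end_mass s : 0 < s -> s <= r ^+ 2 / 32 ->
  2^-1 <= \int[mu]_z (\1_J z * reflected_kernel th s z y).
Proof.
move=> s0 sr; have r0 := r_gt0; have mJ : measurable J by exact: measurable_itv.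
have bJ : bounded_measurable 1 (\1_J : R -> R).
  split; first exact: measurable_indic.
  by move=> z; rewrite indicE ger0_norm// lern1 leq_b1.
have bc : bounded_measurable `|1 : R| (cst 1 : R -> R) by exact: bounded_measurable_cst.
have b1J : bounded_measurable 1 (cst 1 \- (\1_J : R -> R)).
  split; first by apply: measurable_funB => //; exact: bJ.1.
  by move=> z /=; rewrite indicE; case: (_ \in _); rewrite ?subrr ?subr0 ?normr0 ?normr1.
have tiny : Num.sqrt 2 * expR (- r ^+ 2 / (4 * s)) <= 4^-1.
  have s2 : Num.sqrt 2 <= 2 :> R by apply: sqrtr_le => //; lra.
  have e8 : expR (- r ^+ 2 / (4 * s)) <= 8^-1.
    rewrite mulNr; apply: le_trans (expRN_le_inv _) _; first by rewrite divr_gt0 ?mulr_gt0// exprn_gt0.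
    by rewrite invf_div ler_pdivrMr ?exprn_gt0//; lra.
  apply: (@le_trans _ _ (2 * 8^-1)); last lra.
  by apply: ler_pM => //; exact: expR_ge0.
have E : \int[mu]_z (\1_J z * reflected_kernel th s z y) = heat s \1_J y - th * heat s \1_J (- y).
  rewrite /heat -RintegralZl//; last exact: heat_integrable bJ.
  rewrite -RintegralB//; last 2 first.
  - exact: heat_integrable bJ.
  - have b2 : bounded_measurable `|th| (fun z => th * \1_J z).
      split; first by apply: measurable_funM => //; exact: bJ.1.
      by move=> z; rewrite normrM -[leRHS]mulr1; apply: ler_pM => //; exact: bJ.2.
    have := heat_integrable (- y) s0 b2; congr (_ .-integrable _ _).
    by apply/funext => z /=; rewrite mulrCA.
  apply: eq_Rintegral => z _; rewrite /reflected_kernel (bm_densityC _ z y) (bm_densityC _ z (- y)); ring.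
have H1 : 1 - heat s \1_J y <= 4^-1.
  rewrite -{1}(heat_cst 1 y s0) -(heatB y s0 bc bJ); apply: le_trans (ler_norm _) _.
  apply: le_trans tiny; rewrite -[leRHS]mul1r mulrA; apply: heat_far => //; first exact: ltW.
  move=> z zy; rewrite /= indicE mem_set ?subrr//= /J /= in_itv /=.
  by move: zy; rewrite ltr_norml => /andP[? ?]; apply/andP; split; lra.
have H2 : th * heat s \1_J (- y) <= 4^-1.
  case: thP => [->|[-> ry]]; first by rewrite mul0r.
  rewrite mul1r; apply: le_trans (ler_norm _) _.
  apply: le_trans tiny; rewrite -[leRHS]mul1r mulrA; apply: heat_far => //; first exact: ltW.
  move=> z zy; rewrite indicE memNset//= /J /= in_itv /= => /andP[z1 z2].
  by move: zy; rewrite ltr_norml => /andP[? ?]; lra.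
by rewrite E; lra.
Qed.

End EndPoint.

Section SurvivalToEnd.
Context {R : realType}.
Notation mu := (@lebesgue_measure R).
Notation p := (@bm_density R).
Implicit Types (s t z r : R).
Variables (c h T y th : R).
Hypothesis h_gt0 : 0 < h.
Hypothesis T_gt0 : 0 < T.
Hypothesis y_in : c - h < y < c + h.
Hypothesis thP : th = 0 \/ th = 1 /\ 0 < c - h.
Hypothesis kernelT_gt0 : 0 < reflected_kernel th T c y.
Hypothesis kernel_ge0 : forall dt a : R, 0 < dt -> c - h < a < c + h -> 0 <= reflected_kernel th dt a y.

(** Near [y] the image series stays bounded away from [0] up to time [T] by
    [Delta_lower_bound], and [end_mass] bounds the mass that the bridge density
    puts there. *)
Lemma survival_to_end : exists delta t0 : R, [/\ 0 < delta, t0 < T & forall t, t0 < t -> 0 < t -> t < T ->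
  (delta%:E <= \int[mu]_(z in `](- h)%R, h[) (bridge_ratio c T y th t (z + c) * Delta z h t)%:E)%E].
Proof.
have h0 := h_gt0; have T0 := T_gt0; have /andP[y1 y2] := y_in.
have yc : `|y - c| < h by rewrite ltr_norml; apply/andP; split; lra.
pose r := (h - `|y - c|) / 2; have r0 : 0 < r by rewrite divr_gt0// subr_gt0.
pose rho := `|y - c| + r.
have rho_lt : rho < h by rewrite /rho /r; lra.
have rho0 : 0 <= rho by rewrite addr_ge0// ltW.
have [k k0 Hk] := Delta_lower_bound h_gt0 rho0 rho_lt T_gt0.
pose k' := (Num.sqrt (2 * pi * T))^-1 * (expR (- (h ^+ 2 / T)) * k).
have k'0 : 0 < k' by rewrite !mulr_gt0 ?expR_gt0// invr_gt0 sqrtr_gt0 !mulr_gt0 ?pi_gt0.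
pose kT := reflected_kernel th T c y.
have thP' : th = 0 \/ th = 1 /\ r < y.
  case: thP => [->|[-> ch]]; [by left|right; split => //].
  have : - `|y - c| <= y - c by rewrite lerNl -normrN ler_norm.
  rewrite /r; lra.
pose J : set R := `[y - r, y + r]%classic.
have JI z : J z -> c - h < z < c + h /\ `|z - c| <= rho.
  rewrite /J /= in_itv /= => /andP[z1 z2].
  have zc : `|z - c| <= rho.
    have -> : z - c = (y - c) + (z - y) by ring.
    apply: le_trans (ler_normD _ _) _; rewrite /rho lerD2l ler_norml; apply/andP; split; lra.
  split => //; move: (le_lt_trans zc rho_lt); rewrite ltr_norml => /andP[? ?]; apply/andP; split; lra.
have mJ : measurable J by exact: measurable_itv.
exists (k' / kT * 2^-1), (Num.max (T / 2) (T - r ^+ 2 / 32)); split.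
- by rewrite !divr_gt0.
- by rewrite gt_max; apply/andP; split; [lra|rewrite gtrBl divr_gt0// exprn_gt0].
move=> t; rewrite gt_max => /andP[t1 t2] tp tT.
have s0 : 0 < T - t by rewrite subr_gt0.
have sr : T - t <= r ^+ 2 / 32 by lra.
have mass := end_mass r0 thP' s0 sr.
pose f z := \1_J z * reflected_kernel th (T - t) z y.
have f0 z : 0 <= f z.
  rewrite /f indicE; case: (boolP (z \in J)) => [/set_mem Jz|_]; last by rewrite mul0r.
  by rewrite mul1r; apply: kernel_ge0 => //; exact: (JI z Jz).1.
have mk : measurable_fun setT (fun z => reflected_kernel th (T - t) z y).
  apply: measurable_funB; last apply: measurable_funM => //; by apply: measurable_bm_density_joint.
have mf : measurable_fun setT f by apply: measurable_funM => //; exact: measurable_indic.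
have mass' : (2^-1%:E <= \int[mu]_z (f z)%:E)%E.
  move: mass; rewrite /Rintegral -/(f _).
  have : (0 <= \int[mu]_z (f z)%:E)%E by apply: integral_ge0 => z _; rewrite lee_fin.
  rewrite /f; case: (\int[mu]_z _)%E => [x|_ _|//]; first by rewrite lee_fin.
  by rewrite leey.
have Delta_ge z : `|z| <= rho -> k' <= Delta z h t.
  move=> zr; apply: le_trans (Hk z t zr tp (ltW tT)); rewrite /k'.
  have z2 : z ^+ 2 <= h ^+ 2.
    rewrite -(real_normK (num_real z)) ler_pXn2r ?nnegrE ?(ltW h_gt0)//.
    exact: le_trans (ltW rho_lt).
  apply: ler_pM.
  - by rewrite invr_ge0 sqrtr_ge0.
  - by rewrite mulr_ge0 ?expR_ge0// ltW.
  - rewrite lef_pV2 ?posrE ?sqrtr_gt0 ?mulr_gt0 ?pi_gt0//; apply: ler_wsqrtr.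
    by rewrite ler_pM2l ?mulr_gt0 ?pi_gt0// ltW.
  - rewrite ler_pM2r// ler_expR mulNr lerN2; apply: ler_pM; rewrite ?sqr_ge0//.
      by rewrite invr_ge0 mulr_ge0// ltW.
    by rewrite lef_pV2 ?posrE ?mulr_gt0//; lra.
have mratio : measurable_fun setT (fun z => bridge_ratio c T y th t (z + c)).
  by apply: measurable_funM => //; apply: (measurableT_comp mk); exact: measurable_funD.
apply: (@le_trans _ _ ((k' / kT)%:E * \int[mu]_z (f z)%:E)%E).
  by rewrite EFinM; apply: lee_wpmul2l => //; rewrite lee_fin divr_ge0// ltW.
rewrite -(integral_shift c (f := fun z => (f z)%:E)); last exact/measurable_EFinP.
rewrite -ge0_integralZl_EFin//; last 3 first.
- by move=> z _; rewrite lee_fin.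
- by apply/measurable_EFinP; apply: (measurableT_comp mf); exact: measurable_funD.
- by rewrite divr_ge0// ltW.
rewrite [leRHS]integral_mkcond; apply: ge0_le_integral => //.
- by move=> z _; rewrite mule_ge0// lee_fin// divr_ge0// ltW.
- by apply/measurable_EFinP; apply: measurable_funM => //; apply: (measurableT_comp mf); exact: measurable_funD.
- have mo : measurable (`]- h, h[%classic : set R) by exact: measurable_itv.
  apply/(measurable_restrictT _ mo)/measurable_EFinP; apply: measurable_funM.
    exact: measurable_funTS.
  apply: measurable_Delta => // z; rewrite /= in_itv /= => /andP[z1 z2].
  by split => //; rewrite ler_norml !ltW.
move=> z _; rewrite -EFinM patchE; case: ifPn => [/set_mem|].
  rewrite /= in_itv /= => /andP[z1 z2].
  have zh : `|z| < h by rewrite ltr_norml z1 z2.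
  rewrite lee_fin /f indicE; case: (boolP (_ \in _)) => [/set_mem /JI[_]|_].
    rewrite addrAC subrr add0r mul1r => zr; rewrite /bridge_ratio -/kT (addrC c).
    rewrite mulrAC [leRHS]mulrAC ler_pM2r ?invr_gt0// mulrC ler_wpM2l ?Delta_ge//.
    by apply: kernel_ge0 => //; apply/andP; split; lra.
  rewrite mul0r mulr0 mulr_ge0 ?(ltW (Delta_gt0 _ _ _))// divr_ge0 ?(ltW kernelT_gt0)//.
  by apply: kernel_ge0 => //; apply/andP; split; lra.
rewrite notin_setE /= in_itv /= => zn; rewrite /f indicE memNset ?mul0r ?mulr0// => /JI[/andP[? ?] _].
by apply: zn; apply/andP; split; lra.
Qed.

End SurvivalToEnd.

(** * Mean exit times of bridges *)

Section BridgeExit.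
Context {R : realType}.
Notation mu := (@lebesgue_measure R).
Implicit Types (s t z : R).
Variables (c h T y : R).
Hypothesis h_gt0 : 0 < h.
Hypothesis T_gt0 : 0 < T.
Context d (S : measurableType d) (P : probability S R).
Variables (D : set R) (q : R -> R -> R -> R) (X : R -> {RV P >-> R}).
Hypothesis HM : markov_process D q c X.
Variables (th w0 : R) (w : R -> R).
Hypothesis thP : th = 0 \/ th = 1 /\ 0 < c - h.
Hypothesis mw : measurable_fun setT w.
Hypothesis w0_gt0 : 0 < w0.
Hypothesis w_ge : forall z, c - h < z < c + h -> w0 <= w z.
Hypothesis ID : forall z, c - h < z < c + h -> D z.
Hypothesis qE : forall dt a z : R, 0 < dt -> c - h < a < c + h -> c - h < z < c + h ->
  q dt a z = w z / w a * reflected_kernel th dt a z.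
Hypothesis qyE : forall dt a : R, 0 < dt -> c - h < a < c + h ->
  q dt a y = w y / w a * reflected_kernel th dt a y.
Hypothesis wy_gt0 : 0 < w y.
Hypothesis kernel_ge0 : forall dt a : R, 0 < dt -> c - h < a < c + h -> 0 <= reflected_kernel th dt a y.
Hypothesis kernelT_gt0 : 0 < reflected_kernel th T c y.
Context d' (S' : measurableType d') (P' : probability S' R) (B : R -> {RV P' >-> R}).
Hypothesis HB : bridge_of X q T c y B.

Let B_start : {ae P', forall o, B 0 o = c}.
Proof. exact: (bridge_start h_gt0 T_gt0 HM w0_gt0 w_ge qyE wy_gt0 kernelT_gt0 HB). Qed.

Let B_cont o : {within `[0, T], continuous (fun t => B t o)}.
Proof. exact: (bridge_continuous HB). Qed.

Let stayE t := bridge_survival h_gt0 T_gt0 HM thP mw w0_gt0 w_ge ID qE qyE wy_gt0 kernel_ge0 kernelT_gt0 HB (t := t).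

Lemma bridge_mean_exit_time : ~ (c - h < y < c + h) ->
  mean_exit_time B T (c - h) (c + h) =
  (\int[mu]_(t in `]0%R, T[) \int[mu]_(z in `](- h)%R, h[)
     (bridge_ratio c T y th t (z + c) * Delta z h t)%:E)%E.
Proof.
move=> yI; rewrite (mean_exit_time_layer_cake T_gt0 h_gt0 (@B_cont) B_start).
  apply: eq_integral => t /set_mem; rewrite /= in_itv /= => /andP[t0 tT].
  exact: stayE.
by apply: filterS (bridge_end HB) => o ->.
Qed.

Lemma bridge_mean_exit_time_pinfty : c - h < y < c + h ->
  mean_exit_time B T (c - h) (c + h) = +oo%E.
Proof.
move=> yI.
have [delta [t0 [delta0 t0T H]]] := survival_to_end h_gt0 T_gt0 yI thP kernelT_gt0 kernel_ge0.
apply: (mean_exit_time_pinfty T_gt0 h_gt0 (@B_cont) t0T delta0).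
  by apply: filterS (bridge_end HB) => o ->.
by move=> t t0t tp tT; rewrite stayE//; exact: H.
Qed.

End BridgeExit.

Section Instances.
Context {R : realType}.
Notation mu := (@lebesgue_measure R).
Notation p := (@bm_density R).
Implicit Types (s t x y z h : R).
Variable T : R.
Hypothesis T_gt0 : 0 < T.
Context d (S : measurableType d) (P : probability S R) (B : R -> {RV P >-> R}).

Lemma bm_kernelE s x y : reflected_kernel 0 s x y = p s x y.
Proof. by rewrite /reflected_kernel mul0r subr0. Qed.

Lemma brownian_bridge_exit h y : 0 < h -> brownian_bridge T 0 y B ->
  (~ (- h < y < h) -> mean_exit_time B T (- h) h =
    (\int[mu]_(t in `]0%R, T[) \int[mu]_(z in `](- h)%R, h[)
       (bridge_ratio 0 T y 0 t (z + 0) * Delta z h t)%:E)%E) /\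
  (- h < y < h -> mean_exit_time B T (- h) h = +oo%E).
Proof.
move=> h0 [d' [S' [P' [X [HM HB]]]]].
have qE (dt a z : R) : p dt a z = cst 1 z / cst 1 a * reflected_kernel 0 dt a z.
  by rewrite bm_kernelE divr1 mul1r.
have kT : 0 < reflected_kernel 0 T 0 y by rewrite bm_kernelE bm_density_gt0.
have k0 (dt a : R) : 0 < dt -> 0 - h < a < 0 + h -> 0 <= reflected_kernel 0 dt a y.
  by move=> _ _; rewrite bm_kernelE bm_density_ge0.
have th0 : (0 : R) = 0 \/ (0 : R) = 1 /\ 0 < 0 - h by left.
have w1 z : 0 - h < z < 0 + h -> 1 <= (cst 1 : R -> R) z by [].
have I1 z : 0 - h < z < 0 + h -> setT z by [].
have m1 : measurable_fun setT (cst 1 : R -> R) by [].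
have := bridge_mean_exit_time_pinfty h0 T_gt0 HM th0 m1 ltr01 w1 I1 (fun dt a z _ _ _ => qE dt a z)
    (fun dt a _ _ => qE dt a y) ltr01 k0 kT HB.
have := bridge_mean_exit_time h0 T_gt0 HM th0 m1 ltr01 w1 I1 (fun dt a z _ _ _ => qE dt a z)
    (fun dt a _ _ => qE dt a y) ltr01 k0 kT HB.
by rewrite sub0r add0r.
Qed.

Lemma bes3_kernel_gt0 s x y : 0 < s -> 0 < x -> 0 < y -> 0 < reflected_kernel 1 s x y.
Proof.
move=> s0 x0 y0; rewrite /reflected_kernel mul1r subr_gt0 /bm_density ltr_pM2l; last first.
  by rewrite invr_gt0 sqrtr_gt0 !mulr_gt0// pi_gt0.
rewrite ltr_expR !mulNr ltrN2 ltr_pM2r ?invr_gt0 ?mulr_gt0//.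
nra.
Qed.

Lemma bes3_densityE s x y : bes3_density s x y = y / x * reflected_kernel 1 s x y.
Proof. by rewrite /bes3_density /reflected_kernel mul1r. Qed.

Lemma bessel3_bridge_exit h x y : 0 < h -> h < x -> 0 < y -> bessel3_bridge T x y B ->
  (~ (x - h < y < x + h) -> mean_exit_time B T (x - h) (x + h) =
    (\int[mu]_(t in `]0%R, T[) \int[mu]_(z in `](- h)%R, h[)
       (bridge_ratio x T y 1 t (z + x) * Delta z h t)%:E)%E) /\
  (x - h < y < x + h -> mean_exit_time B T (x - h) (x + h) = +oo%E).
Proof.
move=> h0 hx y0 [d' [S' [P' [X [HM HB]]]]].
have x0 : 0 < x by exact: lt_trans hx.
have xh : 0 < x - h by rewrite subr_gt0.
have kT := bes3_kernel_gt0 T_gt0 x0 y0.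
have k0 (dt a : R) : 0 < dt -> x - h < a < x + h -> 0 <= reflected_kernel 1 dt a y.
  by move=> dt0 /andP[/(lt_trans xh) a0 _]; apply/ltW/bes3_kernel_gt0.
have th1 : (1 : R) = 0 \/ (1 : R) = 1 /\ 0 < x - h by right.
have w1 z : x - h < z < x + h -> x - h <= (@id R) z by move=> /andP[/ltW].
have I1 z : x - h < z < x + h -> [set z | 0 < z] z by move=> /andP[/(lt_trans xh)].
have m1 : measurable_fun setT (@id R) by exact: measurable_id.
split=> yI.
  exact: (bridge_mean_exit_time h0 T_gt0 HM th1 m1 xh w1 I1 (fun dt a z _ _ _ => bes3_densityE dt a z)
    (fun dt a _ _ => bes3_densityE dt a y) y0 k0 kT HB yI).
exact: (bridge_mean_exit_time_pinfty h0 T_gt0 HM th1 m1 xh w1 I1 (fun dt a z _ _ _ => bes3_densityE dt a z)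
    (fun dt a _ _ => bes3_densityE dt a y) y0 k0 kT HB yI).
Qed.

End Instances.

Theorem theorem2p4 (R : realType) (T : R) (T_gt0 : 0 < T)
    (d : measure_display) (S : measurableType d) (P : probability S R)
    (B : R -> {RV P >-> R}) :
  (* (i) *)
  (forall y : R, brownian_bridge T 0 y B ->
    (forall h : R, 0 < h -> h <= `|y| ->
      mean_exit_time B T (- h) h =
      (\int[lebesgue_measure]_(t in `]0%R, T[)
         \int[lebesgue_measure]_(z in `](- h)%R, h[)
           (bm_density (T - t) z y / bm_density T 0 y * Delta z h t)%:E)%E) /\
    (y != 0 ->
      ((h ^- 2)%:E * mean_exit_time B T (- h) h)%E @[h --> 0^'+] --> 1%E)) /\
  (* (ii) *)
  (forall x y : R, 0 < x -> 0 < y -> bessel3_bridge T x y B ->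
    (forall h : R, 0 < h -> h < x -> ~ (x - h < y < x + h) ->
      mean_exit_time B T (x - h) (x + h) =
      (\int[lebesgue_measure]_(t in `]0%R, T[)
         \int[lebesgue_measure]_(z in `](- h)%R, h[)
           ((z + x) / x * Delta z h t *
            (bes3_density (T - t) (z + x) y / bes3_density T x y))%:E)%E) /\
    (y != x ->
      ((h ^- 2)%:E * mean_exit_time B T (x - h) (x + h))%E @[h --> 0^'+]
        --> 1%E)) /\
  (* (iii) *)
  (forall y h : R, 0 < h -> - h < y < h -> brownian_bridge T 0 y B ->
    mean_exit_time B T (- h) h = +oo%E) /\
  (forall x y h : R, 0 < h -> h < x -> 0 < y -> x - h < y < x + h ->
    bessel3_bridge T x y B -> mean_exit_time B T (x - h) (x + h) = +oo%E).
Proof.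
split; last split; last split.
- move=> y HB; have kT : 0 < reflected_kernel 0 T 0 y by rewrite bm_kernelE bm_density_gt0.
  have out h : h <= `|y| -> ~ (- h < y < h).
    by move=> hy /andP[y1 y2]; move: hy; rewrite leNgt ltr_norml y1 y2.
  split=> [h h0 hy|y0].
    rewrite (brownian_bridge_exit T_gt0 h0 HB).1; last exact: out.
    apply: eq_integral => t _; apply: eq_integral => z _.
    by rewrite /bridge_ratio !bm_kernelE addr0.
  have ny : 0 < `|y| by rewrite normr_gt0.
  apply: (@scaled_mean_cvg1 R 0 y T 0 T_gt0 (or_introl erefl) kT y0 `|y| ny _
    (fun h => mean_exit_time B T (- h) h)).
  + by move=> s z s0 _; rewrite bm_kernelE bm_density_ge0.
  + by move=> h h0 /ltW /out; exact: (brownian_bridge_exit T_gt0 h0 HB).1.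
- move=> x y x0 y0 HB; have kT := bes3_kernel_gt0 T_gt0 x0 y0.
  split=> [h h0 hx yI|yx].
    rewrite (bessel3_bridge_exit T_gt0 h0 hx y0 HB).1//.
    apply: eq_integral => t /set_mem; rewrite /= in_itv /= => /andP[t0 tT].
    apply: eq_integral => z /set_mem; rewrite /= in_itv /= => /andP[z1 z2]; congr EFin.
    have zx : z + x != 0 by rewrite lt0r_neq0//; lra.
    rewrite /bridge_ratio !bes3_densityE.
    by field; rewrite zx !lt0r_neq0.
  have nyx : 0 < `|y - x| by rewrite normr_gt0 subr_eq0.
  have h1_gt0 : 0 < Num.min x `|y - x| by rewrite lt_min x0.
  apply: (@scaled_mean_cvg1 R x y T 1 T_gt0 (or_intror erefl) kT yx _ h1_gt0 _
    (fun h => mean_exit_time B T (x - h) (x + h))).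
  + move=> s z s0 /andP[+ _]; rewrite ltrNl lt_min => /andP[zx _].
    by apply/ltW/bes3_kernel_gt0 => //; lra.
  + move=> h h0; rewrite lt_min => /andP[hx hyx]; apply: (bessel3_bridge_exit T_gt0 h0 hx y0 HB).1.
    move=> /andP[y1 y2]; move: hyx; rewrite ltNge => /negP; apply; apply/ltW.
    by rewrite ltr_norml; apply/andP; split; lra.
- by move=> y h h0 yI HB; exact: (brownian_bridge_exit T_gt0 h0 HB).2.
- by move=> x y h h0 hx y0 yI HB; exact: (bessel3_bridge_exit T_gt0 h0 hx y0 HB).2.
Qed.
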